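(* Let $k\ge1$ be an integer and consider a simple random walk on $\mathbb Z^2$ started at $(k,k)$ and killed upon hitting the origin. If $\Theta$ is the total winding angle of the walk around the origin and $[\Theta]\in\pi(\mathbb Z+\frac12)$ its value rounded to the nearest half-integer multiple of $\pi$, then for all $\beta\in\mathbb R$ $$\mathbb E\big[e^{i\beta[\Theta]}\big]=\cos\Big(\frac{\pi\beta}2\Big)\,h^\downarrow_{\cos(\pi\beta)}(k).$$ As a consequence $$\frac{\Theta}{\log k}\xrightarrow[k\to\infty]{(\mathrm d)}\mathcal C,$$ where $\mathcal C$ is a Cauchy random variable with density $\frac1\pi(1+x^2)^{-1}$ on $\mathbb R$.
   Context: The simple random walk has steps $(\pm1,0),(0,\pm1)$ with probability $\frac14$ each. The total winding angle $\Theta$ is the sum of the signed angle increments (in $(-\pi,\pi)$, as seen from the origin) of the walk from its start until its last position before hitting the origin. ''Half-integer multiple of $\pi$'' means an element of $\pi(\mathbb Z+\frac12)$. The functions $h^\downarrow_{\mathfrak p}:\mathbb Z_{\ge0}\to\mathbb R$, $\mathfrak p\in[-1,1]$: $h^\downarrow_{\mathfrak p}(0)=1$ and for $p\ge1$ $$h^\downarrow_{\mathfrak p}(p)=\frac1{1+\mathfrak p}\frac{\Gamma(b)}{\Gamma(2p+1)\Gamma(b-2p)}\,{}_2F_1(-2p,b-1;b-2p;-1)\quad(\mathfrak p\in(-1,1),\ b=\tfrac1\pi\arccos\mathfrak p),$$ $$h^\downarrow_1(p)=1,\qquad h^\downarrow_{-1}(p)=\frac4{\pi^2p}\sum_{k=1}^p\frac1{2k-1}.$$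 *)

(* Defs.v *)
From HB Require Import structures.
From mathcomp Require Import all_boot all_order all_algebra.
From mathcomp Require Import all_classical all_reals all_analysis.
From mathcomp Require Import measurable_realfun.
From mathcomp Require Import ring lra.
From mathcomp Require Import complex.

Set Implicit Arguments.
Unset Strict Implicit.
Unset Printing Implicit Defensive.

Import Order.TTheory GRing.Theory Num.Theory.
Import numFieldNormedType.Exports.

Local Open Scope classical_set_scope.
Local Open Scope ring_scope.

Section SpecialFunctions.
Context {R : realType}.
Implicit Types (a b c x z p : R) (n l : nat).

(* Euler-Gauss limit: unlike the integral it also covers negative non-integer
   arguments, such as [b - 2l] in [h_down]. *)
Definition Gamma x : R :=
  limn (fun n => n%:R `^ x * n`!%:R / \prod_(0 <= i < n.+1) (x + i%:R)).

Definition rising_factorial x n : R := \prod_(0 <= i < n) (x + i%:R).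

Definition hyp2F1 a b c z : R :=
  limn (series (fun n => rising_factorial a n * rising_factorial b n
                         / rising_factorial c n * (z ^+ n / n`!%:R))).

(* Only meaningful for [-1 <= p <= 1]. *)
Definition h_down p l : R :=
  if l == 0%N then 1
  else if p == 1 then 1
  else if p == -1 then
    4 / (pi ^+ 2 * l%:R) * \sum_(1 <= k < l.+1) (2 * k%:R - 1)^-1
  else
    let b := acos p / pi in
    (1 + p)^-1
    * (Gamma b / (Gamma (2 * l%:R + 1) * Gamma (b - 2 * l%:R)))
    * hyp2F1 (- (2 * l%:R)) (b - 1) (b - 2 * l%:R) (-1).

End SpecialFunctions.

Notation Z2 := (int * int)%type.

Definition unit_steps : seq Z2 := [:: (1, 0); (-1, 0); (0, 1); (0, -1)].

Section Walk.
Context d (T : measurableType d).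
Implicit Types (S : nat -> T -> Z2) (w : T).

Definition increment S n w : Z2 := S n.+1 w - S n w.

(* Z^2 is discrete, so independence of the increments quantifies over all
   families of subsets. *)
Record simple_random_walk (R : realType) (P : probability T R) (z0 : Z2) S
    : Prop := SimpleRandomWalk {
  srw_start : forall w, S 0%N w = z0 ;
  srw_measurable : forall n z, measurable (S n @^-1` [set z]) ;
  srw_uniform : forall n (e : Z2), e \in unit_steps ->
    P (increment S n @^-1` [set e]) = (1 / 4)%:E ;
  srw_independent : forall (J : seq nat) (A : nat -> set Z2), uniq J ->
    P (\bigcap_(j in [set` J]) (increment S j @^-1` A j)) =
    (\prod_(j <- J) P (increment S j @^-1` A j))%E
}.

(* The junk value 0 is only taken on the null event of never hitting 0. *)
Definition hitting_time S w : nat :=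
  if pselect (exists n, S n w == 0) is left h then ex_minn h else 0%N.

End Walk.

Section Winding.
Context {R : realType}.

Definition znorm (u : Z2) : R := Num.sqrt (u.1 ^+ 2 + u.2 ^+ 2)%:~R.

(* Signed angle at the origin from [u] to [v], counterclockwise positive. It
   lies in (-pi, pi) and would be 0 for opposite vectors, but no segment
   between two nonzero neighbours of the lattice contains the origin. *)
Definition signed_angle (u v : Z2) : R :=
  (Num.sg (u.1 * v.2 - u.2 * v.1))%:~R
  * acos ((u.1 * v.1 + u.2 * v.2)%:~R / (znorm u * znorm v)).

(* With t the hitting time, the last position before the origin is S_(t-1). *)
Definition winding_angle d (T : measurableType d) (S : nat -> T -> Z2) (w : T)
    : R :=
  \sum_(0 <= n < (hitting_time S w).-1) signed_angle (S n w) (S n.+1 w).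

(* Nearest element of pi * (Z + 1/2); rounds up at the midpoints pi * Z. *)
Definition round_half_pi (x : R) : R :=
  pi * ((Num.floor (x / pi))%:~R + 1 / 2).

Lemma round_half_pi_nearest (x : R) (m : int) :
  `|x - round_half_pi x| <= `|x - pi * (m%:~R + 1 / 2)|.
Proof.
have pi0 := @pi_gt0 R.
rewrite /round_half_pi -[x in `|x - _|](divfK (lt0r_neq0 pi0)).
rewrite -[x in leRHS](divfK (lt0r_neq0 pi0)) (mulrC _ pi) -!mulrBr !normrM.
apply: ler_wpM2l => //; set y := x / pi.
have yl : (Num.floor y)%:~R <= y by exact: floor_le.
have yu : y < (Num.floor y)%:~R + 1 by rewrite -intrD1 floorD1_gt.
have [->//|] := eqVneq m (Num.floor y).
move=> m_neq; apply: (@le_trans _ _ (1 / 2)); first by rewrite ler_norml; lra.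
have [mf|fm|mf] := ltgtP m (Num.floor y).
- have : m%:~R + 1 <= (Num.floor y)%:~R :> R by rewrite -intrD1 ler_int lezD1.
  by move=> ?; rewrite ler_normr; apply/orP; left; lra.
- have : (Num.floor y)%:~R + 1 <= m%:~R :> R by rewrite -intrD1 ler_int lezD1.
  by move=> ?; rewrite ler_normr; apply/orP; right; lra.
- by rewrite mf eqxx in m_neq.
Qed.

End Winding.

Section ComplexExpectation.
Context {R : realType}.

Definition cis (t : R) : R[i] := Complex (cos t) (sin t).

Definition complex_expectation d (T : measurableType d) (P : probability T R)
    (Z : T -> R[i]) : R[i] :=
  Complex (fine ('E_P[fun w => complex.Re (Z w)])%E)
          (fine ('E_P[fun w => complex.Im (Z w)])%E).

End ComplexExpectation.

Section Cauchy.
Context {R : realType}.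
Notation mu := (@lebesgue_measure R).

Definition cauchy_pdf (x : R) : R := pi^-1 * (1 + x ^+ 2)^-1.

Lemma cauchy_pdf_ge0 x : 0 <= cauchy_pdf x.
Proof.
by rewrite mulr_ge0// invr_ge0 ?pi_ge0// addr_ge0// sqr_ge0.
Qed.

Lemma continuous_cauchy_pdf : continuous cauchy_pdf.
Proof.
move=> x; apply: cvgM; first exact: cvg_cst.
exact: continuous_oneDsqrV.
Qed.

Lemma measurable_cauchy_pdf : measurable_fun [set: R] cauchy_pdf.
Proof. by apply: continuous_measurable_fun; exact: continuous_cauchy_pdf. Qed.

Definition cauchy_prob (A : set R) : \bar R :=
  (\int[mu]_(x in A) (cauchy_pdf x)%:E)%E.

Let cauchy0 : cauchy_prob set0 = 0%E.
Proof. by rewrite /cauchy_prob integral_set0. Qed.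

Let cauchy_ge0 A : (0 <= cauchy_prob A)%E.
Proof. by apply: integral_ge0 => x _; rewrite lee_fin cauchy_pdf_ge0. Qed.

Let cauchy_sigma_additive : semi_sigma_additive cauchy_prob.
Proof.
move=> /= F mF tF mUF; rewrite /cauchy_prob; apply: cvg_toP.
  apply: ereal_nondecreasing_is_cvgn => m n mn.
  apply: lee_sum_nneg_natr => // k _ _; apply: integral_ge0 => /= x Fkx.
  by rewrite lee_fin cauchy_pdf_ge0.
rewrite ge0_integral_bigcup//=.
- apply/measurable_funTS/measurableT_comp => //; exact: measurable_cauchy_pdf.
- by move=> x _; rewrite lee_fin cauchy_pdf_ge0.
Qed.

HB.instance Definition _ := isMeasure.Build _ _ _
  cauchy_prob cauchy0 cauchy_ge0 cauchy_sigma_additive.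

Let cauchy_setT : cauchy_prob [set: R] = 1%E.
Proof.
rewrite /cauchy_prob ge0_symfun_integralT//=; last 3 first.
- exact: cauchy_pdf_ge0.
- exact: continuous_cauchy_pdf.
- by move=> x/=; rewrite /cauchy_pdf sqrrN.
rewrite (_ : [set x | _] = `[0, +oo[%classic); last first.
  by apply/seteqP; split => x/=; rewrite in_itv/= andbT.
under eq_integral do rewrite /cauchy_pdf EFinM.
rewrite ge0_integralZl//=; last 3 first.
- apply/measurable_EFinP; apply: measurable_funTS.
  by apply: continuous_measurable_fun; exact: continuous_oneDsqrV.
- by move=> x _; rewrite lee_fin invr_ge0 addr_ge0// sqr_ge0.
- by rewrite lee_fin invr_ge0 pi_ge0.
rewrite [X in (_ * (_ * X))%E](@integral0y_oneDsqr R) -!EFinM; congr EFin.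
have pi_neq0 : pi != 0 :> R by rewrite lt0r_neq0// pi_gt0.
by rewrite mulKf// mulfV// pnatr_eq0.
Qed.

HB.instance Definition _ :=
  @Measure_isProbability.Build _ _ R cauchy_prob cauchy_setT.

End Cauchy.

(* Weak convergence of the laws of the [X n], which may live on different
   spaces. The [X n] are plain functions: winding angles are measurable as
   functions of a walk, but are not packaged as random variables. *)
Definition cvg_in_distribution (R : realType) (d : nat -> measure_display)
    (T : forall n, measurableType (d n)) (P : forall n, probability (T n) R)
    (X : forall n, T n -> R) (Q : probability R R) : Prop :=
  forall f : R -> R, continuous f -> (exists M : R, forall x, `|f x| <= M) ->
    ('E_(P n)[f \o X n] @[n --> \oo] --> \int[Q]_x (f x)%:E)%E.

(* Main.v *)
Require Import Defs.
From HB Require Import structures.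
From mathcomp Require Import all_boot all_order all_algebra.
From mathcomp Require Import all_classical all_reals all_analysis.
From mathcomp Require Import complex.
From mathcomp Require Import measurable_realfun.
From mathcomp Require Import zify ring lra.

Set Implicit Arguments.
Unset Strict Implicit.
Unset Printing Implicit Defensive.

Import Order.TTheory GRing.Theory Num.Theory.
Import numFieldNormedType.Exports.

Local Open Scope classical_set_scope.
Local Open Scope ring_scope.

(* Rotate the lattice by 45 degrees, so that the steps are (+-1, +-1), and fold
   the plane onto the upper half-plane [v >= 0]: the walk becomes a walk in the
   half-plane together with the number [m] of half turns, and the rounded angle
   is pi (m + 1/2) at the hitting time of the origin. With [a = 1 - beta], [s =
   sin (pi beta / 2)] and [T = tan (pi / 4 - t / 2)], the function
     e^(i pi beta (m + 1/2)) (s / pi) \int_0^pi cot(t/2)^a T^v e^(-i u t) dt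
   is bounded by 1 and harmonic for this walk: inside the half-plane because
   (1 + T^2) cos t = 2 T, on the axis because the integrals of
   cot(t/2)^a cos(n t + pi a / 2), n >= 1, vanish. At the origin it is
   e^(i pi beta (m + 1/2)), so its value at the starting point is the wanted
   expectation, as soon as the origin is hit almost surely; this follows by
   letting beta tend to 0. For n = 2k the integral of
   cot(t/2)^a sin(n t + pi a / 2) is, up to a factor, the coefficient of x^n in
   ((1 + x) / (1 - x))^a, which is also the value of the hypergeometric formula.
   Evenness and (anti)periodicity in beta give all other beta.

   The three-term recurrence of these coefficients yields the limit e^(-t) of
   the characteristic functions at t / log k. Convergence in law follows by
   smoothing test functions with a Cauchy kernel, whose Fourier transform is
   an exponential, so that no general Levy theorem is needed. *)

(** * The integrals against cot (t / 2) ^ a *)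

(** Any weight in t would give a function harmonic off the axis. The weight cot(t/2)^a is chosen so
    that the sheets glue along the axis, where a half turn costs the phase pi beta; it is integrable
    at 0 only for a < 1, whence beta > 0. Every relation between the integrals comes from a single
    integration by parts, which gives recurrences but no values. The missing constants are found as
    in Wallis' product: if W(m) is the integral of cot(t/2)^a sin^m and C(m) that of cos^m t cos(a
    t) over [0, pi/2], then (m + 1) W(m + 1) C(m) is unchanged when m grows by 2 and tends to pi, so
    it is pi; C(0) and C(1) are elementary. Absorption at the origin uses the same function. It is
    small high above the axis, and the unstopped height is a simple walk on Z, which leaves every
    bounded band in probability. Its mean at time n is therefore at most the probability of
    absorption by time n, up to a small error, while its initial value is close to 1 for small
    beta. *)

Section RealIntegrable.
Context d (T : measurableType d) (R : realType) (mu : {measure set T -> \bar R}).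
Variables (D : set T) (mD : measurable D).
Implicit Types f g : T -> R.

Lemma integrable_EFinZl k f : mu.-integrable D (EFin \o f) ->
  mu.-integrable D (EFin \o (fun x => k * f x)).
Proof. by move=> fi; have := integrableZl mD k fi. Qed.

Lemma integrable_EFinD f g : mu.-integrable D (EFin \o f) ->
  mu.-integrable D (EFin \o g) -> mu.-integrable D (EFin \o (fun x => f x + g x)).
Proof. by move=> fi gi; have := integrableD mD fi gi. Qed.

Lemma integrable_EFinB f g : mu.-integrable D (EFin \o f) ->
  mu.-integrable D (EFin \o g) -> mu.-integrable D (EFin \o (fun x => f x - g x)).
Proof. by move=> fi gi; have := integrableB mD fi gi. Qed.

Lemma integrable_EFin_le f g : measurable_fun D f -> (forall x, D x -> `|f x| <= g x) ->
  mu.-integrable D (EFin \o g) -> mu.-integrable D (EFin \o f).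
Proof.
move=> mf fg; apply: le_integrable => //; first exact/measurable_EFinP.
by move=> x Dx /=; rewrite lee_fin (le_trans (fg x Dx))// ler_norm.
Qed.

End RealIntegrable.

Section CotInt.
Context {R : realType}.
Notation mu := (@lebesgue_measure R).

Lemma FTC2_is_derive (F f : R -> R) (a b : R) : a < b ->
    (forall x, a <= x <= b -> is_derive x 1 F (f x)) ->
    (forall x, a <= x <= b -> {for x, continuous f}) ->
  mu.-integrable `[a, b] (EFin \o f) /\
  \int[mu]_(x in `[a, b]) f x = F b - F a.
Proof.
move=> ab dF cf.
have cfw : {within `[a, b], continuous f}.
  apply: continuous_in_subspaceT => x /set_mem; rewrite /= in_itv /= => xab.
  exact: cf.
have Fc x : a <= x <= b -> {for x, continuous F}.
  move=> xab; apply/differentiable_continuous/derivable1_diffP.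
  by have := dF x xab => -[].
split.
  by apply: continuous_compact_integrable => //; exact: segment_compact.
rewrite /Rintegral (@continuous_FTC2 _ f F)//.
- split.
  + move=> x; rewrite in_itv/= => /andP[ax xb].
    by have := dF x; rewrite !ltW// => /(_ isT)[].
  + by apply: cvg_at_right_filter; apply: Fc; rewrite lexx ltW.
  + by apply: cvg_at_left_filter; apply: Fc; rewrite lexx ltW.
- move=> x; rewrite in_itv/= => /andP[ax xb]; rewrite derive1E.
  by have := dF x; rewrite !ltW// => /(_ isT) h; rewrite derive_val.
Qed.

Let I (n : nat) : set R := `[n.+2%:R^-1, pi - n.+2%:R^-1]%classic.
Let D : set R := `]0, pi[%classic.

Lemma exhaustion_sub n : I n `<=` D.
Proof.
move=> x; rewrite /I /D /= !in_itv/= => /andP[h1 h2].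
have : 0 < n.+2%:R^-1 :> R by rewrite invr_gt0.
by move: h1 h2; set e := (_^-1) => h1 h2 e0; apply/andP; split; lra.
Qed.

Lemma exhaustion_near x : D x -> \forall n \near \oo, I n x.
Proof.
rewrite /D /= in_itv/= => /andP[x0 xpi].
have c : (n.+2%:R^-1 : R) @[n --> \oo] --> (0 : R).
  by have := @cvg_harmonic R; rewrite -cvg_shiftS; apply.
have h1 := cvgr_lt _ c x x0.
have h2 : 0 < pi - x by rewrite subr_gt0.
have h3 := cvgr_lt _ c _ h2.
near=> n; rewrite /I /= in_itv/=; apply/andP; split.
  by apply/ltW; near: n; exact: h1.
have : n.+2%:R^-1 < pi - x by near: n; exact: h3.
by set e := (_^-1) => h; lra.
Unshelve. all: by end_near. Qed.

Lemma exhaustion_lt : \forall n \near \oo, n.+2%:R^-1 < pi - n.+2%:R^-1 :> R.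
Proof.
have p : D (pi / 2).
  by rewrite /D /= in_itv/=; have := @pi_gt0 R => ?; apply/andP; split; lra.
near=> n.
have n0 : n.+2%:R^-1 < 1 :> R by rewrite invf_lt1// ltr1n.
have := @pihalf_ge1 R; move: n0; set e := (_^-1) => n0 h; lra.
Unshelve. all: by end_near. Qed.

Lemma measurable_exhaustion n : measurable (I n). Proof. exact: measurable_itv. Qed.

Lemma cvg_Rintegral_exhaustion (f : R -> R) : mu.-integrable D (EFin \o f) ->
  \int[mu]_(x in I n) f x @[n --> \oo] --> \int[mu]_(x in D) f x.
Proof.
move=> fi.
have mf : measurable_fun D (EFin \o f) by case/integrableP : fi.
have e n : \int[mu]_(x in I n) f x = \int[mu]_(x in D) (f \_ (I n)) x.
  by rewrite -Rintegral_mkcondr; congr Rintegral; rewrite setIidr//; exact: exhaustion_sub.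
have [|||||_ _] := @dominated_convergence _ _ R mu D (measurable_itv _)
   (fun n => EFin \o (f \_ (I n))) (EFin \o f) (abse \o (EFin \o f)).
- move=> n; apply/measurable_EFinP/measurable_restrict; [exact: measurable_itv|exact: measurable_itv|].
  by apply: (@measurable_funS _ _ _ _ D) => //; [exact: measurable_itv|exact/measurable_EFinP].
- exact: mf.
- apply: aeW => x Dx; apply: cvg_near_cst.
  have := exhaustion_near Dx; apply: filterS => n Ix /=.
  by rewrite patchE mem_set.
- exact: integrable_abse.
- apply: aeW => x n Dx /=; rewrite patchE; case: ifP => //= _.
  by rewrite normr0 lee_fin.
move=> h.
under eq_fun do rewrite e.
rewrite /Rintegral; apply: fine_cvg; rewrite fineK//.
by apply: (integrable_fin_num _ fi); exact: measurable_itv.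
Qed.

(** Monotone convergence along the compact pieces. It serves for functions such as cot(t/2)^a, which
    blow up at 0 and have no explicit primitive. *)
Lemma integrable_exhaustion (f : R -> R) (B : R) : measurable_fun D f ->
  (forall x, D x -> 0 <= f x) ->
  (\forall n \near \oo, mu.-integrable (I n) (EFin \o f) /\ \int[mu]_(x in I n) f x <= B) ->
  mu.-integrable D (EFin \o f).
Proof.
move=> mf f0 fB.
have DI : D = \bigcup_n I n.
  apply/seteqP; split => [x Dx|x [n _]]; last exact: exhaustion_sub.
  have [n _ h] := exhaustion_near Dx; exists n => //; exact: (h n (leqnn n)).
apply/integrableP; split; first exact/measurable_EFinP.
have -> : (\int[mu]_(x in D) `|(EFin \o f) x| = \int[mu]_(x in D) (EFin \o f) x)%E.
  by apply: eq_integral => x /set_mem Dx /=; rewrite ger0_norm ?f0.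
have ndI : nondecreasing_seq I.
  move=> m n mn; apply/subsetPset => x; rewrite /I /= !in_itv/= => /andP[h1 h2].
  have h : n.+2%:R^-1 <= m.+2%:R^-1 :> R by rewrite lef_pV2 ?posrE// ler_nat.
  by move: h1 h2 h; set e1 := (_^-1); set e2 := (_^-1) => h1 h2 h; apply/andP; split; lra.
have c : (\int[mu]_(x in I i) (EFin \o f) x @[i --> \oo] -->
    \int[mu]_(x in \bigcup_i I i) (EFin \o f) x)%E.
  apply: ge0_nondecreasing_set_cvg_integral => //.
  - exact: measurable_exhaustion.
  - move=> n; apply/measurable_EFinP; apply: measurable_funS mf => //; first exact: measurable_itv.
    exact: exhaustion_sub.
  - by move=> n x /exhaustion_sub; rewrite lee_fin; exact: f0.
rewrite DI; apply: (@le_lt_trans _ _ B%:E); last exact: ltry.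
apply: (cvge_le _ c).
near=> n.
have [fi fle] : mu.-integrable (I n) (EFin \o f) /\ \int[mu]_(x in I n) f x <= B by near: n; exact: fB.
rewrite -[leLHS]fineK ?lee_fin//.
by apply: (integrable_fin_num _ fi); exact: measurable_exhaustion.
Unshelve. all: by end_near. Qed.

(** Bernoulli's inequality, from 1 + y <= exp y used twice: with z = ln x, the two bounds get the
    weights a and 1 - a, and the terms a (1 - a) z cancel. Later estimates on powers use concavity
    in this form. *)
Lemma powR_le_affine (x a : R) : 0 < x -> 0 <= a <= 1 -> x `^ a <= 1 + a * (x - 1).
Proof.
move=> x0 /andP[a0 a1].
rewrite /powR gt_eqF//; set z := ln x.
have -> : x = expR z by rewrite /z lnK.
have h1 : expR (a * z) * (1 + (1 - a) * z) <= expR z.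
  rewrite [leRHS](_ : _ = expR (a * z) * expR ((1 - a) * z)).
    by rewrite ler_pM2l ?expR_gt0// expR_ge1Dx.
  by rewrite -expRD; congr expR; ring.
have h2 : expR (a * z) * (1 - a * z) <= 1.
  rewrite [leRHS](_ : _ = expR (a * z) * expR (- (a * z))).
    by rewrite ler_pM2l ?expR_gt0// expR_ge1Dx.
  by rewrite -expRD subrr expR0.
have := ler_wpM2l a0 h1.
have : 0 <= 1 - a by lra.
move=> /ler_wpM2l /(_ _ _ h2).
move: (expR (a * z)) (expR z) => A B; nra.
Qed.

(** This is cot (t / 2), written without the half angle so that [cos2Dsin2] settles its
    identities. *)
Definition cot_half (t : R) : R := (1 + cos t) / sin t.
Definition cot_pow (a t : R) : R := cot_half t `^ a.

Lemma sin_itv_gt0 t : D t -> 0 < sin t.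
Proof. by rewrite /D /= in_itv/=; exact: sin_gt0_pi. Qed.

Lemma onepcos_gt0 t : D t -> 0 < 1 + cos t.
Proof.
move=> /sin_itv_gt0 s0; have := cos2Dsin2 t; have := cos_le1 t; have := cos_geN1 t.
by move: s0; set s := sin t; set c := cos t; move=> *; nra.
Qed.

Lemma cot_half_gt0 t : D t -> 0 < cot_half t.
Proof. by move=> Dt; rewrite divr_gt0// ?onepcos_gt0// sin_itv_gt0. Qed.

Lemma cot_pow_gt0 a t : D t -> 0 < cot_pow a t.
Proof. by move=> Dt; rewrite powR_gt0// cot_half_gt0. Qed.

Lemma is_derive_cot_half t : D t -> is_derive t 1 cot_half (- (cot_half t / sin t)).
Proof.
move=> Dt; have s0 := sin_itv_gt0 Dt.
have h : is_derive t 1 (fun x => (sin x)^-1) (- (sin t) ^- 2 *: cos t).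
  by apply: is_deriveV; rewrite gt_eqF.
have h2 : is_derive t 1 (fun x : R => 1 + cos x) (- sin t).
  have := is_deriveD (is_derive_cst (1 : R) t 1) (is_derive_cos t).
  by rewrite add0r.
apply: (@is_derive_eq _ _ _ ((fun x : R => 1 + cos x) * (fun x => (sin x)^-1))).
have := cos2Dsin2 t; rewrite /cot_half /GRing.scale /=.
have : sin t != 0 by rewrite gt_eqF.
move: (sin t) (cos t) => s c s00 h1.
transitivity (- (c + (c ^+ 2 + s ^+ 2)) / s ^+ 2); first by field.
by rewrite h1; field.
Qed.

Lemma is_derive_cot_pow a t : D t ->
  is_derive t 1 (cot_pow a) (- (a * cot_pow a t / sin t)).
Proof.
move=> Dt; have X0 := cot_half_gt0 Dt; have s0 := sin_itv_gt0 Dt.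
have h1 := is_derive_cot_half Dt.
have h2 : is_derive (cot_half t) 1 (fun x => x `^ a) (a * cot_half t `^ (a - 1)).
  exact: is_derive1_powR.
have h3 := @is_derive1_comp _ _ _ _ _ _ h2 h1.
apply: is_derive_eq.
rewrite /cot_pow powRB; last by rewrite (gt_eqF X0) implybT.
rewrite powRr1 ?ltW//; field.
by rewrite !gt_eqF.
Qed.

Lemma continuous_cot_pow a t : D t -> {for t, continuous (cot_pow a)}.
Proof.
move=> Dt; apply/differentiable_continuous/derivable1_diffP.
by have [] := is_derive_cot_pow a Dt.
Qed.

Lemma measurable_cot_pow a : measurable_fun D (cot_pow a).
Proof.
apply: open_continuous_measurable_fun; first exact: interval_open.
by move=> t /set_mem; exact: continuous_cot_pow.
Qed.

(** The derivative of cot(t/2)^a is -a cot(t/2)^a / sin t; the factor sin t removes this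
    denominator. *)
Lemma is_derive_by_parts a (g dg : R -> R) t : D t -> is_derive t 1 g (dg t) ->
  is_derive t 1 (fun x => cot_pow a x * (sin x * g x))
    (cot_pow a t * ((cos t - a) * g t + sin t * dg t)).
Proof.
move=> Dt dgt; have s0 := sin_itv_gt0 Dt.
have h1 := is_derive_cot_pow a Dt.
apply: is_derive_eq; rewrite /GRing.scale/=; field.
by rewrite gt_eqF.
Qed.

(** The product is (1 + cos t)^a (sin t)^(1 - a), and the first factor is at most 2. For a < 1 it
    follows that boundary terms vanish at both ends. *)
Lemma cot_pow_sin_le a t : 0 <= a <= 1 -> D t -> 0 <= cot_pow a t * sin t <= 2 * sin t `^ (1 - a).
Proof.
move=> /andP[a0 a1] Dt; have s0 := sin_itv_gt0 Dt.
rewrite mulr_ge0 ?powR_ge0 ?(ltW s0)//=.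
have -> : cot_pow a t * sin t = (1 + cos t) `^ a * sin t `^ (1 - a).
  rewrite /cot_pow /cot_half powRM ?invr_ge0 ?(ltW s0) ?(ltW (onepcos_gt0 Dt))//.
  rewrite -powR_inv1 ?(ltW s0)// -powRrM mulN1r powRB ?(gt_eqF s0) ?implybT//.
  by rewrite powRr1 ?(ltW s0)// powRN -mulrA (mulrC _ (sin t)).
rewrite ler_wpM2r ?powR_ge0//.
have := cos_le1 t => c1.
have h : 0 <= a <= 1 by rewrite a0.
apply: (le_trans (powR_le_affine (onepcos_gt0 Dt) h)).
by nra.
Qed.

Lemma cvg_sin_exhaustion_l : sin (n.+2%:R^-1) @[n --> \oo] --> (0 : R).
Proof.
have c : (n.+2%:R^-1 : R) @[n --> \oo] --> (0 : R).
  by have := @cvg_harmonic R; rewrite -cvg_shiftS; apply.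
rewrite -[X in _ --> X]sin0; apply: continuous_cvg => //; exact: continuous_sin.
Qed.

Lemma sin_exhaustion_r n : sin (pi - n.+2%:R^-1) = sin (n.+2%:R^-1) :> R.
Proof. by rewrite sinB sinpi cospi mul0r sub0r mulN1r opprK. Qed.

Lemma exhaustion_endpoints n : D (n.+2%:R^-1) /\ D (pi - n.+2%:R^-1).
Proof.
have n0 : n.+2%:R^-1 < 1 :> R by rewrite invf_lt1// ltr1n.
have n1 : 0 < n.+2%:R^-1 :> R by rewrite invr_gt0.
have := @pihalf_ge1 R; move: n0 n1; rewrite /D /= !in_itv/=; set e := (_^-1) => n0 n1 h.
by split; apply/andP; split; lra.
Qed.

Lemma cvg_boundary a (g : R -> R) (M : R) (u : nat -> R) : 0 <= a < 1 -> (forall t, `|g t| <= M) ->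
  (forall n, D (u n) /\ sin (u n) = sin (n.+2%:R^-1)) ->
  cot_pow a (u n) * (sin (u n) * g (u n)) @[n --> \oo] --> (0 : R).
Proof.
move=> /andP[a0 a1] gM Du.
have c : (2 * M * sin (n.+2%:R^-1) `^ (1 - a)) @[n --> \oo] --> (0 : R).
  rewrite -[X in _ --> X](mulr0 (2 * M)); apply: cvgMr.
  have : (fun x => x `^ (1 - a)) x @[x --> 0^'+] --> (0 : R) by apply: powR_cvg0; lra.
  move=> /cvg_at_rightP; apply; split; last exact: cvg_sin_exhaustion_l.
  by move=> n; apply: sin_itv_gt0; case: (exhaustion_endpoints n).
apply: norm_cvg0; apply: (@squeeze_cvgr _ _ _ _ (cst 0) _ _ _ _ _ c); last exact: cvg_cst.
apply: nearW => n /=; rewrite normr_ge0/= mulrA normrM.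
have [Dun <-] := Du n.
have h : 0 <= a <= 1 by rewrite a0 ltW.
have /andP[p1 p2] := cot_pow_sin_le h Dun.
rewrite (ger0_norm p1).
have M0 : 0 <= M by apply: le_trans (gM 0).
have := gM (u n); have := normr_ge0 (g (u n)); have := powR_ge0 (sin (u n)) (1 - a).
move: p1 p2 M0; set A := _ * _; set B := _ `^ _; set G := `|_|; nra.
Qed.

Lemma cot_half_sqr t : D t -> cot_half t ^+ 2 = (1 + cos t) / (1 - cos t).
Proof.
move=> Dt; have c0 := onepcos_gt0 Dt; have s0 := sin_itv_gt0 Dt.
have h := cos2Dsin2 t.
have c1 : 0 < 1 - cos t by move: c0 s0 h; set c := cos t; set s := sin t => *; nra.
have sE : sin t ^+ 2 = (1 - cos t) * (1 + cos t) by rewrite sin2cos2; ring.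
rewrite /cot_half expr_div_n sE; field.
by rewrite !gt_eqF.
Qed.

(* Where [cos t >= (1 + a) / 2] the derivative of [cot_pow a * sin] controls
   [cot_pow a]; elsewhere [cot_pow a] is bounded. *)
Lemma cot_pow_le_derive a t : 0 <= a < 1 -> D t ->
  cot_pow a t <= 2 / (1 - a) * (cot_pow a t * (cos t - a)) + (2 + 4 / (1 - a)) * (1 + 4 / (1 - a)).
Proof.
move=> /andP[a0 a1] Dt.
have w0 := cot_pow_gt0 a Dt; have c1 := cos_le1 t; have cN1 := cos_geN1 t.
have a2 : 0 < 1 - a by rewrite subr_gt0.
have i0 : 0 < (1 - a)^-1 by rewrite invr_gt0.
have ii : (1 - a)^-1 * (1 - a) = 1 by rewrite mulVf// gt_eqF.
have [h|h] := leP ((1 + a) / 2) (cos t).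
  have : cot_pow a t <= 2 / (1 - a) * (cot_pow a t * (cos t - a)).
    have : (1 - a) / 2 <= cos t - a by lra.
    move: w0 i0 ii a2; set w := cot_pow a t; set i := (1 - a)^-1; set c := cos t.
    move=> w0 i0 ii a2 h2.
    have -> : 2 / (1 - a) * (w * (c - a)) = (2 * i * (c - a)) * w by rewrite -/i; ring.
    rewrite ler_peMl//; first exact: ltW.
    have := ler_wpM2l (ltW i0) h2; nra.
  move=> H; apply: (le_trans H); rewrite lerDl mulr_ge0// addr_ge0// mulr_ge0// ltW//.
have X0 := cot_half_gt0 Dt.
have h1 : cot_pow a t <= 2 + 4 / (1 - a).
  have /powR_le_affine h2 := X0.
  have/h2 : 0 <= a <= 1 by rewrite a0 ltW.
  rewrite -/(cot_pow a t) => h3; apply: (le_trans h3).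
  have : cot_half t ^+ 2 <= 4 / (1 - a).
    rewrite cot_half_sqr// ler_pdivrMr; last by lra.
    have : (1 - a) / 2 <= 1 - cos t by lra.
    move: i0 ii a2; set i := (1 - a)^-1 => i0 ii a2 h4.
    have : i * ((1 - a) / 2) <= i * (1 - cos t) by rewrite ler_wpM2l// ltW.
    nra.
  move: X0; set X := cot_half t; set B := 4 / _; nra.
apply: (le_trans h1).
have h4 : - (2 * (2 + 4 / (1 - a))) <= cot_pow a t * (cos t - a).
  by move: h1 w0; set w := cot_pow a t; set B := 2 + _ => *; nra.
move: h4 h1 i0; set i := (1 - a)^-1; set w := cot_pow a t * _ => h4 h1 i0.
have : 2 * i * - (2 * (2 + 4 * i)) <= 2 * i * w by rewrite ler_wpM2l// mulr_ge0// ltW.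
lra.
Qed.

Lemma exhaustion_FTC a (g dg : R -> R) n : n.+2%:R^-1 < pi - n.+2%:R^-1 :> R ->
    (forall t : R, is_derive t 1 g (dg t)) -> continuous dg ->
  mu.-integrable (I n) (EFin \o (fun t => cot_pow a t * ((cos t - a) * g t + sin t * dg t))) /\
  \int[mu]_(t in I n) (cot_pow a t * ((cos t - a) * g t + sin t * dg t)) =
    cot_pow a (pi - n.+2%:R^-1) * (sin (pi - n.+2%:R^-1) * g (pi - n.+2%:R^-1))
    - cot_pow a (n.+2%:R^-1) * (sin (n.+2%:R^-1) * g (n.+2%:R^-1)).
Proof.
move=> nlt dgt cdg.
have ID x : n.+2%:R^-1 <= x <= pi - n.+2%:R^-1 -> D x.
  by move=> h; apply: (@exhaustion_sub n); rewrite /I /= in_itv.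
apply: (@FTC2_is_derive (fun t => cot_pow a t * (sin t * g t))) => //.
  by move=> x /ID Dx; exact: is_derive_by_parts.
move=> x /ID Dx; apply: cvgM; first exact: continuous_cot_pow.
have cg : {for x, continuous g}.
  by apply/differentiable_continuous/derivable1_diffP; case: (dgt x).
apply: cvgD; apply: cvgM.
- by apply: cvgB; [exact: continuous_cos|exact: cvg_cst].
- exact: cg.
- exact: continuous_sin.
- exact: cdg.
Qed.

(** The right-hand side of [cot_pow_le_derive] is an exact derivative plus a constant. On each
    compact piece its integral is at most [K] times a boundary term, itself at most 2, plus [M]
    times the length. *)
Lemma integrable_cot_pow a : 0 <= a < 1 -> mu.-integrable D (EFin \o cot_pow a).
Proof.
move=> a01; have /andP[a0 a1] := a01.
set K := 2 / (1 - a); set M := (2 + 4 / (1 - a)) * (1 + 4 / (1 - a)).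
have K0 : 0 <= K by rewrite divr_ge0// subr_ge0 ltW.
have M0 : 0 <= M.
  have i0 : 0 <= 4 / (1 - a) by rewrite divr_ge0// subr_ge0 ltW.
  by rewrite /M mulr_ge0// addr_ge0.
apply: (@integrable_exhaustion _ (K * 2 + M * pi)).
- exact: measurable_cot_pow.
- by move=> x Dx; rewrite ltW// cot_pow_gt0.
have := exhaustion_lt; apply: filterS => n nlt.
have h0 (t : R) : is_derive t 1 (fun=> 1 : R) 0 by exact: is_derive_cst.
have [fi fE] := @exhaustion_FTC a (fun=> 1) (fun=> 0) n nlt h0 (fun=> cvg_cst _).
have wi : mu.-integrable (I n) (EFin \o cot_pow a).
  apply: continuous_compact_integrable; first exact: segment_compact.
  apply: continuous_in_subspaceT => x /set_mem; move/exhaustion_sub; exact: continuous_cot_pow.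
split=> //.
have ci : mu.-integrable (I n) (EFin \o (fun=> M)).
  apply: continuous_compact_integrable; first exact: segment_compact.
  by apply: continuous_in_subspaceT => x _; exact: cvg_cst.
have Ki : mu.-integrable (I n) (EFin \o (fun t => K * (cot_pow a t * ((cos t - a) * 1 + sin t * 0)))).
  by apply: integrable_EFinZl => //; exact: measurable_exhaustion.
have Kci : mu.-integrable (I n) (EFin \o (fun t => K * (cot_pow a t * ((cos t - a) * 1 + sin t * 0)) + M)).
  by apply: integrable_EFinD => //; exact: measurable_exhaustion.
apply: (@le_trans _ _ (\int[mu]_(t in I n) (K * (cot_pow a t * ((cos t - a) * 1 + sin t * 0)) + M))).
  apply: le_Rintegral => //; first exact: measurable_exhaustion.
  move=> x /exhaustion_sub Dx; rewrite mulr1 mulr0 addr0; exact: cot_pow_le_derive.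
rewrite RintegralD//; last exact: measurable_exhaustion.
rewrite RintegralZl//; last exact: measurable_exhaustion.
rewrite fE Rintegral_cst; last exact: measurable_exhaustion.
have -> : (fine (mu (I n)) = (pi - n.+2%:R^-1) - n.+2%:R^-1 :> R).
  by rewrite /I lebesgue_measure_itv /= lte_fin nlt.
rewrite !mulr1; apply: lerD; apply: ler_wpM2l => //.
  have a01' : 0 <= a <= 1 by rewrite a0 ltW.
  have [D1 D2] := exhaustion_endpoints n.
  have /andP[_ p1] := cot_pow_sin_le a01' D2.
  have /andP[p2 _] := cot_pow_sin_le a01' D1.
  have : sin (pi - n.+2%:R^-1) `^ (1 - a) <= 1 :> R.
    have b01 : 0 <= 1 - a <= 1 by apply/andP; split; lra.
    apply: (le_trans (powR_le_affine (sin_itv_gt0 D2) b01)).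
    have := sin_le1 (pi - n.+2%:R^-1 : R); set s := sin _ => s1.
    by have /andP[b0 _] := b01; nra.
  move: p1 p2; set A := cot_pow a (pi - _) * _; set B := cot_pow a _ * _; set C := _ `^ _; lra.
have : 0 <= n.+2%:R^-1 :> R by [].
by set e := (_^-1) => ?; lra.
Qed.

Section Functional.
Variable a : R.
Hypothesis a01 : 0 <= a < 1.

(** Both conditions are imposed on the whole line, although [cot_int] only sees [D]: sums, products
    and powers then carry no domain. *)
Definition test_fun (g : R -> R) := continuous g /\ exists M, forall t, `|g t| <= M.

Definition cot_int (g : R -> R) : R := \int[mu]_(t in D) (cot_pow a t * g t).

Lemma integrable_cot_int g : test_fun g -> mu.-integrable D (EFin \o (fun t => cot_pow a t * g t)).
Proof.
move=> [cg [M gM]]; apply: (@integrable_EFin_le _ _ _ mu D _ _ (fun t => M * cot_pow a t)).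
- exact: measurable_itv.
- apply: measurable_funM; first exact: measurable_cot_pow.
  by apply: measurable_funTS; exact: continuous_measurable_fun.
- move=> x Dx; rewrite normrM ger0_norm ?(ltW (cot_pow_gt0 _ Dx))// mulrC.
  by rewrite ler_wpM2r// ltW// cot_pow_gt0.
- apply: integrable_EFinZl; first exact: measurable_itv.
  exact: integrable_cot_pow.
Qed.

Lemma eq_cot_int f g : (forall t, D t -> f t = g t) -> cot_int f = cot_int g.
Proof. by move=> fg; apply: eq_Rintegral => t /set_mem Dt; rewrite fg. Qed.

Lemma cot_intD f g : test_fun f -> test_fun g ->
  cot_int (fun t => f t + g t) = cot_int f + cot_int g.
Proof.
move=> tf tg; rewrite /cot_int -RintegralD//; first by apply: eq_Rintegral => t _; rewrite mulrDr.
- exact: measurable_itv.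
- exact: integrable_cot_int.
- exact: integrable_cot_int.
Qed.

Lemma cot_intZ k f : test_fun f -> cot_int (fun t => k * f t) = k * cot_int f.
Proof.
move=> tf; rewrite /cot_int -RintegralZl//; first by apply: eq_Rintegral => t _; rewrite mulrCA.
  exact: measurable_itv.
exact: integrable_cot_int.
Qed.

Lemma test_fun_cst k : test_fun (fun=> k).
Proof. by split; [move=> x; exact: cvg_cst|exists `|k|]. Qed.

Lemma test_funD f g : test_fun f -> test_fun g -> test_fun (fun t => f t + g t).
Proof.
move=> [cf [M fM]] [cg [N gN]]; split; first by move=> x; apply: cvgD; [exact: cf|exact: cg].
by exists (M + N) => t; rewrite (le_trans (ler_normD _ _))// lerD.
Qed.

Lemma test_funM f g : test_fun f -> test_fun g -> test_fun (fun t => f t * g t).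
Proof.
move=> [cf [M fM]] [cg [N gN]]; split; first by move=> x; apply: cvgM; [exact: cf|exact: cg].
by exists (M * N) => t; rewrite normrM ler_pM.
Qed.

Lemma test_funX f n : test_fun f -> test_fun (fun t => f t ^+ n).
Proof.
move=> tf; elim: n => [|n IH].
  by under eq_fun do rewrite expr0; exact: test_fun_cst.
by under eq_fun do rewrite exprS; exact: test_funM.
Qed.

Lemma test_funZ k f : test_fun f -> test_fun (fun t => k * f t).
Proof. by move=> tf; apply: test_funM => //; exact: test_fun_cst. Qed.

Lemma test_funN f : test_fun f -> test_fun (fun t => - f t).
Proof. by move=> /(test_funZ (-1)); under eq_fun do rewrite mulN1r. Qed.

Lemma test_funB f g : test_fun f -> test_fun g -> test_fun (fun t => f t - g t).
Proof. by move=> tf tg; apply: test_funD => //; exact: test_funN. Qed.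

Lemma test_fun_cos k b : test_fun (fun t => cos (k * t + b)).
Proof.
split; last by exists 1 => t; exact: cos_max.
move=> x; apply: (@continuous_comp _ _ _ (fun t => k * t + b)); last exact: continuous_cos.
by apply: cvgD; [apply: cvgM; [exact: cvg_cst|exact: cvg_id]|exact: cvg_cst].
Qed.

Lemma test_fun_sin k b : test_fun (fun t => sin (k * t + b)).
Proof.
split; last by exists 1 => t; exact: sin_max.
move=> x; apply: (@continuous_comp _ _ _ (fun t => k * t + b)); last exact: continuous_sin.
by apply: cvgD; [apply: cvgM; [exact: cvg_cst|exact: cvg_id]|exact: cvg_cst].
Qed.

Lemma test_fun_cos1 : test_fun cos.
Proof. by split; [exact: continuous_cos|exists 1 => t; exact: cos_max]. Qed.

Lemma test_fun_sin1 : test_fun sin.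
Proof. by split; [exact: continuous_sin|exists 1 => t; exact: sin_max]. Qed.

Lemma cot_intB f g : test_fun f -> test_fun g ->
  cot_int (fun t => f t - g t) = cot_int f - cot_int g.
Proof.
move=> tf tg; rewrite cot_intD//; last exact: test_funN.
congr (_ + _); rewrite -mulN1r -cot_intZ//; apply: eq_cot_int => t _; ring.
Qed.

Lemma cot_int_ge0 f : (forall t, D t -> 0 <= f t) -> 0 <= cot_int f.
Proof.
move=> f0; apply: Rintegral_ge0 => t Dt.
by rewrite mulr_ge0 ?f0// ltW// cot_pow_gt0.
Qed.

Lemma cot_int_le f g : test_fun f -> test_fun g -> (forall t, D t -> f t <= g t) ->
  cot_int f <= cot_int g.
Proof.
move=> tf tg fg; rewrite -subr_ge0 -cot_intB//; apply: cot_int_ge0 => t Dt.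
by rewrite subr_ge0 fg.
Qed.

Lemma cot_int_norm f g : test_fun f -> test_fun g -> (forall t, D t -> `|f t| <= g t) ->
  `|cot_int f| <= cot_int g.
Proof.
move=> tf tg fg; rewrite ler_norml; apply/andP; split.
  rewrite -mulN1r -cot_intZ//; apply: cot_int_le => //; first exact: test_funZ.
  by move=> t /fg; rewrite mulN1r ler_norml => /andP[].
by apply: cot_int_le => // t /fg; rewrite ler_norml => /andP[].
Qed.

(** The source of all recurrences below, which are its instances for g = 1, cos (n t + b), sin^m and
    sin^m cos. *)
Lemma cot_int_by_parts g dg : test_fun g -> test_fun dg ->
  (forall t : R, is_derive t 1 g (dg t)) ->
  cot_int (fun t => (cos t - a) * g t + sin t * dg t) = 0.
Proof.
move=> tg tdg dgt.
set h := fun t => _.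
have th : test_fun h.
  by apply: test_funD; apply: test_funM => //; [apply: test_funB; [exact: test_fun_cos1|exact: test_fun_cst]|exact: test_fun_sin1].
have c := cvg_Rintegral_exhaustion (integrable_cot_int th).
have [_ [M gM]] := tg.
have c1 := @cvg_boundary a g M (fun n => n.+2%:R^-1) a01 gM.
have c2 := @cvg_boundary a g M (fun n => pi - n.+2%:R^-1) a01 gM.
have h1 n : D n.+2%:R^-1 /\ sin (n.+2%:R^-1) = sin (n.+2%:R^-1) :> R.
  by split=> //; case: (exhaustion_endpoints n).
have h2 n : D (pi - n.+2%:R^-1) /\ sin (pi - n.+2%:R^-1) = sin (n.+2%:R^-1) :> R.
  by split; [case: (exhaustion_endpoints n)|exact: sin_exhaustion_r].
have c3 : cot_pow a (pi - n.+2%:R^-1) * (sin (pi - n.+2%:R^-1) * g (pi - n.+2%:R^-1))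
    - cot_pow a (n.+2%:R^-1) * (sin (n.+2%:R^-1) * g (n.+2%:R^-1)) @[n --> \oo] --> (0 : R).
  rewrite -[X in _ --> X](subr0 (0 : R)); exact: cvgB (c2 h2) (c1 h1).
apply: (cvg_unique _ c) => //.
apply: cvg_trans c3; apply: near_eq_cvg.
have := exhaustion_lt; apply: filterS => n nlt.
by have [_ ->] := @exhaustion_FTC a g dg n nlt dgt tdg.1.
Qed.

Lemma test_fun_norm f : test_fun f -> test_fun (fun t => `|f t|).
Proof.
move=> [cf [M fM]]; split; last by exists M => t; rewrite normr_id.
by move=> x; apply: continuous_comp; [exact: cf|exact: norm_continuous].
Qed.

(** Dominated convergence, with [cot_pow a] as the dominating function. With f = [tan_ratio] it
    makes the potential small high above the axis; with f = cos and a = 0 it makes the law of the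
    height spread out. *)
Lemma cvg_cot_int_expn f : test_fun f -> (forall t, D t -> `|f t| < 1) ->
  cot_int (fun t => `|f t| ^+ n) @[n --> \oo] --> (0 : R).
Proof.
move=> tf f1.
have tn n := test_funX n (test_fun_norm tf).
have [|||||_ _] := @dominated_convergence _ _ R mu D (measurable_itv _)
   (fun n => EFin \o (fun t => cot_pow a t * `|f t| ^+ n)) (EFin \o (cst 0)) (EFin \o cot_pow a).
- move=> n; have := integrable_cot_int (tn n); exact: measurable_int.
- exact/measurable_EFinP/measurable_cst.
- apply: aeW => x Dx; apply: cvg_EFin; first exact: nearW.
  rewrite -[X in _ --> X](mulr0 (cot_pow a x)); apply: cvgMr.
  by apply: cvg_expr; rewrite normr_id f1.
- exact: integrable_cot_pow.
- apply: aeW => x n Dx /=; rewrite lee_fin normrM ger0_norm ?(ltW (cot_pow_gt0 _ Dx))//.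
  rewrite ler_piMr// ?(ltW (cot_pow_gt0 _ Dx))// ger0_norm ?exprn_ge0//.
  by rewrite exprn_ile1// ltW// f1.
have -> : (\int[mu]_(x in D) (EFin \o (cst (0%R : R))) x = 0)%E by rewrite integral0_eq.
by move=> h; apply: fine_cvg.
Qed.

End Functional.
End CotInt.

(** * Trigonometric moments *)

Section Moments.
Context {R : realType}.
Notation mu := (@lebesgue_measure R).
Let D : set R := `]0, pi[%classic.

Lemma le_of_eq (x y : R) : x = y -> x <= y. Proof. by move=> ->. Qed.

Section Recurrence.
Variable a : R.
Hypothesis a01 : 0 <= a < 1.

(** Integration by parts with g = cos ((n + 1) t + b), then product-to-sum formulas. For n = 0 the
    first term on the right drops out, so the integrals of index at least 1 are determined by the
    one of index 1. *)
Lemma cot_int_cos_rec (b : R) n :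
  n.+2%:R * cot_int a (fun t => cos (n.+2%:R * t + b)) =
  n%:R * cot_int a (fun t => cos (n%:R * t + b))
  + 2 * a * cot_int a (fun t => cos (n.+1%:R * t + b)).
Proof.
have h : (forall t : R, is_derive t 1 (fun t => cos (n.+1%:R * t + b)) (- n.+1%:R * sin (n.+1%:R * t + b))).
  move=> t.
  have h1 : is_derive t 1 (fun t => n.+1%:R * t + b) (n.+1%:R : R).
    have := is_deriveD (is_deriveZ n.+1%:R (is_derive_id t 1)) (is_derive_cst b t 1).
    by rewrite addr0 /GRing.scale/= mulr1.
  have := is_derive1_comp (is_derive_cos _) h1.
  by rewrite mulrC mulrN mulNr.
have := cot_int_by_parts a01 (test_fun_cos _ _) (test_funZ _ (test_fun_sin _ _)) h.
rewrite (@eq_cot_int _ a _ (fun t => n.+2%:R / 2 * cos (n.+2%:R * t + b) +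
   (- (n%:R / 2) * cos (n%:R * t + b) - a * cos (n.+1%:R * t + b)))); last first.
  move=> t _; have -> : n.+2%:R * t + b = (n.+1%:R * t + b) + t :> R by rewrite -(natr1 n.+1); ring.
  have -> : n%:R * t + b = (n.+1%:R * t + b) - t :> R by rewrite -natr1; ring.
  set x := n.+1%:R * t + b; rewrite (cosD x t) (cosB x t).
  have -> : n.+2%:R = n.+1%:R + 1 :> R by rewrite natr1.
  have -> : n%:R = n.+1%:R - 1 :> R by rewrite -natr1; ring.
  by field.
rewrite cot_intD//; last 2 first.
  exact: (test_funZ _ (test_fun_cos _ _)).
  by apply: test_funB; apply: test_funZ; exact: test_fun_cos.
rewrite cot_intB//; try by apply: test_funZ; exact: test_fun_cos.
rewrite !cot_intZ//; try exact: test_fun_cos.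
move=> h2; lra.
Qed.

Lemma cot_int_cos1 : cot_int a cos = a * cot_int a (fun=> 1).
Proof.
have h (t : R) : is_derive t 1 (fun=> 1 : R) 0 by exact: is_derive_cst.
have := cot_int_by_parts a01 (test_fun_cst 1) (test_fun_cst 0) h.
rewrite (@eq_cot_int _ a _ (fun t => cos t - a * 1)); last by move=> t _; ring.
rewrite cot_intB// ?cot_intZ//.
- by move=> ?; lra.
- exact: test_fun_cst.
- exact: test_fun_cos1.
- exact: test_fun_cst.
Qed.

Definition sin_moment (a : R) m := cot_int a (fun t => sin t ^+ m).

Lemma is_derive_sinX m (t : R) : is_derive t 1 (fun t => sin t ^+ m) (m%:R * sin t ^+ m.-1 * cos t).
Proof.
rewrite (_ : (fun t => _) = (sin : R -> R) ^+ m); last by apply/funext => x; rewrite exprfctE.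
exact: is_deriveX.
Qed.

Lemma test_fun_sinX m : test_fun (fun t : R => sin t ^+ m).
Proof. exact: (test_funX _ test_fun_sin1). Qed.

Lemma test_fun_sinXcos m : test_fun (fun t : R => sin t ^+ m * cos t).
Proof. by apply: test_funM; [exact: test_fun_sinX|exact: test_fun_cos1]. Qed.

Lemma cot_int_sinXcos m :
  m.+1%:R * cot_int a (fun t => sin t ^+ m * cos t) = a * sin_moment a m.
Proof.
have tdg : test_fun (fun t : R => m%:R * sin t ^+ m.-1 * cos t).
  by apply: test_funM; [apply: test_funZ; exact: test_fun_sinX|exact: test_fun_cos1].
have := cot_int_by_parts a01 (test_fun_sinX m) tdg (is_derive_sinX m).
rewrite (@eq_cot_int _ a _ (fun t => m.+1%:R * (sin t ^+ m * cos t) - a * sin t ^+ m)); last first.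
  move=> t _; case: m {tdg} => [|m]; first by rewrite !expr0; ring.
  by rewrite /= -(natr1 m.+1) exprS; ring.
rewrite cot_intB// ?cot_intZ//.
- by move=> ?; rewrite /sin_moment; lra.
- exact: test_fun_sinX.
- exact: test_fun_sinXcos.
- by apply: test_funZ; exact: test_fun_sinXcos.
- by apply: test_funZ; exact: test_fun_sinX.
Qed.

(** Taking g = sin^m cos leaves the integral of cot(t/2)^a sin^m cos, which [cot_int_sinXcos] turns
    back into a sine moment at the cost of a second factor a. *)
Lemma sin_moment_rec m : m.+1%:R * m.+2%:R * sin_moment a m.+2
   = (m.+1%:R ^+ 2 - a ^+ 2) * sin_moment a m.
Proof.
have dg (t : R) : is_derive t 1 (fun t => sin t ^+ m * cos t)
    (m%:R * sin t ^+ m.-1 * cos t ^+ 2 - sin t ^+ m.+1).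
  have := is_deriveM (is_derive_sinX m t) (is_derive_cos t).
  move=> dd; apply: (is_derive_eq dd); rewrite /GRing.scale/=; case: m {dd} => [|m] /=.
    by rewrite !expr0 expr1; ring.
  by rewrite !exprS; ring.
have tdg : test_fun (fun t : R => m%:R * sin t ^+ m.-1 * cos t ^+ 2 - sin t ^+ m.+1).
  apply: test_funB; last exact: test_fun_sinX.
  by apply: test_funM; [apply: test_funZ; exact: test_fun_sinX|apply: test_funX; exact: test_fun_cos1].
have := cot_int_by_parts a01 (test_fun_sinXcos m) tdg dg.
rewrite (@eq_cot_int _ a _ (fun t => (m.+1%:R * sin t ^+ m - m.+2%:R * sin t ^+ m.+2) - a * (sin t ^+ m * cos t))); last first.
  move=> t _; case: m {tdg dg} => [|m].
    rewrite !expr0 expr1 expr2 mul0r mul0r sub0r; have := cos2Dsin2 t.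
    rewrite !expr2 => h; have hc : cos t * cos t = 1 - sin t * sin t by rewrite -h; ring.
    transitivity (cos t * cos t - sin t * sin t - a * cos t); first by ring.
    by rewrite hc; ring.
  transitivity (m.+2%:R * sin t ^+ m.+1 * cos t ^+ 2 - a * (sin t ^+ m.+1 * cos t) - sin t ^+ m.+3).
    by rewrite /= -(natr1 m.+1) !exprS; ring.
  rewrite cos2sin2 -(natr1 m.+2) !exprS; ring.
rewrite cot_intB ?cot_intB ?cot_intZ//.
- have := cot_int_sinXcos m; rewrite -/(sin_moment a m) -/(sin_moment a m.+2).
  set W := sin_moment a m; set W2 := sin_moment a m.+2; set K := cot_int _ _ => h1 h2.
  have : m.+1%:R * (m.+1%:R * W - m.+2%:R * W2) - a * (m.+1%:R * K) = 0.
    by rewrite -[RHS](mulr0 m.+1%:R) -h2; ring.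
  rewrite h1 => h3.
  by apply/eqP; rewrite -subr_eq0; apply/eqP; rewrite -[RHS]oppr0 -h3; ring.
all: try by apply: test_funZ; exact: test_fun_sinX.
all: try exact: test_fun_sinX.
all: try exact: test_fun_sinXcos.
- by apply: test_funB; apply: test_funZ; exact: test_fun_sinX.
- by apply: test_funZ; exact: test_fun_sinXcos.
Qed.
End Recurrence.

Let zero01 : 0 <= (0 : R) < 1. Proof. by rewrite lexx ltr01. Qed.

Lemma cot_pow0 (t : R) : cot_pow 0 t = 1. Proof. by rewrite /cot_pow powRr0. Qed.

Lemma sin_moment0_0 : sin_moment 0 0 = pi :> R.
Proof.
rewrite /sin_moment /cot_int.
under eq_Rintegral do rewrite cot_pow0 expr0 mulr1.
rewrite Rintegral_cst; last exact: measurable_itv.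
have -> : (fine (mu D) = pi :> R); last by rewrite mul1r.
by rewrite /D lebesgue_measure_itv /= lte_fin pi_gt0 /= subr0.
Qed.

Lemma Rintegral_oo_cc (f : R -> R) (x y : R) : mu.-integrable `[x, y] (EFin \o f) ->
  \int[mu]_(t in `]x, y[) f t = \int[mu]_(t in `[x, y]) f t.
Proof.
move=> fi; rewrite Rintegral_itv_obnd_cbnd.
  rewrite Rintegral_itv_bndo_bndc//.
  by apply: integrableS fi => //; apply: subset_itvl; rewrite bnd_simp.
by apply: integrableS fi => //; apply: subset_itvW; rewrite bnd_simp.
Qed.

Lemma sin_moment0_1 : sin_moment 0 1 = 2 :> R.
Proof.
rewrite /sin_moment /cot_int.
under eq_Rintegral do rewrite cot_pow0 expr1 mul1r.
have [si sE] := @FTC2_is_derive R (fun t => - cos t) sin 0 pi (pi_gt0 R)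
  (fun t _ => is_derive_eq (is_deriveN (is_derive_cos t)) (opprK _)) (fun t _ => @continuous_sin R t).
by rewrite Rintegral_oo_cc// sE cospi cos0 !opprK; ring.
Qed.

Lemma sin_moment0_rec m : m.+2%:R * sin_moment 0 m.+2 = m.+1%:R * sin_moment 0 m :> R.
Proof.
have := sin_moment_rec zero01 m; rewrite expr0n subr0 expr2 -!mulrA.
by move/mulfI; apply; rewrite pnatr_eq0.
Qed.

Lemma sin_moment0_gt0 m : 0 < sin_moment (0 : R) m /\ 0 < sin_moment (0 : R) m.+1.
Proof.
elim: m => [|m [IH1 IH2]]; first by rewrite sin_moment0_0 sin_moment0_1 pi_gt0.
split=> //; rewrite -(pmulr_rgt0 _ (ltr0Sn R m.+1)) sin_moment0_rec.
by rewrite mulr_gt0.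
Qed.

Lemma sin_moment0_decr m : sin_moment (0 : R) m.+1 <= sin_moment 0 m.
Proof.
apply: (cot_int_le zero01); try exact: test_fun_sinX.
move=> t Dt; rewrite exprS ler_piMl ?sin_le1// exprn_ge0// ltW//.
exact: sin_itv_gt0.
Qed.

Lemma sin_moment0_wallis m : m.+1%:R * sin_moment 0 m.+1 * sin_moment 0 m = 2 * pi :> R.
Proof.
elim: m => [|m IH]; first by rewrite sin_moment0_0 sin_moment0_1 mul1r.
by rewrite sin_moment0_rec -IH; ring.
Qed.

Lemma sin_moment0_ratio m : m.+1%:R * sin_moment 0 m <= m.+2%:R * sin_moment (0 : R) m.+1.
Proof. by rewrite -sin_moment0_rec ler_wpM2l// sin_moment0_decr. Qed.

(** With w = cot(t/2)^a, [powR_le_affine] gives w <= 1 + a (cot(t/2) - 1), and w >= 2 - 1/w turns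
    the same inequality for tan(t/2) into a lower bound. Multiplied by sin^(m+1), both bounds
    involve only sin^(m+1), sin^m and sin^m cos, and the last one has integral 0 when a = 0. *)
Lemma sin_moment_bounds a m : 0 <= a < 1 ->
  (1 + a) * sin_moment 0 m.+1 - a * sin_moment 0 m <= sin_moment a m.+1
    <= (1 - a) * sin_moment 0 m.+1 + a * sin_moment 0 m.
Proof.
move=> a01; have /andP[a0 a1] := a01; have a01' : 0 <= a <= 1 by rewrite a0 ltW.
have zc : cot_int (0 : R) (fun t => sin t ^+ m * cos t) = 0.
  have := cot_int_sinXcos zero01 m; rewrite mul0r => /eqP; rewrite mulf_eq0 pnatr_eq0 /=.
  by move/eqP.
have tx m' := @test_fun_sinX m'; have tc := @test_fun_sinXcos m.
have i0 k l j : mu.-integrable D (EFin \o (fun t => cot_pow 0 t * (k * sin t ^+ m.+1 + (l * sin t ^+ m + j * (sin t ^+ m * cos t))))).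
  apply: integrable_cot_int => //; apply: test_funD; first exact: test_funZ.
  by apply: test_funD; exact: test_funZ.
have E k l j : \int[mu]_(t in D) (cot_pow 0 t * (k * sin t ^+ m.+1 + (l * sin t ^+ m + j * (sin t ^+ m * cos t))))
   = k * sin_moment 0 m.+1 + l * sin_moment 0 m.
  rewrite -/(cot_int _ _) cot_intD// ?cot_intD// ?cot_intZ//; try exact: test_funZ.
  - by rewrite zc mulr0 addr0.
  - by apply: test_funD; exact: test_funZ.
have ia := integrable_cot_int a01 (tx m.+1).
apply/andP; split.
  rewrite -mulNr -(E _ _ a); apply: le_Rintegral => //; first exact: measurable_itv.
  move=> t Dt; rewrite cot_pow0 mul1r; have s0 := sin_itv_gt0 Dt.
  have X0 := cot_half_gt0 Dt; have w0 := cot_pow_gt0 a Dt.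
  have Y0 : 0 < (cot_half t)^-1 by rewrite invr_gt0.
  have := powR_le_affine Y0 a01'.
  have -> : (cot_half t)^-1 `^ a = (cot_pow a t)^-1.
    by rewrite -powR_inv1 ?ltW// -powRrM mulN1r powRN.
  have -> : (cot_half t)^-1 = (1 - cos t) / sin t.
    have c0 := onepcos_gt0 Dt.
    have -> : (cot_half t)^-1 = sin t ^+ 2 / (sin t * (1 + cos t)).
      by rewrite /cot_half; field; rewrite !gt_eqF.
    have -> : sin t ^+ 2 = (1 - cos t) * (1 + cos t) by rewrite sin2cos2; ring.
    by field; rewrite !gt_eqF.
  set Y := (1 - cos t) / sin t => h.
  have h2 : 2 - (1 + a * (Y - 1)) <= cot_pow a t.
    apply: (@le_trans _ _ (2 - (cot_pow a t)^-1)); first by rewrite lerD2l lerN2.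
    have ww : cot_pow a t * (cot_pow a t)^-1 = 1 by rewrite mulfV// gt_eqF.
    have wi : 0 < (cot_pow a t)^-1 by rewrite invr_gt0.
    move: w0 ww wi; set w := cot_pow a t; set i := w^-1 => w0 ww wi.
    rewrite -(ler_pM2l w0) mulrBr ww -subr_ge0 (_ : _ - _ = (w - 1) ^+ 2) ?sqr_ge0//; ring.
  have := ler_wpM2r (exprn_ge0 m.+1 (ltW s0)) h2; apply: le_trans.
  apply: le_of_eq; rewrite /Y exprS; field.
  by rewrite gt_eqF.
rewrite -(E _ _ a); apply: (le_Rintegral _ ia (i0 _ _ _)); first exact: measurable_itv.
move=> t Dt; rewrite cot_pow0 mul1r; have s0 := sin_itv_gt0 Dt.
have := powR_le_affine (cot_half_gt0 Dt) a01'; rewrite -/(cot_pow a t) => h.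
have := ler_wpM2r (exprn_ge0 m.+1 (ltW s0)) h; move=> h3; apply: (le_trans h3).
apply: le_of_eq; rewrite /cot_half exprS; field.
by rewrite gt_eqF.
Qed.

(** * Cosine moments, the partners of the sine moments *)

Section CosIntegrals.
Variable a : R.
Let I : set R := `[0, pi / 2]%classic.
Let mI : measurable I. Proof. exact: measurable_itv. Qed.

(** Chosen because its recurrence carries the factors n^2 - a^2 on the side opposite to the one for
    [sin_moment], and because its first two values are elementary. *)
Definition cos_moment (a : R) n := \int[mu]_(t in `[0, pi / 2]) (cos t ^+ n * cos (a * t)).

Lemma integrable_cos_moment (b : R) n : mu.-integrable I (EFin \o (fun t => cos t ^+ n * cos (b * t))).
Proof.
apply: continuous_compact_integrable; first exact: segment_compact.
apply: continuous_subspaceT => x.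
have [c1 _] := test_funX n (@test_fun_cos1 R).
have [c2 _] := @test_fun_cos R b 0.
apply: cvgM; first exact: c1.
by have := c2 x; rewrite /continuous_at /= addr0; apply: cvg_trans; apply: near_eq_cvg; near=> y; rewrite addr0.
Unshelve. all: by end_near. Qed.

Lemma cos_moment_FTC (F f : R -> R) : (forall t : R, is_derive t 1 F (f t)) -> continuous f ->
  \int[mu]_(t in I) f t = F (pi / 2) - F 0.
Proof.
move=> dF cf; have p0 : 0 < pi / 2 :> R by rewrite divr_gt0// pi_gt0.
by have [_ ->] := FTC2_is_derive p0 (fun t _ => dF t) (fun t _ => cf t).
Qed.

Lemma is_derive_cosX m (t : R) : is_derive t 1 (fun t => cos t ^+ m) (- (m%:R * cos t ^+ m.-1 * sin t)).
Proof.
rewrite (_ : (fun t => _) = (cos : R -> R) ^+ m); last by apply/funext => x; rewrite exprfctE.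
by have := is_deriveX m (is_derive_cos t); move=> h; apply: (is_derive_eq h); rewrite /GRing.scale/= mulrN.
Qed.

Lemma is_derive_cosZ (t : R) : is_derive t 1 (fun t => cos (a * t)) (- (a * sin (a * t))).
Proof.
have h1 : is_derive t 1 (fun t => a * t) a.
  by have := is_deriveZ a (is_derive_id t 1); rewrite /GRing.scale/= mulr1.
have h := is_derive1_comp (is_derive_cos (a * t)) h1.
by apply: (is_derive_eq h); ring.
Qed.

Lemma is_derive_sinZ (t : R) : is_derive t 1 (fun t => sin (a * t)) (a * cos (a * t)).
Proof.
have h1 : is_derive t 1 (fun t => a * t) a.
  by have := is_deriveZ a (is_derive_id t 1); rewrite /GRing.scale/= mulr1.
have h := is_derive1_comp (is_derive_sin (a * t)) h1.
by apply: (is_derive_eq h); ring.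
Qed.

Let ccos n k : continuous (fun t : R => k * (cos t ^+ n * cos (a * t))).
Proof.
have [c1 _] := test_funX n (@test_fun_cos1 R).
move=> x; apply: cvgM; first exact: cvg_cst.
apply: cvgM; first exact: c1.
apply: differentiable_continuous; apply/derivable1_diffP; by case: (is_derive_cosZ x).
Qed.

Lemma cos_moment0 : a * cos_moment a 0 = sin (pi * a / 2).
Proof.
have := cos_moment_FTC is_derive_sinZ; rewrite mulr0 sin0 subr0 => h.
rewrite [RHS](_ : _ = sin (a * (pi / 2))); last by congr sin; ring.
rewrite -h; last first.
  by have := @ccos 0 a; under eq_fun do rewrite expr0 mul1r.
rewrite -RintegralZl//; last exact: integrable_cos_moment.
by apply: eq_Rintegral => t _; rewrite expr0 mul1r.
Qed.

Lemma cos_moment1 : (1 - a ^+ 2) * cos_moment a 1 = cos (pi * a / 2).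
Proof.
have dF (t : R) : is_derive t 1 (fun t => sin t * cos (a * t) - a * (cos t * sin (a * t)))
    ((1 - a ^+ 2) * (cos t ^+ 1 * cos (a * t))).
  have h1 := is_deriveM (is_derive_sin t) (is_derive_cosZ t).
  have h2 := is_deriveZ a (is_deriveM (is_derive_cos t) (is_derive_sinZ t)).
  apply: (is_derive_eq (is_deriveB h1 h2)); rewrite /GRing.scale/=; ring.
have := cos_moment_FTC dF (@ccos 1 _).
rewrite sin0 cos0 mulr0 sin0 cos_pihalf sin_pihalf RintegralZl//; last exact: integrable_cos_moment.
rewrite -/(cos_moment a 1) => ->.
rewrite !mul0r !mulr0 !subr0 mul1r; congr cos; ring.
Qed.

Lemma cos_moment_rec m :
  (m.+2%:R ^+ 2 - a ^+ 2) * cos_moment a m.+2 = m.+1%:R * m.+2%:R * cos_moment a m.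
Proof.
have dF (t : R) : is_derive t 1 (fun t => m.+2%:R * (cos t ^+ m.+1 * (sin t * cos (a * t))) - a * (cos t ^+ m.+2 * sin (a * t)))
    ((m.+2%:R ^+ 2 - a ^+ 2) * (cos t ^+ m.+2 * cos (a * t)) + (- (m.+1%:R * m.+2%:R)) * (cos t ^+ m * cos (a * t))).
  have h1 := is_deriveZ m.+2%:R (is_deriveM (is_derive_cosX m.+1 t) (is_deriveM (is_derive_sin t) (is_derive_cosZ t))).
  have h2 := is_deriveZ a (is_deriveM (is_derive_cosX m.+2 t) (is_derive_sinZ t)).
  apply: (is_derive_eq (is_deriveB h1 h2)); rewrite /GRing.scale/=.
  have -> : ((sin : R -> R) * (fun t0 : R => cos (a * t0))) t = sin t * cos (a * t) by [].
  rewrite -(natr1 m.+1) !exprS.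
  have := cos2Dsin2 t; rewrite !expr2 => h.
  set x := m.+1%:R; set c := cos t; set s := sin t; set C := cos (a * t); set S := sin (a * t).
  have hs : s * s = 1 - c * c by rewrite -h /c /s; ring.
  transitivity ((x + 1) * (c * c ^+ m * (c * C - a * s * S) - x * c ^+ m * C * (s * s)) - a * (c * (c * c ^+ m) * a * C - (x + 1) * (c * c ^+ m) * s * S)); first by ring.
  by rewrite hs; ring.
have cF : continuous (fun t : R => (m.+2%:R ^+ 2 - a ^+ 2) * (cos t ^+ m.+2 * cos (a * t)) + (- (m.+1%:R * m.+2%:R)) * (cos t ^+ m * cos (a * t))).
  by move=> x; apply: cvgD; exact: ccos.
have := cos_moment_FTC dF cF.
rewrite RintegralD ?RintegralZl//; first last.
- by apply: integrable_EFinZl => //; exact: integrable_cos_moment.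
- by apply: integrable_EFinZl => //; exact: integrable_cos_moment.
- exact: integrable_cos_moment.
- exact: integrable_cos_moment.
rewrite -!/(cos_moment a _) sin0 mulr0 sin0 cos_pihalf !exprS !(mul0r, mulr0) !subr0.
by move/eqP; rewrite mulNr subr_eq0 => /eqP.
Qed.

(** On [0, pi / 2] one has cos t <= cos (a t) <= 1. *)
Lemma cos_moment_bounds n : 0 <= a < 1 -> cos_moment 0 n.+1 <= cos_moment a n <= cos_moment 0 n.
Proof.
move=> /andP[a0 a1]; have := @pi_gt0 R => p0.
have c0 t : I t -> 0 <= cos t.
  by rewrite /I /= in_itv/= => /andP[t0 t1]; apply: cos_ge0_pihalf; apply/andP; split; lra.
apply/andP; split; apply: le_Rintegral => //; try exact: integrable_cos_moment; move=> t It.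
  rewrite mul0r cos0 mulr1 exprSr ler_wpM2l ?exprn_ge0 ?c0//.
  move: It; rewrite /I /= in_itv/= => /andP[t0 t1].
  have : a * t <= t by nra.
  rewrite le_eqVlt => /orP[/eqP ->//|h]; apply/ltW; rewrite ltr_cos//; rewrite in_itv/=.
    by apply/andP; split; nra.
  by apply/andP; split; nra.
by rewrite mul0r cos0 ler_wpM2l ?exprn_ge0 ?c0// cos_le1.
Qed.

End CosIntegrals.

Lemma cos_moment0_sin m : 2 * cos_moment 0 m = sin_moment (0 : R) m.
Proof.
suff h : 2 * cos_moment 0 m = sin_moment (0 : R) m /\ 2 * cos_moment 0 m.+1 = sin_moment (0 : R) m.+1 by case: h.
elim: m => [|m [IH1 IH2]].
  split.
    rewrite sin_moment0_0 /cos_moment; under eq_Rintegral do rewrite expr0 mul0r cos0 mulr1.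
    rewrite Rintegral_cst; last exact: measurable_itv.
    have -> : (fine (mu `[(0 : R), pi / 2]%classic) = pi / 2 :> R); last by field.
    by rewrite lebesgue_measure_itv /= lte_fin divr_gt0 ?pi_gt0//= subr0.
  have := cos_moment1 0; rewrite mulr0 mul0r cos0 expr0n /= subr0 mul1r => ->.
  by rewrite sin_moment0_1 mulr1.
split=> //; apply: (@mulfI _ (m.+2%:R)); first by rewrite pnatr_eq0.
rewrite sin_moment0_rec -IH1 mulrCA [RHS]mulrCA; congr (_ * _).
have := cos_moment_rec 0 m; rewrite expr0n subr0 expr2 -mulrA.
rewrite -[RHS]mulrA [RHS]mulrCA; move/mulfI; apply.
by rewrite pnatr_eq0.
Qed.

(** The factors (m + 2)^2 - a^2 of the two recurrences cancel. *)
Lemma moment_product_const a n m : 0 <= a < 1 ->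
  (m + n.*2).+1%:R * sin_moment a (m + n.*2).+1 * cos_moment a (m + n.*2)
  = m.+1%:R * sin_moment a m.+1 * cos_moment a m.
Proof.
move=> a01; elim: n => [|n IH]; first by rewrite addn0.
rewrite -IH doubleS !addnS; move: (m + n.*2)%N {IH} => {}m.
have h1 := sin_moment_rec a01 m.+1; have h2 := cos_moment_rec a m.
have /andP[a0 a1] := a01.
have x1 : (1 : R) <= m.+2%:R by rewrite ler1n.
have p : 0 < m.+2%:R ^+ 2 - a ^+ 2 :> R by nra.
apply: (mulfI (lt0r_neq0 p)).
transitivity (m.+2%:R^-1 * (m.+2%:R * m.+3%:R * sin_moment a m.+3) * ((m.+2%:R ^+ 2 - a ^+ 2) * cos_moment a m.+2)); first by field; lra.
by rewrite h1 h2; field; lra.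
Qed.

(** For a = 0 the product is exactly pi, by [sin_moment0_wallis]. The bounds on the two moments
    compare it to this case, with relative error O(1 / m) because consecutive moments have ratio 1 +
    O(1 / m) by [sin_moment0_ratio]. *)
Lemma moment_product_bounds a m : 0 <= a < 1 ->
  `|m.+1%:R * sin_moment a m.+1 * cos_moment a m - pi| <= 2 * pi / m.+1%:R.
Proof.
move=> a01; have /andP[a0 a1] := a01; have := @pi_gt0 R => p0.
have /andP[w1 w2] := sin_moment_bounds m a01.
have /andP[c1 c2] := cos_moment_bounds m a01.
have e1 := cos_moment0_sin m; have e2 := cos_moment0_sin m.+1.
have [q0 q1] := sin_moment0_gt0 m.
have d := sin_moment0_decr m; have r := sin_moment0_ratio m.
have W := sin_moment0_wallis m.
have x1 : (1 : R) <= m.+1%:R by rewrite ler1n.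
move: r W x1; rewrite -(natr1 m.+1); set x := m.+1%:R => r W x1.
move: w1 w2 c1 c2 e1 e2 q0 q1 d r W; set q := sin_moment 0 m; set q' := sin_moment 0 m.+1.
set w := sin_moment a m.+1; set c := cos_moment a m; set k := cos_moment 0 m; set k' := cos_moment 0 m.+1.
clearbody x q q' w c k k' => w1 w2 c1 c2 e1 e2 q0 q1 d r W.
have x0 : 0 < x by lra.
have xm : 0 <= x - 1 by lra.
have xp : 0 < x + 1 by lra.
have wu : w <= q by nra.
have cu : c <= q / 2 by lra.
have cl : q' / 2 <= c by lra.
have wl : (x - 1) * q' <= x * w by nra.
have c0 : 0 < c by lra.
have hu : x * (x * w * c) <= pi * (x + 1).
  have h1 : w * c <= q * (q / 2) by nra.
  have h2 : x * (x * (w * c)) <= x * (x * (q * (q / 2))) by rewrite !ler_pM2l.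
  have h3 : x * (q / 2) * (x * q) <= x * (q / 2) * ((x + 1) * q') by rewrite ler_wpM2l// mulr_ge0 ?divr_ge0 ?ltW.
  have h4 : x * (q / 2) * ((x + 1) * q') = pi * (x + 1).
    have -> : x * (q / 2) * ((x + 1) * q') = (x * q' * q) * ((x + 1) / 2) by ring.
    by rewrite W; field.
  nra.
have hl : (x + 1) * (x * w * c) >= pi * (x - 1).
  have h1 : (x - 1) * q' * (q' / 2) <= x * w * c.
    have A0 : 0 <= (x - 1) * q' by rewrite mulr_ge0// ltW.
    have B0 : 0 <= q' / 2 by rewrite divr_ge0// ltW.
    exact: (ler_pM A0 B0 wl cl).
  have h2 : (x + 1) * ((x - 1) * q' * (q' / 2)) <= (x + 1) * (x * w * c) by rewrite ler_pM2l.
  have h3 : (x - 1) * (q' / 2) * (x * q) <= (x - 1) * (q' / 2) * ((x + 1) * q').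
    by rewrite ler_wpM2l// mulr_ge0// divr_ge0// ltW.
  have h4 : (x - 1) * (q' / 2) * (x * q) = pi * (x - 1).
    have -> : (x - 1) * (q' / 2) * (x * q) = (x * q' * q) * ((x - 1) / 2) by ring.
    by rewrite W; field.
  nra.
have w0 : 0 <= x * w by apply: le_trans wl; rewrite mulr_ge0// ltW.
have xy : x * (2 * pi / x) = 2 * pi by field; rewrite gt_eqF.
have v0 : 0 <= x * w * c by rewrite mulr_ge0// ltW.
clear -xy hu hl v0 x0 x1 p0.
rewrite ler_norml; apply/andP; split; rewrite -(ler_pM2l x0) ?mulrN xy mulrBr; nra.
Qed.

(** The product at m is also the product at m + 2n, whose distance to pi tends to 0 with n. *)
Lemma moment_product (a : R) m : 0 <= a < 1 ->
  m.+1%:R * sin_moment a m.+1 * cos_moment a m = pi.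
Proof.
move=> a01; apply/eqP; rewrite -subr_eq0 -normr_le0.
set V := _ - pi.
have h n : `|V| <= 2 * pi * n.+1%:R^-1.
  apply: (@le_trans _ _ (2 * pi / (m + n.*2).+1%:R)).
    by rewrite /V -(moment_product_const n m a01); exact: moment_product_bounds.
  rewrite ler_wpM2l ?mulr_ge0 ?pi_ge0// lef_pV2 ?posrE// ler_nat ltnS.
  by rewrite -addnn addnA leq_addl.
have c : 2 * pi * n.+1%:R^-1 @[n --> \oo] --> (2 * pi * 0 : R) by apply: cvgMr; exact: cvg_harmonic.
rewrite mulr0 in c.
rewrite -(cvg_lim _ c)//; apply: limr_ge; [exact: cvgP c|exact: nearW].
Qed.

(* Euler's reflection formula, in the variable tan (t / 2). *)
Lemma cot_int_one (a : R) : 0 <= a < 1 -> cot_int a (fun=> 1) * cos (pi * a / 2) = pi.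
Proof.
move=> a01; have := moment_product 1 a01; have := sin_moment_rec a01 0.
rewrite -(cos_moment1 a) => h <-; rewrite mul1r in h.
have e : sin_moment a 0 = cot_int a (fun=> 1) by rewrite /sin_moment; apply: eq_cot_int => t _; rewrite expr0.
by rewrite h e expr1n; ring.
Qed.

Lemma cot_int_sin (a : R) : 0 <= a < 1 -> cot_int a sin * sin (pi * a / 2) = pi * a.
Proof.
move=> a01; have := moment_product 0 a01; rewrite mul1r -(cos_moment0 a) => <-.
have -> : sin_moment a 1 = cot_int a sin by rewrite /sin_moment; apply: eq_cot_int => t _; rewrite expr1.
ring.
Qed.

(** With b = pi a / 2, cos b times the moment of cos and sin b times the moment of sin are both pi
    a, so the phase b kills the integral of index 1; the recurrence propagates the zero. *)
Lemma cot_int_phase (a : R) n : 0 <= a < 1 ->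
  cot_int a (fun t => cos (n.+1%:R * t + pi * a / 2)) = 0.
Proof.
move=> a01; set b := pi * a / 2.
have E1 : cot_int a (fun t => cos (1%:R * t + b)) = 0.
  rewrite (@eq_cot_int _ a _ (fun t => cos b * cos t - sin b * sin t)); last first.
    by move=> t _; rewrite mul1r cosD; ring.
  rewrite cot_intB//; try by [apply: test_funZ; exact: test_fun_cos1|apply: test_funZ; exact: test_fun_sin1].
  rewrite !cot_intZ//; try by [exact: test_fun_cos1|exact: test_fun_sin1].
  rewrite cot_int_cos1// mulrC -mulrA cot_int_one// [sin b * _]mulrC cot_int_sin//; ring.
suff h : cot_int a (fun t => cos (n.+1%:R * t + b)) = 0 /\ cot_int a (fun t => cos (n.+2%:R * t + b)) = 0 by case: h.
elim: n => [|n [IH1 IH2]].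
  split=> //; apply: (@mulfI _ (2%:R)); first by rewrite pnatr_eq0.
  by rewrite mulr0 (cot_int_cos_rec a01 b 0) E1 mul0r mulr0 addr0.
split=> //; apply: (@mulfI _ (n.+3%:R)); first by rewrite pnatr_eq0.
by rewrite mulr0 (cot_int_cos_rec a01 b n.+1) IH1 IH2 !mulr0 addr0.
Qed.

(* [half_moebius_coef a n] is the coefficient of [x ^ n] in ((1 + x) / (1 - x)) ^ a. *)
Fixpoint half_moebius_coef (a : R) (n : nat) : R :=
  match n with
  | 0 => 1
  | m.+1 => match m with
            | 0 => 2 * a
            | k.+1 => (k%:R * half_moebius_coef a k + 2 * a * half_moebius_coef a m) / m.+1%:R
            end
  end.

Lemma half_moebius_coef_rec a n : n.+2%:R * half_moebius_coef a n.+2 =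
  n%:R * half_moebius_coef a n + 2 * a * half_moebius_coef a n.+1.
Proof. by rewrite [in LHS]/= mulrC divfK// pnatr_eq0. Qed.

(** A sine is a cosine with phase shifted by pi / 2, so these integrals obey the recurrence defining
    [half_moebius_coef] and only index 1 has to be computed. Multiplying by sin (pi a) avoids a
    quotient that is undefined at a = 0. *)
Lemma cot_int_sin_coef (a : R) n : 0 <= a < 1 ->
  cot_int a (fun t => sin (n.+1%:R * t + pi * a / 2)) * sin (pi * a)
  = pi * half_moebius_coef a n.+1.
Proof.
move=> a01; set b := pi * a / 2.
pose S n := cot_int a (fun t => sin (n%:R * t + b)).
have rec m : m.+2%:R * S m.+2 = m%:R * S m + 2 * a * S m.+1.
  have h k : S k = cot_int a (fun t => cos (k%:R * t + (b - pi / 2))).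
    by apply: eq_cot_int => t _; rewrite addrA cosBpihalf.
  by rewrite !h; exact: cot_int_cos_rec.
have S1 : S 1%N * sin (pi * a) = pi * (2 * a).
  have -> : sin (pi * a) = 2 * sin b * cos b.
    have -> : pi * a = b *+ 2 by rewrite /b mulr2n; field.
    by rewrite sin_mulr2n mulr2n; ring.
  rewrite /S (@eq_cot_int _ a _ (fun t => cos b * sin t + sin b * cos t)); last first.
    by move=> t _; rewrite mul1r sinD; ring.
  rewrite cot_intD//; try by [apply: test_funZ; exact: test_fun_cos1|apply: test_funZ; exact: test_fun_sin1].
  rewrite !cot_intZ//; try by [exact: test_fun_cos1|exact: test_fun_sin1].
  rewrite cot_int_cos1//; have h1 := cot_int_one a01; have h2 := cot_int_sin a01.
  rewrite -/b in h1 h2.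
  transitivity (2 * cos b ^+ 2 * (cot_int a sin * sin b) + 2 * a * sin b ^+ 2 * (cot_int a (fun=> 1) * cos b)); first by ring.
  rewrite h1 h2; have := cos2Dsin2 b => h.
  transitivity (2 * pi * a * (cos b ^+ 2 + sin b ^+ 2)); first by ring.
  by rewrite h; ring.
suff h : S n.+1 * sin (pi * a) = pi * half_moebius_coef a n.+1 /\ S n.+2 * sin (pi * a) = pi * half_moebius_coef a n.+2 by case: h.
elim: n => [|n [IH1 IH2]].
  split=> //; apply: (@mulfI _ (2%:R)); first by rewrite pnatr_eq0.
  rewrite mulrA rec mul0r add0r mulrCA half_moebius_coef_rec mul0r add0r /=.
  by rewrite -[2 * a * _ * _]mulrA S1; ring.
split=> //; apply: (@mulfI _ (n.+3%:R)); first by rewrite pnatr_eq0.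
rewrite [RHS]mulrCA half_moebius_coef_rec mulrA rec.
transitivity (n.+1%:R * (S n.+1 * sin (pi * a)) + 2 * a * (S n.+2 * sin (pi * a))); first by ring.
by rewrite IH1 IH2; ring.
Qed.

(** At a = 0, that is beta = 1, [cot_int_sin_coef] only says 0 = 0. There the recurrence links
    indices of equal parity, and its factor n is 0 at the start of the even chain. *)
Lemma cot_int_sin_even0 n : cot_int 0 (fun t : R => sin (n.+1.*2%:R * t)) = 0.
Proof.
pose S n := cot_int 0 (fun t : R => cos (n%:R * t + (- (pi / 2)))).
rewrite (_ : cot_int _ _ = S n.+1.*2); last by apply: eq_cot_int => t _; rewrite cosBpihalf.
have rec m : m.+2%:R * S m.+2 = m%:R * S m.
  by have := cot_int_cos_rec zero01 (- (pi / 2)) m; rewrite mulr0 mul0r addr0.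
elim: n => [|n IH].
  by apply: (@mulfI _ 2%:R); rewrite ?pnatr_eq0// (rec 0) mul0r mulr0.
by apply: (@mulfI _ (n.+1.*2).+2%:R); rewrite ?pnatr_eq0// rec IH !mulr0.
Qed.

End Moments.

(** * The values of [h_down] *)

Section HDown.
Context {R : realType}.

Section Convolution.
Variables (alpha : R) (f g : nat -> R).
Hypotheses (f0 : f 0%N = 1) (g0 : g 0%N = 1).
Hypothesis fS : forall n, n.+1%:R * f n.+1 = (alpha - n%:R) * f n.
Hypothesis gS : forall n, n.+1%:R * g n.+1 = (alpha + n%:R) * g n.

(** For the series F = (1 + x)^alpha and G = (1 - x)^(-alpha), with coefficients [f] and [g], these
    are the coefficients of F G, x F' G and x F G'. *)
Let c n := \sum_(j < n.+1) f (n - j)%N * g j.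
Let A n := \sum_(j < n.+1) (n - j)%:R * (f (n - j)%N * g j).
Let B n := \sum_(j < n.+1) j%:R * (f (n - j)%N * g j).

Let AB n : A n + B n = n%:R * c n.
Proof.
rewrite /A /B /c -big_split mulr_sumr; apply: eq_bigr => j _.
by rewrite /= -mulrDl -natrD subnK// -ltnS ltn_ord.
Qed.

Let AS n : A n.+1 = alpha * c n - A n.
Proof.
rewrite /A big_ord_recr /= subnn mul0r addr0 /c mulr_sumr -sumrB.
apply: eq_bigr => j _; rewrite subSn; last by rewrite -ltnS ltn_ord.
by rewrite mulrA fS; ring.
Qed.

Let BS n : B n.+1 = alpha * c n + B n.
Proof.
rewrite /B big_ord_recl /= mul0r add0r /c mulr_sumr -big_split /=.
apply: eq_bigr => j _; rewrite /bump /= add1n subSS.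
by rewrite mulrCA gS; ring.
Qed.

(** [AS] and [BS] express (1 + x) F' = alpha F and (1 - x) G' = alpha G. Together they make B - A at
    n + 1 equal to A + B at n, that is n c(n), whence the three-term recurrence. *)
Lemma convolution_coef n : \sum_(j < n.+1) f (n - j)%N * g j = half_moebius_coef alpha n.
Proof.
have c0 : c 0%N = 1 by rewrite /c big_ord1 f0 g0 mulr1.
have cS m : m.+1%:R * c m.+1 = 2 * alpha * c m + (B m - A m).
  by rewrite -AB AS BS; ring.
rewrite -/(c n).
suff h : c n = half_moebius_coef alpha n /\ c n.+1 = half_moebius_coef alpha n.+1 by case: h.
elim: n => [|n [IH1 IH2]].
  split=> //; have := cS 0%N; rewrite /A /B !big_ord1 subn0 !mul0r subr0 addr0 mul1r c0 => ->.
  by rewrite mulr1.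
split=> //; apply: (@mulfI _ n.+2%:R); first by rewrite pnatr_eq0.
rewrite half_moebius_coef_rec -IH1 -IH2 cS AS BS -AB; ring.
Qed.
End Convolution.

(** Changing a into -a in ((1 + x) / (1 - x))^a is changing x into -x. *)
Lemma half_moebius_coefN (a : R) n : half_moebius_coef (- a) n = (-1) ^+ n * half_moebius_coef a n.
Proof.
suff h : half_moebius_coef (- a) n = (-1) ^+ n * half_moebius_coef a n /\
   half_moebius_coef (- a) n.+1 = (-1) ^+ n.+1 * half_moebius_coef a n.+1 by case: h.
elim: n => [|n [IH1 IH2]]; first by split=> /=; rewrite ?expr0 ?expr1; ring.
split=> //; apply: (@mulfI _ n.+2%:R); first by rewrite pnatr_eq0.
rewrite [RHS]mulrCA !half_moebius_coef_rec IH1 IH2 !exprS; ring.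
Qed.

(** The sequence whose [limn] is [Gamma x]. A [limn] means nothing without convergence, so each
    value of [Gamma] has to be reached through a limit of this sequence. *)
Definition gauss_gamma (x : R) n : R := n%:R `^ x * n`!%:R / \prod_(0 <= i < n.+1) (x + i%:R).

Lemma gauss_gammaS (x : R) n : (0 < n)%N -> (forall i, x + i%:R != 0) ->
  gauss_gamma (x + 1) n = gauss_gamma x n * (x * (n%:R / (x + 1 + n%:R))).
Proof.
move=> n0 xi; rewrite /gauss_gamma.
have n0' : (n%:R : R) != 0 by rewrite pnatr_eq0 -lt0n.
rewrite powRD; last by rewrite n0' implybT.
rewrite powRr1//.
have -> : \prod_(0 <= i < n.+1) (x + 1 + i%:R) = (\prod_(0 <= i < n.+1) (x + i%:R)) * (x + 1 + n%:R) / x.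
  apply: (mulIf (xi 0%N)); rewrite addr0 divfK; last by have := xi 0%N; rewrite addr0.
  rewrite [in RHS]big_nat_recl//= addr0 mulrC -mulrA; congr (_ * _).
  rewrite [in LHS]big_nat_recr//=; congr (_ * _).
  by apply: eq_bigr => i _; rewrite -natr1; ring.
have p0 : \prod_(0 <= i < n.+1) (x + i%:R) != 0.
  by rewrite prodf_seq_neq0; apply/allP => i _; exact: xi.
field; rewrite p0 -addrA nat1r xi /=.
by have := xi 0%N; rewrite addr0.
Qed.

Lemma cvg_ratio1 (x : R) : n%:R / (x + 1 + n%:R) @[n --> \oo] --> (1 : R).
Proof.
have h : (fun n : nat => (1 + (x + 1) * n%:R^-1)^-1) @ \oo --> (1 : R).
  rewrite -[X in _ --> X]invr1; apply: cvgV => //.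
  rewrite -[X in _ --> X]addr0; apply: cvgD; first exact: cvg_cst.
  rewrite -[X in _ --> X](mulr0 (x + 1)); apply: cvgMr.
  by rewrite -cvg_shiftS; exact: cvg_harmonic.
apply: cvg_trans h; apply: near_eq_cvg; near=> n.
have n0 : (0 < n)%N by near: n; exact: nbhs_infty_gt.
have n1 : (n%:R : R) != 0 by rewrite pnatr_eq0 -lt0n.
by rewrite -[RHS]invf_div; congr (_^-1); field.
Unshelve. all: by end_near. Qed.

Lemma cvg_gauss_gammaS (x L : R) : (forall i, x + i%:R != 0) ->
  gauss_gamma x @ \oo --> L -> gauss_gamma (x + 1) @ \oo --> x * L.
Proof.
move=> xi gL.
have h : gauss_gamma x n * (x * (n%:R / (x + 1 + n%:R))) @[n --> \oo] --> L * (x * 1).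
  by apply: cvgM => //; apply: cvgMr; exact: cvg_ratio1.
rewrite mulr1 mulrC in h; apply: cvg_trans h; apply: near_eq_cvg; near=> n.
rewrite gauss_gammaS//; near: n; exact: nbhs_infty_gt.
Unshelve. all: by end_near. Qed.

(** The functional equation read downwards, to reach the negative arguments b - 2k. *)
Lemma cvg_gauss_gamma_pred (x L : R) : (forall i, x + i%:R != 0) ->
  gauss_gamma (x + 1) @ \oo --> L -> gauss_gamma x @ \oo --> L / x.
Proof.
move=> xi gL; have x0 : x != 0 by have := xi 0%N; rewrite addr0.
have h : gauss_gamma (x + 1) n * (n%:R / (x + 1 + n%:R))^-1 / x @[n --> \oo] --> L * 1^-1 / x.
  apply: cvgMl; apply: cvgM => //; apply: cvgV => //; exact: cvg_ratio1.
rewrite invr1 mulr1 in h; apply: cvg_trans h; apply: near_eq_cvg; near=> n.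
have n0 : (0 < n)%N by near: n; exact: nbhs_infty_gt.
have n1 : (n%:R : R) != 0 by rewrite pnatr_eq0 -lt0n.
rewrite gauss_gammaS//; field; rewrite n1 x0 -addrA nat1r xi //.
Unshelve. all: by end_near. Qed.

Lemma cvg_gauss_gamma_nat m : gauss_gamma (m%:R + 1) @ \oo --> (m`!%:R : R).
Proof.
elim: m => [|m IH]; last first.
  have := cvg_gauss_gammaS (x := m%:R + 1) _ IH.
  rewrite factS natrM -natr1; apply => i.
  by rewrite natr1 -natrD pnatr_eq0.
rewrite add0r fact0.
have := @cvg_ratio1 0; apply: cvg_trans; apply: near_eq_cvg; near=> n.
rewrite /gauss_gamma powRr1// add0r.
have -> : \prod_(0 <= i < n.+1) (1 + i%:R : R) = n.+1`!%:R.
  by rewrite fact_prod natr_prod big_add1 /=; apply: eq_bigr => i _; rewrite nat1r.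
rewrite factS natrM nat1r; field.
by rewrite nat1r !pnatr_eq0 -lt0n fact_gt0.
Unshelve. all: by end_near. Qed.

(** The sequence increases from index 1 on and stays below the decreasing sequence [hi], which has
    (n + 1)^x in place of n^x; both monotonicities are [powR_le_affine]. The limit is positive
    because the term of index 1 is. *)
Lemma cvg_gauss_gamma01 (x : R) : 0 < x < 1 -> exists2 L : R, 0 < L & gauss_gamma x @ \oo --> L.
Proof.
move=> /andP[x0 x1].
have x01 : 0 <= x <= 1 by rewrite !ltW.
have pp n : 0 < \prod_(0 <= i < n.+1) (x + i%:R).
  by rewrite prodr_gt0// => i _; rewrite ltr_wpDr.
have fp n : 0 < (n`!%:R : R) by rewrite ltr0n fact_gt0.
pose hi n := n.+1%:R `^ x * n`!%:R / \prod_(0 <= i < n.+1) (x + i%:R).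
have hiD n : hi n.+1 <= hi n.
  rewrite /hi [X in _ / X]big_nat_recr//= factS natrM.
  have P0 := pp n; have F0 := fp n; set P := \prod_(_ <= _ < _) _ in P0 *.
  have q0 : 0 < n.+2%:R / n.+1%:R :> R by rewrite divr_gt0.
  have h := powR_le_affine q0 x01.
  have -> : n.+2%:R `^ x = (n.+2%:R / n.+1%:R) `^ x * n.+1%:R `^ x :> R.
    by rewrite -powRM ?divfK// ?ltW// pnatr_eq0.
  have e : 1 + x * (n.+2%:R / n.+1%:R - 1) = (x + n.+1%:R) / n.+1%:R :> R.
    by rewrite -(natr1 n.+1); field; rewrite ?(natr1, nat1r) pnatr_eq0.
  rewrite e in h.
  have -> : (n.+2%:R / n.+1%:R) `^ x * n.+1%:R `^ x * (n.+1%:R * n`!%:R) / (P * (x + n.+1%:R))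
     = ((n.+2%:R / n.+1%:R) `^ x / ((x + n.+1%:R) / n.+1%:R)) * (n.+1%:R `^ x * n`!%:R / P).
    have : x + n.+1%:R != 0 by rewrite gt_eqF// ltr_wpDr.
    have : n.+1%:R != 0 :> R by rewrite pnatr_eq0.
    move: (n.+1%:R) => y y0 xy; field; by rewrite y0 xy (gt_eqF P0).
  rewrite ler_piMl//; first by rewrite !mulr_ge0 ?powR_ge0 ?invr_ge0 ?ltW.
  by rewrite ler_pdivrMr ?mul1r// divr_gt0// ltr_wpDr.
have hi1 n : hi n <= hi 0%N by elim: n => // n IH; exact: le_trans IH.
have lohi n : gauss_gamma x n <= hi n.
  rewrite /gauss_gamma /hi ler_wpM2r ?invr_ge0 ?(ltW (pp n))// ler_wpM2r ?(ltW (fp n))//.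
  by apply: ge0_ler_powR; rewrite ?nnegrE ?(ltW x0)// ler_nat.
have loI n : gauss_gamma x n.+1 <= gauss_gamma x n.+2.
  rewrite /gauss_gamma [X in _ <= _ / X]big_nat_recr//= [in leRHS]factS natrM.
  have P0 := pp n.+1; have F0 := fp n.+1; set P := \prod_(_ <= _ < _) _ in P0 *.
  have q0 : 0 < n.+1%:R / n.+2%:R :> R by rewrite divr_gt0.
  have h := powR_le_affine q0 x01.
  have e0 : n.+1%:R `^ x = (n.+1%:R / n.+2%:R) `^ x * n.+2%:R `^ x :> R.
    by rewrite -powRM ?divfK// ?ltW// pnatr_eq0.
  have e : 1 + x * (n.+1%:R / n.+2%:R - 1) = (n.+2%:R - x) / n.+2%:R :> R.
    by rewrite -(natr1 n.+1); field; rewrite ?(natr1, nat1r) ?pnatr_eq0.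
  rewrite e in h; rewrite e0.
  have y2 : (1 : R) <= n.+2%:R by rewrite ler1n.
  have -> : n.+2%:R `^ x * (n.+2%:R * n.+1`!%:R) / (P * (x + n.+2%:R))
    = n.+2%:R / (x + n.+2%:R) * (n.+2%:R `^ x * n.+1`!%:R / P).
    by field; rewrite (gt_eqF P0) /= gt_eqF//; lra.
  have -> : (n.+1%:R / n.+2%:R) `^ x * n.+2%:R `^ x * n.+1`!%:R / P = (n.+1%:R / n.+2%:R) `^ x * (n.+2%:R `^ x * n.+1`!%:R / P).
    by rewrite !mulrA.
  rewrite ler_wpM2r//; first by rewrite !mulr_ge0 ?powR_ge0 ?invr_ge0 ?ltW.
  apply: (le_trans h); move: (n.+2%:R) y2 => y y2.
  have y0 : 0 < y by lra.
  have xy0 : 0 < x + y by lra.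
  rewrite ler_pdivrMr// mulrAC ler_pdivlMr//; nra.
have nd : nondecreasing_seq (fun n => gauss_gamma x n.+1) by apply/nondecreasing_seqP.
have ub : has_ubound (range (fun n => gauss_gamma x n.+1)).
  by exists (hi 0%N) => _ [n _ <-]; exact: le_trans (lohi _) (hi1 _).
have c := nondecreasing_cvgn nd ub.
exists (sup (range (fun n => gauss_gamma x n.+1))); last by rewrite -cvg_shiftS.
apply: (@lt_le_trans _ _ (gauss_gamma x 1)).
  by rewrite /gauss_gamma !mulr_gt0 ?invr_gt0 ?powR_gt0.
by apply: ub_le_sup => //; exists 0%N.
Qed.

Lemma cvg_gauss_gamma_sub (b L : R) m : 0 < b < 1 -> gauss_gamma b @ \oo --> L ->
  gauss_gamma (b - m%:R) @ \oo --> L / \prod_(0 <= i < m) (b - i.+1%:R).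
Proof.
move=> b01 gL; elim: m => [|m IH]; first by rewrite big_nil divr1 subr0.
rewrite big_nat_recr//= invfM mulrA; apply: cvg_gauss_gamma_pred.
  move=> i; have /andP[b0 b1] := b01; apply/eqP => h.
  have : b = m.+1%:R - i%:R by lra.
  have [im|im] := leqP i m.
    by have : (i%:R : R) + 1 <= m.+1%:R by [rewrite natr1 ler_nat|]; lra.
  by have : (m.+1%:R : R) <= i%:R by [rewrite ler_nat|]; lra.
by rewrite (_ : b - m.+1%:R + 1 = b - m%:R)// -natr1; ring.
Qed.

Lemma prod_sub_neq0 (b : R) m : 0 < b < 1 -> \prod_(0 <= i < m) (b - i.+1%:R) != 0.
Proof.
move=> /andP[b0 b1]; rewrite prodf_seq_neq0; apply/allP => i _ /=; rewrite lt_eqF// subr_lt0.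
by apply: (lt_le_trans b1); rewrite ler1n.
Qed.

Lemma Gamma_nat m : Gamma (m%:R + 1) = m`!%:R :> R.
Proof. by apply/cvg_lim => //; exact: cvg_gauss_gamma_nat. Qed.

(** The limit at b is known only to be nonzero, and it cancels in the quotient. *)
Lemma Gamma_quotient (b : R) m : 0 < b < 1 ->
  Gamma b / Gamma (b - m%:R) = \prod_(0 <= i < m) (b - i.+1%:R).
Proof.
move=> b01; have [L L0 gL] := cvg_gauss_gamma01 b01.
have -> : Gamma b = L by apply/cvg_lim.
have -> : Gamma (b - m%:R) = L / \prod_(0 <= i < m) (b - i.+1%:R).
  by apply/cvg_lim => //; exact: cvg_gauss_gamma_sub.
have := prod_sub_neq0 m b01; set P := \prod_(_ <= _ < _) _ => P0.
by field; rewrite P0 gt_eqF.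
Qed.

Lemma hyp2F1_terminating m (x y z : R) : hyp2F1 (- m%:R) x y z =
  \sum_(j < m.+1) rising_factorial (- m%:R) j * rising_factorial x j
                 / rising_factorial y j * (z ^+ j / j`!%:R).
Proof.
apply/cvg_lim => //; apply: cvg_near_cst; near=> n.
have mn : (m.+1 <= n)%N by near: n; exact: nbhs_infty_ge.
rewrite /series /= (big_cat_nat (leq0n m.+1) mn)/= big_mkord [X in _ + X]big_nat_cond [X in _ + X]big1 ?addr0//.
move=> i /andP[/andP[mi _] _].
rewrite (_ : rising_factorial (- m%:R) i = 0) ?mul0r//.
by rewrite /rising_factorial (big_cat_nat (leq0n m.+1) mi)/= big_nat_recr//= addNr mulr0 mul0r.
Unshelve. all: by end_near. Qed.

(** The Gamma quotient times the terminating series is the coefficient of index 2k in the product of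
    (1 + x)^(beta - 1) and (1 - x)^(1 - beta). As 2k is even, the exponent beta - 1 may be replaced
    by 1 - beta. *)
Lemma h_down_coef (beta : R) k : 0 < beta < 1 -> (1 <= k)%N ->
  h_down (cos (pi * beta)) k = half_moebius_coef (1 - beta) k.*2 / (1 + cos (pi * beta)).
Proof.
move=> b01 k1; have /andP[b0 b1] := b01; have p0 := @pi_gt0 R.
have pb : 0 < pi * beta < pi by apply/andP; split; nra.
have s0 : 0 < sin (pi * beta) by exact: sin_gt0_pi.
(* Since sin (pi beta) > 0, neither special branch of [h_down] is taken. *)
have c1 : cos (pi * beta) != 1.
  apply/eqP => h; have := cos2Dsin2 (pi * beta); rewrite h => h2.
  by move: s0 h2; set s := sin _ => *; nra.
have c2 : cos (pi * beta) != -1.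
  apply/eqP => h; have := cos2Dsin2 (pi * beta); rewrite h => h2.
  by move: s0 h2; set s := sin _ => *; nra.
rewrite /h_down eqn0Ngt k1 /= (negbTE c1) (negbTE c2) cosK; last first.
  by rewrite in_itv/=; case/andP: pb => *; rewrite !ltW.
have -> : pi * beta / pi = beta by rewrite mulrC mulKf// gt_eqF.
have -> : 2 * k%:R = (k.*2)%:R :> R by rewrite -mul2n natrM.
set m := k.*2.
rewrite Gamma_nat hyp2F1_terminating -mulrA [RHS]mulrC; congr (_ * _).
have -> : Gamma beta / (m`!%:R * Gamma (beta - m%:R)) = (Gamma beta / Gamma (beta - m%:R)) / m`!%:R.
  by rewrite invfM; ring.
rewrite Gamma_quotient//.
have -> : half_moebius_coef (1 - beta) m = half_moebius_coef (beta - 1) m.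
  by rewrite -[beta - 1]opprB half_moebius_coefN /m -signr_odd odd_double expr0 mul1r.
pose f i : R := \prod_(0 <= r < i) (beta - r.+1%:R) / i`!%:R.
pose g i : R := rising_factorial (beta - 1) i / i`!%:R.
rewrite -(@convolution_coef (beta - 1) f g); last first.
- move=> n; rewrite /g /rising_factorial big_nat_recr//= factS natrM; field.
  by rewrite pnatr_eq0 -lt0n fact_gt0 nat1r pnatr_eq0.
- move=> n; rewrite /f big_nat_recr//= factS natrM -(natr1 n); field.
  by rewrite pnatr_eq0 -lt0n fact_gt0 natr1 pnatr_eq0.
- by rewrite /g /rising_factorial big_nil fact0 divr1.
- by rewrite /f big_nil fact0 divr1.
rewrite mulr_sumr; apply: eq_bigr => -[j jm] _ /=; rewrite ltnS in jm.
have e1 : rising_factorial (- m%:R) j * (-1) ^+ j = m`!%:R / (m - j)`!%:R :> R.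
  apply: (canRL (mulfK _)); first by rewrite pnatr_eq0 -lt0n fact_gt0.
  elim: j jm => [|j IH] jm; first by rewrite /rising_factorial big_nil expr0 !mul1r subn0.
  rewrite -IH ?(ltnW jm)// /rising_factorial big_nat_recr//= exprS.
  rewrite -[in RHS](subnSK jm) factS natrM (subnSK jm) natrB ?(ltnW jm)//; ring.
(* The last j factors, read backwards, form the rising factorial; dividing by it leaves the
   numerator of the binomial coefficient of order m - j. *)
have e2 : \prod_(0 <= i < m) (beta - i.+1%:R) =
    \prod_(0 <= i < m - j) (beta - i.+1%:R) * rising_factorial (beta - m%:R) j.
  elim: j jm {e1} => [|j IH] jm; first by rewrite /rising_factorial big_nil mulr1 subn0.
  rewrite IH ?(ltnW jm)// /rising_factorial [in RHS]big_nat_recr//= -[in LHS](subnSK jm).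
  rewrite big_nat_recr//= (subnSK jm) natrB ?(ltnW jm)//; ring.
have r0 : rising_factorial (beta - m%:R) j != 0.
  by have := prod_sub_neq0 m b01; rewrite e2 mulf_eq0 negb_or => /andP[].
transitivity (\prod_(0 <= i < m) (beta - i.+1%:R) / m`!%:R / rising_factorial (beta - m%:R) j
   * (rising_factorial (- m%:R) j * (-1) ^+ j) * (rising_factorial (beta - 1) j / j`!%:R)).
  by rewrite [(-1) ^+ j / _]mulrC; ring.
rewrite e1 e2 /f /g; field.
by rewrite r0 !pnatr_eq0 -!lt0n !fact_gt0.
Qed.
End HDown.

(** * Asymptotics of the coefficients *)

Section Asymptotics.
Context {R : realType}.
Implicit Types (a t : R).

Lemma continuous_half_moebius_coef n : continuous (fun a => half_moebius_coef a n : R).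
Proof.
suff h : continuous (fun a => half_moebius_coef a n : R) /\ continuous (fun a => half_moebius_coef a n.+1 : R) by case: h.
elim: n => [|n [IH1 IH2]].
  split=> a /=; first exact: cvg_cst.
  by apply: cvgM; [exact: cvg_cst|exact: cvg_id].
split=> // a /=; apply: cvgM; last exact: cvg_cst.
apply: cvgD; apply: cvgM; try exact: cvg_cst; try exact: IH1; try exact: IH2.
by apply: cvgM; [exact: cvg_cst|exact: cvg_id].
Qed.

Lemma half_moebius_coef1 n : half_moebius_coef 1 n.+1 = 2 :> R.
Proof.
suff h : half_moebius_coef 1 n.+1 = 2 :> R /\ half_moebius_coef 1 n.+2 = 2 :> R by case: h.
elim: n => [|n [IH1 IH2]].
  by split; rewrite /= ?mulr1//; field.
split=> //; apply: (@mulfI _ n.+3%:R); first by rewrite pnatr_eq0.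
by rewrite half_moebius_coef_rec IH1 IH2 -(natr1 n.+2) -(natr1 n.+1); ring.
Qed.

(** For the sequence n c(n) the recurrence reads u(n+2) = u(n) + 2 a u(n+1) / (n + 1). Its
    coefficients are nonnegative for a >= 0, so bounds at two consecutive indices propagate. *)
Lemma half_moebius_coef_weighted a n :
  n.+2%:R * half_moebius_coef a n.+2 =
  n%:R * half_moebius_coef a n + 2 * a / n.+1%:R * (n.+1%:R * half_moebius_coef a n.+1).
Proof.
rewrite half_moebius_coef_rec; congr (_ + _).
by field; rewrite nat1r pnatr_eq0.
Qed.

(** (m + 1)^a is a subsolution of the weighted recurrence, by [powR_le_affine] at (m + 3) / (m + 1).
    The constant C does not change along the way, so the bound is uniform in a. *)
Lemma half_moebius_coef_ge a (C : R) n0 n : 0 <= a <= 1 -> 0 <= C ->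
  C * n0.+1%:R `^ a <= n0%:R * half_moebius_coef a n0 ->
  C * n0.+2%:R `^ a <= n0.+1%:R * half_moebius_coef a n0.+1 ->
  C * (n0 + n).+1%:R `^ a <= (n0 + n)%:R * half_moebius_coef a (n0 + n).
Proof.
move=> a01 C0 h0 h1; have /andP[a0 a1] := a01.
suff h : C * (n0 + n).+1%:R `^ a <= (n0 + n)%:R * half_moebius_coef a (n0 + n) /\
   C * (n0 + n).+2%:R `^ a <= (n0 + n).+1%:R * half_moebius_coef a (n0 + n).+1 by case: h.
elim: n => [|n [IH1 IH2]]; first by rewrite addn0.
rewrite addnS; split=> //; move: (n0 + n)%N IH1 IH2 => m {h0 h1} h0 h1.
rewrite half_moebius_coef_weighted.
have m1 : 0 < m.+1%:R :> R by [].
have c0 : 0 <= 2 * a / m.+1%:R by rewrite divr_ge0// mulr_ge0.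
apply: (@le_trans _ _ (C * m.+1%:R `^ a + 2 * a / m.+1%:R * (C * m.+2%:R `^ a))); last first.
  by apply: lerD => //; rewrite ler_wpM2l.
have -> : C * m.+1%:R `^ a + 2 * a / m.+1%:R * (C * m.+2%:R `^ a) =
  C * (m.+1%:R `^ a + 2 * a / m.+1%:R * m.+2%:R `^ a) by ring.
rewrite ler_wpM2l//.
apply: (@le_trans _ _ (m.+1%:R `^ a + 2 * a / m.+1%:R * m.+1%:R `^ a)); last first.
  by rewrite lerD2l ler_wpM2l// ge0_ler_powR ?nnegrE// ler_nat.
have q0 : 0 < m.+3%:R / m.+1%:R :> R by rewrite divr_gt0.
have -> : m.+3%:R `^ a = (m.+3%:R / m.+1%:R) `^ a * m.+1%:R `^ a :> R.
  by rewrite -powRM ?divfK// ?ltW// pnatr_eq0.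
rewrite -[X in _ <= X + _]mul1r -mulrDl ler_wpM2r ?powR_ge0//.
apply: (le_trans (powR_le_affine q0 a01)); apply: le_of_eq.
by rewrite -(natr1 m.+2) -(natr1 m.+1); field; rewrite nat1r pnatr_eq0.
Qed.

(** Dually, the power a of the index minus one is a supersolution, by the same inequality at (m + 1)
    / (m + 3). *)
Lemma half_moebius_coef_le a (C : R) n0 n : 0 <= a <= 1 -> 0 <= C ->
  n0.+2%:R * half_moebius_coef a n0.+2 <= C * n0.+1%:R `^ a ->
  n0.+3%:R * half_moebius_coef a n0.+3 <= C * n0.+2%:R `^ a ->
  (n0 + n).+2%:R * half_moebius_coef a (n0 + n).+2 <= C * (n0 + n).+1%:R `^ a.
Proof.
move=> a01 C0 h0 h1; have /andP[a0 a1] := a01.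
suff h : (n0 + n).+2%:R * half_moebius_coef a (n0 + n).+2 <= C * (n0 + n).+1%:R `^ a /\
   (n0 + n).+3%:R * half_moebius_coef a (n0 + n).+3 <= C * (n0 + n).+2%:R `^ a by case: h.
elim: n => [|n [IH1 IH2]]; first by rewrite addn0.
rewrite addnS; split=> //; move: (n0 + n)%N IH1 IH2 => m {h0 h1} h0 h1.
rewrite half_moebius_coef_weighted.
have c0 : 0 <= 2 * a / m.+3%:R by rewrite divr_ge0// mulr_ge0.
apply: (@le_trans _ _ (C * m.+1%:R `^ a + 2 * a / m.+3%:R * (C * m.+2%:R `^ a))).
  by apply: lerD => //; rewrite ler_wpM2l.
have -> : C * m.+1%:R `^ a + 2 * a / m.+3%:R * (C * m.+2%:R `^ a) =
  C * (m.+1%:R `^ a + 2 * a / m.+3%:R * m.+2%:R `^ a) by ring.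
rewrite ler_wpM2l//.
apply: (@le_trans _ _ (m.+1%:R `^ a + 2 * a / m.+3%:R * m.+3%:R `^ a)).
  by rewrite lerD2l ler_wpM2l// ge0_ler_powR ?nnegrE// ler_nat.
have q0 : 0 < m.+1%:R / m.+3%:R :> R by rewrite divr_gt0.
have -> : m.+1%:R `^ a = (m.+1%:R / m.+3%:R) `^ a * m.+3%:R `^ a :> R.
  by rewrite -powRM ?divfK// ?ltW// pnatr_eq0.
rewrite -mulrDl ler_piMl ?powR_ge0// -lerBrDr.
apply: (le_trans (powR_le_affine q0 a01)); apply: le_of_eq.
rewrite -(natr1 m.+2) -(natr1 m.+1); field; rewrite ?(nat1r, natr1, natrD) -?natrD.
by rewrite gt_eqF//; have := ler0n R m => ?; lra.
Qed.

Lemma cvg_lnV : (ln n%:R)^-1 @[n --> \oo] --> (0 : R).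
Proof.
apply/cvgr0Pnorm_lt => e e0; near=> n.
have h : expR (2 / e) <= n%:R by near: n; exact: nbhs_infty_ger.
have n0 : 0 < n%:R :> R by apply: lt_le_trans h; exact: expR_gt0.
have l : 2 / e <= ln n%:R by rewrite -(expRK (2 / e)) ler_ln ?posrE ?expR_gt0.
have l0 : 0 < ln n%:R :> R by apply: lt_le_trans l; rewrite divr_gt0.
rewrite ger0_norm ?invr_ge0 ?ltW// invf_plt ?posrE//.
apply: lt_le_trans l; rewrite -[X in X < _]mul1r ltr_pM2r ?invr_gt0// ltr1n//.
Unshelve. all: by end_near. Qed.

(** x^(1 - t / ln n) is x exp (- t ln x / ln n), and ln x / ln n tends to 1 because x / n stays
    between 1 and 3. *)
Lemma cvg_powR_exponent t (x : nat -> R) :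
  (\forall n \near \oo, n%:R <= x n <= 3 * n%:R) -> x n / (2 * n%:R) @[n --> \oo] --> (1 : R) ->
  x n `^ (1 - t / ln n%:R) / (2 * n%:R) @[n --> \oo] --> expR (- t).
Proof.
move=> xn x1.
have e1 : ln (x n / n%:R) / ln n%:R @[n --> \oo] --> (0 : R).
  have c3 : ln 3 / ln n%:R @[n --> \oo] --> (0 : R).
    by rewrite -[X in _ --> X](mulr0 (ln 3)); apply: cvgMr; exact: cvg_lnV.
  apply: (@squeeze_cvgr _ _ _ _ (cst 0) _ _ _ _ _ c3); last exact: cvg_cst.
  near=> n.
  have n1 : 1 < n%:R :> R by rewrite ltr1n; near: n; exact: nbhs_infty_gt.
  have n0 : 0 < n%:R :> R by lra.
  have l0 : 0 < ln n%:R :> R by rewrite ln_gt0.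
  have /andP[h1 h2] : n%:R <= x n <= 3 * n%:R by near: n.
  rewrite divr_ge0 ?(ltW l0)//=; last by rewrite ln_ge0// ler_pdivlMr// mul1r.
  rewrite ler_wpM2r ?invr_ge0 ?(ltW l0)// ler_ln ?posrE//; last by rewrite divr_gt0//; lra.
  by rewrite ler_pdivrMr.
have e2 : x n / (2 * n%:R) * expR (- (t * (1 + ln (x n / n%:R) / ln n%:R))) @[n --> \oo] --> 1 * expR (- t).
  apply: cvgM => //; apply: continuous_cvg; first exact: continuous_expR.
  apply: cvgN; rewrite -[X in _ --> X]mulr1; apply: cvgMr; rewrite -[X in _ --> X]addr0.
  by apply: cvgD => //; exact: cvg_cst.
rewrite mul1r in e2; apply: cvg_trans e2; apply: near_eq_cvg; near=> n.
have n1 : 1 < n%:R :> R by rewrite ltr1n; near: n; exact: nbhs_infty_gt.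
have n0 : 0 < n%:R :> R by lra.
have l0 : 0 < ln n%:R :> R by rewrite ln_gt0.
have /andP[h1 h2] : n%:R <= x n <= 3 * n%:R by near: n.
have x0 : 0 < x n by lra.
rewrite powRB; last by rewrite (gt_eqF x0) implybT.
rewrite powRr1 ?(ltW x0)// [RHS]mulrAC; congr (_ * _); rewrite -powRN /powR (gt_eqF x0).
congr expR; rewrite lnM ?posrE ?invr_gt0// lnV ?posrE//; field.
by rewrite gt_eqF.
Unshelve. all: by end_near. Qed.

(** The exponent moves with n, so asymptotics at fixed a do not apply. At a = 1 all coefficients of
    positive index are 2; hence for C slightly below or above 2 the comparison holds at two fixed
    indices for every a close to 1, and it propagates up to 2n, where (2n + 1)^a / (2n) and (2n -
    1)^a / (2n) tend to e^(-t). *)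
Lemma cvg_half_moebius_coef t : 0 < t ->
  half_moebius_coef (1 - t / ln n%:R) n.*2 @[n --> \oo] --> 2 * expR (- t).
Proof.
move=> t0; set a := fun n : nat => 1 - t / ln n%:R.
have ca : a @ \oo --> (1 : R).
  rewrite -[X in _ --> X]subr0; apply: cvgB; first exact: cvg_cst.
  by rewrite -[X in _ --> X](mulr0 t); apply: cvgMr; exact: cvg_lnV.
have cinv : (n%:R^-1 : R) @[n --> \oo] --> (0 : R) by rewrite -cvg_shiftS; exact: cvg_harmonic.
have cu : (n.*2).+1%:R `^ (a n) / (2 * n%:R) @[n --> \oo] --> expR (- t).
  apply: cvg_powR_exponent.
    near=> n; have n1 : (0 < n)%N by near: n; exact: nbhs_infty_gt.
    by rewrite -(natrM R 3) !ler_nat -mul2n; apply/andP; split; lia.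
  have c : 1 + 2^-1 * n%:R^-1 @[n --> \oo] --> (1 + 2^-1 * 0 : R).
    by apply: cvgD; [exact: cvg_cst|apply: cvgMr].
  rewrite mulr0 addr0 in c; apply: cvg_trans c; apply: near_eq_cvg; near=> n.
  have n0 : n%:R != 0 :> R by rewrite pnatr_eq0 -lt0n; near: n; exact: nbhs_infty_gt.
  by rewrite -(natr1 n.*2) -mul2n natrM; field.
have cv : (n.*2).-1%:R `^ (a n) / (2 * n%:R) @[n --> \oo] --> expR (- t).
  apply: cvg_powR_exponent.
    near=> n; have n1 : (0 < n)%N by near: n; exact: nbhs_infty_gt.
    by rewrite -(natrM R 3) !ler_nat -mul2n; apply/andP; split; lia.
  have c : 1 - 2^-1 * n%:R^-1 @[n --> \oo] --> (1 - 2^-1 * 0 : R).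
    by apply: cvgB; [exact: cvg_cst|apply: cvgMr].
  rewrite mulr0 subr0 in c; apply: cvg_trans c; apply: near_eq_cvg; near=> n.
  have n1 : (0 < n)%N by near: n; exact: nbhs_infty_gt.
  have n0 : n%:R != 0 :> R by rewrite pnatr_eq0 -lt0n.
  have -> : (n.*2).-1%:R = 2 * n%:R - 1 :> R.
    by rewrite -(natrM R 2) mul2n -subn1 natrB// double_gt0.
  by field.
have ca01 : \forall n \near \oo, 0 <= a n <= 1.
  near=> n; apply/andP; split; first by apply: ltW; near: n; exact: (cvgr_gt _ ca).
  rewrite /a gerBl divr_ge0 ?(ltW t0)// ln_ge0// ler1n; near: n; exact: nbhs_infty_gt.
have cpow (y : R) : 0 < y -> y `^ (a n) @[n --> \oo] --> y.
  move=> y0; have c : expR (a n * ln y) @[n --> \oo] --> expR (1 * ln y).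
    by apply: continuous_cvg; [exact: continuous_expR|apply: cvgMl].
  rewrite mul1r lnK ?posrE// in c; apply: cvg_trans c; apply: near_eq_cvg; apply: nearW => n.
  by rewrite /powR gt_eqF.
have cc m : half_moebius_coef (a n) m.+1 @[n --> \oo] --> (2 : R).
  rewrite -(half_moebius_coef1 m); exact: (cvg_comp _ _ ca (@continuous_half_moebius_coef m.+1 1)).
have lower C : 0 <= C < 2 -> \forall n \near \oo, C * ((n.*2).+1%:R `^ (a n) / (2 * n%:R)) <= half_moebius_coef (a n) n.*2.
  move=> /andP[C0 C2].
  (* This is the comparison at index m + 1 for a = 1; [hm2] is the next index, needed because the
     recurrence has two steps. *)
  have [m hm] : exists m : nat, C * m.+2%:R < 2 * m.+1%:R.
    near \oo => m; exists m.
    have hm : C / (2 - C) < m%:R by near: m; exact: nbhs_infty_gtr.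
    have d0 : 0 < 2 - C by lra.
    by move: hm; rewrite ltr_pdivrMr// => hm; rewrite -(natr1 m.+1) -(natr1 m); nra.
  have hm2 : C * m.+3%:R < 2 * m.+2%:R by move: hm; rewrite -(natr1 m.+2) -(natr1 m.+1); lra.
  have L k : C * k.+2%:R < 2 * k.+1%:R -> \forall n \near \oo, C * k.+2%:R `^ (a n) <= k.+1%:R * half_moebius_coef (a n) k.+1.
    move=> hk.
    have c : k.+1%:R * half_moebius_coef (a n) k.+1 - C * k.+2%:R `^ (a n) @[n --> \oo] --> k.+1%:R * 2 - C * k.+2%:R.
      by apply: cvgB; apply: cvgMr => //; exact: cpow.
    have p : 0 < k.+1%:R * 2 - C * k.+2%:R by rewrite subr_gt0 [ltRHS]mulrC.
    have q := cvgr_gt _ c _ p.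
    by near=> n; apply/ltW; rewrite -subr_gt0; near: n; exact: q.
  have := L _ hm; have := L _ hm2 => l2 l1.
  near=> n.
  have n1 : (m.+1 <= n)%N by near: n; exact: nbhs_infty_ge.
  have h := @half_moebius_coef_ge (a n) C m.+1 (n.*2 - m.+1).
  have n0 : 0 < 2 * n%:R :> R by rewrite mulr_gt0// ltr0n (leq_trans _ n1).
  rewrite mulrA ler_pdivrMr// mulrC [X in _ <= X]mulrC.
  have mn : (m.+1 <= n.*2)%N by rewrite (leq_trans n1)// -addnn leq_addr.
  move: h; rewrite subnKC//.
  have -> : (n.*2)%:R = 2 * n%:R :> R by rewrite -mul2n natrM.
  rewrite [C * _ `^ _ in X in _ -> _ -> _ -> _ -> X]mulrC; apply => //; near: n; first exact: ca01.
    exact: l1.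
  exact: l2.
have upper C : 2 < C -> \forall n \near \oo, half_moebius_coef (a n) n.*2 <= C * ((n.*2).-1%:R `^ (a n) / (2 * n%:R)).
  move=> C2.
  have [m hm] : exists m : nat, 2 * m.+2%:R < C * m.+1%:R.
    near \oo => m; exists m.
    have hm : 4 / (C - 2) < m%:R by near: m; exact: nbhs_infty_gtr.
    have d0 : 0 < C - 2 by lra.
    by move: hm; rewrite ltr_pdivrMr// => hm; rewrite -(natr1 m.+1) -(natr1 m); nra.
  have hm2 : 2 * m.+3%:R < C * m.+2%:R by move: hm; rewrite -(natr1 m.+2) -(natr1 m.+1); lra.
  have L k : 2 * k.+2%:R < C * k.+1%:R -> \forall n \near \oo, k.+2%:R * half_moebius_coef (a n) k.+2 <= C * k.+1%:R `^ (a n).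
    move=> hk.
    have c : C * k.+1%:R `^ (a n) - k.+2%:R * half_moebius_coef (a n) k.+2 @[n --> \oo] --> C * k.+1%:R - k.+2%:R * 2.
      by apply: cvgB; apply: cvgMr => //; exact: cpow.
    have p : 0 < C * k.+1%:R - k.+2%:R * 2 by rewrite subr_gt0 [ltLHS]mulrC.
    have q := cvgr_gt _ c _ p.
    by near=> n; apply/ltW; rewrite -subr_gt0; near: n; exact: q.
  have := L _ hm; have := L _ hm2 => l2 l1.
  near=> n.
  have n1 : (m.+2 <= n)%N by near: n; exact: nbhs_infty_ge.
  have h := @half_moebius_coef_le (a n) C m (n.*2 - m.+2).
  have n0 : 0 < 2 * n%:R :> R by rewrite mulr_gt0// ltr0n (leq_trans _ n1).
  rewrite mulrA ler_pdivlMr// mulrC.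
  have mn : (m.+2 <= n.*2)%N by rewrite (leq_trans n1)// -addnn leq_addr.
  have e2 : (m + (n.*2 - m.+2)).+2 = n.*2 by rewrite -!addSn subnKC.
  move: h; rewrite -[(_ + _).+1]/(((m + (n.*2 - m.+2)).+2).-1) e2.
  have -> : (n.*2)%:R = 2 * n%:R :> R by rewrite -mul2n natrM.
  have C0 : 0 <= C by lra.
  apply => //; near: n; first exact: ca01.
    exact: l1.
  exact: l2.
apply/cvgrPdist_lt => e e0.
have E0 := expR_gt0 (- t); have E1 : expR (- t) <= 1 by rewrite expR_le1; lra.
pose d := Num.min (e / 2) 1.
have d0 : 0 < d by rewrite lt_min ltr01 divr_gt0.
have d1 : d <= 1 by rewrite ge_min lexx orbT.
have de : d <= e / 2 by rewrite ge_min lexx.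
have lo := lower (2 - d); have up := upper (2 + d).
have clo : (2 - d) * ((n.*2).+1%:R `^ (a n) / (2 * n%:R)) @[n --> \oo] --> (2 - d) * expR (- t) by apply: cvgMr.
have cup : (2 + d) * ((n.*2).-1%:R `^ (a n) / (2 * n%:R)) @[n --> \oo] --> (2 + d) * expR (- t) by apply: cvgMr.
have hlo : 2 * expR (- t) - e < (2 - d) * expR (- t) by nra.
have hup : (2 + d) * expR (- t) < 2 * expR (- t) + e by nra.
have l1 := cvgr_gt _ clo _ hlo; have u1 := cvgr_lt _ cup _ hup.
near=> n.
have b1 : 2 * expR (- t) - e < half_moebius_coef (a n) n.*2.
  apply: (@lt_le_trans _ _ ((2 - d) * ((n.*2).+1%:R `^ (a n) / (2 * n%:R)))); near: n; first exact: l1.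
  by apply: lo; apply/andP; split; lra.
have b2 : half_moebius_coef (a n) n.*2 < 2 * expR (- t) + e.
  apply: (@le_lt_trans _ _ ((2 + d) * ((n.*2).-1%:R `^ (a n) / (2 * n%:R)))); near: n; last exact: u1.
  by apply: up; lra.
by clear -b1 b2; rewrite ltr_norml; apply/andP; split; lra.
Unshelve. all: by end_near. Qed.
End Asymptotics.

(** * A continuity theorem for the Cauchy law *)

Section Continuity.
Context {R : realType}.
Notation mu := (@lebesgue_measure R).

Definition cauchy_kernel (e z : R) : R := e / (pi * (e ^+ 2 + z ^+ 2)).

Lemma cauchy_kernel_ge0 e z : 0 <= e -> 0 <= cauchy_kernel e z.
Proof. by move=> e0; rewrite divr_ge0// mulr_ge0 ?pi_ge0// addr_ge0 ?sqr_ge0. Qed.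

Lemma cauchy_kernel_le e z : 0 < e -> cauchy_kernel e z <= (pi * e)^-1.
Proof.
move=> e0; have p0 := @pi_gt0 R.
have q0 : 0 < e ^+ 2 + z ^+ 2 by rewrite ltr_pwDl ?exprn_gt0 ?sqr_ge0.
rewrite /cauchy_kernel ler_pdivrMr ?mulr_gt0//.
have -> : (pi * e)^-1 * (pi * (e ^+ 2 + z ^+ 2)) = (e ^+ 2 + z ^+ 2) / e.
  by move: (pi) p0 => p p0; field; rewrite (gt_eqF e0) (gt_eqF p0).
by rewrite ler_pdivlMr// -expr2 lerDl sqr_ge0.
Qed.

Lemma continuous_cauchy_kernel e : 0 < e -> continuous (cauchy_kernel e).
Proof.
move=> e0 z; have q0 : 0 < e ^+ 2 + z ^+ 2 by rewrite ltr_pwDl ?exprn_gt0 ?sqr_ge0.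
apply: cvgM; first exact: cvg_cst.
apply: cvgV; first by rewrite gt_eqF// mulr_gt0// pi_gt0.
apply: cvgM; first exact: cvg_cst.
by apply: cvgD; [exact: cvg_cst|exact: exprn_continuous].
Qed.

Lemma integral_cauchy_pdf : (\int[mu]_x (cauchy_pdf x)%:E = 1)%E.
Proof. exact: (@probability_setT _ _ R (@cauchy_prob R)). Qed.

Lemma integral_cauchy_kernel e x : 0 < e -> (\int[mu]_y (cauchy_kernel e (x - y))%:E = 1)%E.
Proof.
move=> e0; have ei0 : 0 < e^-1 by rewrite invr_gt0.
pose F := fun y : R => e^-1 * (y - x).
have dF (y : R) : is_derive y 1 F e^-1.
  have h := is_deriveZ e^-1 (is_deriveB (is_derive_id y 1) (is_derive_cst x y 1)).
  by apply: (is_derive_eq h); rewrite subr0 /GRing.scale/= mulr1.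
have F' : (F^`())%classic = fun=> e^-1.
  by apply/funext => y; rewrite derive1E; have := dF y => h; rewrite derive_val.
have := @increasing_ge0_integration_by_substitutionT R F (@cauchy_pdf R).
rewrite integral_cauchy_pdf F' => ->.
- apply: eq_integral => y _; congr EFin; rewrite /= /cauchy_kernel /cauchy_pdf /F /=.
  have q0 : 0 < e ^+ 2 + (x - y) ^+ 2 by rewrite ltr_pwDl ?exprn_gt0 ?sqr_ge0.
  have q1 : 0 < 1 + (e^-1 * (y - x)) ^+ 2 by rewrite ltr_pwDl ?sqr_ge0.
  transitivity (e / (pi * (e ^+ 2 * (1 + (e^-1 * (y - x)) ^+ 2)))).
    by congr (_ / (_ * _)); field; rewrite gt_eqF.
  have p0 := @pi_gt0 R.
  transitivity (pi^-1 * (1 + (e^-1 * (y - x)) ^+ 2)^-1 * e^-1); last by [].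
  move: (pi) (1 + (e^-1 * (y - x)) ^+ 2) p0 q1 => p q p0 q1; field.
  by rewrite (gt_eqF q1) (gt_eqF e0) (gt_eqF p0).
- by move=> a b ab; rewrite /F ltr_pM2l// ltrD2r.
- by move=> y; exact: cvg_cst.
- exact: is_cvg_cst.
- exact: is_cvg_cst.
- by move=> y; case: (dF y).
- apply/cvgrNyPle => A; near=> y.
  rewrite /F -ler_pdivlMl ?invrK// lerBlDr; near: y; apply: nbhs_ninfty_le; exact: num_real.
- apply/cvgryPge => A; near=> y.
  rewrite /F -ler_pdivrMl ?invrK// lerBrDr; near: y; apply: nbhs_pinfty_ge; exact: num_real.
- exact: continuous_cauchy_pdf.
- exact: cauchy_pdf_ge0.
Unshelve. all: by end_near. Qed.

Lemma integrable_cauchy_kernel e x : 0 < e -> mu.-integrable setT (EFin \o (fun y => cauchy_kernel e (x - y))).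
Proof.
move=> e0; apply/integrableP; split.
  apply/measurable_EFinP; apply: continuous_measurable_fun => y.
  apply: (@continuous_comp _ _ _ (fun y => x - y)); last exact: continuous_cauchy_kernel.
  by apply: cvgB; [exact: cvg_cst|exact: cvg_id].
rewrite (_ : (\int[mu]_y _)%E = 1%E) ?ltry// -(integral_cauchy_kernel x e0).
by apply: eq_integral => y _ /=; rewrite ger0_norm// cauchy_kernel_ge0// ltW.
Qed.

Section exp_cos.
Variables (e z : R).
Hypothesis e0 : 0 < e.

Let G t : R := expR (- e * t) * (z * sin (z * t) - e * cos (z * t)) / (e ^+ 2 + z ^+ 2).

Let dG (t : R) : is_derive t 1 G (expR (- e * t) * cos (z * t)).
Proof.
have q0 : e ^+ 2 + z ^+ 2 != 0 by rewrite gt_eqF// ltr_pwDl ?exprn_gt0 ?sqr_ge0.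
have hZ (k : R) : is_derive t 1 (fun t => k * t) k.
  by have := is_deriveZ k (is_derive_id t 1); rewrite /GRing.scale/= mulr1.
have h1 := is_derive1_comp (is_derive_expR (- e * t)) (hZ (- e)).
have h2 := is_derive1_comp (is_derive_sin (z * t)) (hZ z).
have h3 := is_derive1_comp (is_derive_cos (z * t)) (hZ z).
have h4 := is_deriveM h1 (is_deriveB (is_deriveZ z h2) (is_deriveZ e h3)).
have h5 := is_deriveZ (e ^+ 2 + z ^+ 2)^-1 h4.
have -> : G = (e ^+ 2 + z ^+ 2)^-1 \*: ((expR \o (fun t => - e * t)) * (z \*: (sin \o (fun t => z * t)) - e \*: (cos \o (fun t => z * t)))).
  by apply/funext => u; rewrite /G /= !fctE /GRing.scale /= /GRing.scale /= mulrC.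
apply: (is_derive_eq h5); rewrite /GRing.scale /= !fctE /GRing.scale /= /GRing.scale /=.
field.
by [].
Qed.

Lemma integral_exp_cos_n n : \int[mu]_(t in `[0, n.+1%:R]) (expR (- e * t) * cos (z * t)) = G n.+1%:R - G 0.
Proof.
have n0 : 0 < n.+1%:R :> R by [].
have c : forall t : R, 0 <= t <= n.+1%:R -> {for t, continuous (fun t => expR (- e * t) * cos (z * t))}.
  move=> t _; apply: cvgM.
    by apply: continuous_comp; [apply: cvgM; [exact: cvg_cst|exact: cvg_id]|exact: continuous_expR].
  by apply: continuous_comp; [apply: cvgM; [exact: cvg_cst|exact: cvg_id]|exact: continuous_cos].
by have [_ ->] := FTC2_is_derive n0 (fun t _ => dG t) c.
Qed.

Let pdf := exponential_pdf e.

Lemma integrable_pdf_cos : mu.-integrable setT (EFin \o (fun t => pdf t * cos (z * t))).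
Proof.
apply: (@integrable_EFin_le _ _ _ mu setT _ _ pdf) => //; last exact: integrable_exponential_pdf.
  apply: measurable_funM; first exact: measurable_exponential_pdf.
  by apply: continuous_measurable_fun => x; apply: continuous_comp; [apply: cvgM; [exact: cvg_cst|exact: cvg_id]|exact: continuous_cos].
move=> x _; rewrite normrM ger0_norm ?exponential_pdf_ge0 ?(ltW e0)//.
by rewrite ler_piMr ?exponential_pdf_ge0 ?cos_max ?(ltW e0).
Qed.

Let GV : G n.+1%:R @[n --> \oo] --> (0 : R).
Proof.
have c : expR (- e) ^+ n.+1 * ((`|z| + e) / (e ^+ 2 + z ^+ 2)) @[n --> \oo] --> (0 * ((`|z| + e) / (e ^+ 2 + z ^+ 2)) : R).
  apply: cvgMl; rewrite (cvg_shiftS (fun n => expR (- e) ^+ n)).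
  by apply: cvg_expr; rewrite ger0_norm ?expR_ge0// expR_lt1 oppr_lt0.
rewrite mul0r in c.
apply: norm_cvg0; apply: (@squeeze_cvgr _ _ _ _ (cst 0) _ _ _ _ _ c); last exact: cvg_cst.
apply: nearW => n; rewrite normr_ge0 /= /G !normrM ger0_norm ?expR_ge0//.
have -> : expR (- e * n.+1%:R) = expR (- e) ^+ n.+1 by rewrite expRM_natr.
have q0 : 0 < e ^+ 2 + z ^+ 2 by rewrite ltr_pwDl ?exprn_gt0 ?sqr_ge0.
rewrite normfV (ger0_norm (ltW q0)) -mulrA ler_wpM2l ?exprn_ge0 ?expR_ge0// ler_wpM2r ?invr_ge0 ?(ltW q0)//.
rewrite (le_trans (ler_normB _ _))// lerD// normrM ?(ger0_norm (ltW e0)).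
  by rewrite ler_piMr// sin_max.
by rewrite ler_piMr ?cos_max ?ltW.
Qed.

(** The Cauchy kernel as a mixture of cosines under the exponential law; as the kernel is even, the
    half-line is enough. *)
Lemma integral_exponential_pdf_cos : \int[mu]_t (pdf t * cos (z * t)) = pi * e * cauchy_kernel e z.
Proof.
pose In (n : nat) : set R := `[0, n.+1%:R]%classic.
have mIn n : measurable (In n) by exact: measurable_itv.
pose f (t : R) := pdf t * cos (z * t).
have fi : mu.-integrable setT (EFin \o f) := integrable_pdf_cos.
have mf : measurable_fun setT (EFin \o f) by case/integrableP : fi.
have En n : \int[mu]_(t in In n) f t = e * (G n.+1%:R - G 0).
  rewrite -integral_exp_cos_n -RintegralZl//; last first.
    apply: continuous_compact_integrable; first exact: segment_compact.
    apply: continuous_subspaceT => x; apply: cvgM.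
      by apply: continuous_comp; [apply: cvgM; [exact: cvg_cst|exact: cvg_id]|exact: continuous_expR].
    by apply: continuous_comp; [apply: cvgM; [exact: cvg_cst|exact: cvg_id]|exact: continuous_cos].
  apply: eq_Rintegral => t /set_mem; rewrite /In /= in_itv/= => /andP[t0 _].
  by rewrite /f /pdf exponential_pdfE// mulrA.
have c1 : e * (G n.+1%:R - G 0) @[n --> \oo] --> e * (0 - G 0).
  by apply: cvgMr; apply: cvgB => //; exact: cvg_cst.
have v : e * (0 - G 0) = pi * e * cauchy_kernel e z.
  have q0 : 0 < e ^+ 2 + z ^+ 2 by rewrite ltr_pwDl ?exprn_gt0 ?sqr_ge0.
  have p0 := @pi_gt0 R; rewrite /G /cauchy_kernel !mulr0 expR0 sin0 cos0.
  move: (pi) p0 => p p0; field.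
  by rewrite (gt_eqF q0) (gt_eqF p0).
rewrite -v; apply: (cvg_unique _ _ c1) => //.
have [|||||_ _] := @dominated_convergence _ _ R mu setT measurableT
   (fun n => EFin \o (f \_ (In n))) (EFin \o f) (abse \o (EFin \o f)).
- move=> n; apply/measurable_EFinP/measurable_restrict; [exact: mIn|exact: measurableT|].
  by apply: measurable_funTS; exact/measurable_EFinP.
- exact: mf.
- apply: aeW => t _; apply: cvg_near_cst.
  have [t0|t0] := leP 0 t.
    near=> n; rewrite /= patchE mem_set// /In /= in_itv/= t0 /=.
    have h : t <= n%:R by near: n; exact: nbhs_infty_ger.
    by rewrite (le_trans h)// ler_nat.
  apply: nearW => n /=; rewrite patchE memNset /=.
    by rewrite /f /pdf lt0_exponential_pdf// mul0r.
  by rewrite /In /= in_itv/= leNgt t0.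
- exact: integrable_abse.
- apply: aeW => t n _ /=; rewrite patchE; case: ifP => //= _.
  by rewrite normr0 lee_fin.
move=> h; rewrite /Rintegral.
have h2 : fine (\int[mu]_t (EFin \o (f \_ (In n))) t)%E @[n --> \oo] --> fine (\int[mu]_t (f t)%:E)%E.
  by apply: fine_cvg; rewrite fineK//; exact: (integrable_fin_num _ fi).
apply: cvg_trans h2; apply: near_eq_cvg; apply: nearW => n.
by rewrite -En Rintegral_mkcond.
Unshelve. all: by end_near. Qed.

End exp_cos.

Lemma bounded_integrable d (U : measurableType d) (Q : probability U R) (f : U -> R) (M : R) :
  measurable_fun setT f -> (forall x, `|f x| <= M) -> Q.-integrable setT (EFin \o f).
Proof.
move=> mf fM; apply: (@integrable_EFin_le _ _ _ Q setT _ _ (fun=> M)) => //.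
exact: finite_measure_integrable_cst.
Qed.

Lemma Rintegral_cst_probability d (U : measurableType d) (Q : probability U R) (c : R) : \int[Q]__ c = c.
Proof.
rewrite Rintegral_cst//; have q1 : Q setT = 1%E := probability_setT Q.
by rewrite [X in fine X](_ : _ = 1%E) ?mulr1.
Qed.

Lemma Rintegral_bounded d (U : measurableType d) (Q : probability U R) (f : U -> R) (M : R) :
  measurable_fun setT f -> (forall x, `|f x| <= M) -> `|\int[Q]_x f x| <= M.
Proof.
move=> mf fM; have fi := bounded_integrable Q mf fM.
apply: (le_trans (le_normr_Rintegral _ fi)) => //.
rewrite -(Rintegral_cst_probability Q M).
apply: le_Rintegral => //; first exact: integrable_norm.
exact: finite_measure_integrable_cst.
Qed.

(** * Smoothing a law or a test function by a Cauchy kernel *)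

Section OneLaw.
Context d (U : measurableType d) (Q : probability U R) (Y : U -> R).
Hypothesis mY : measurable_fun setT Y.

Let mcos (t y : R) : measurable_fun setT (fun w => cos (t * (Y w - y))).
Proof.
apply: measurableT_comp; first by apply: continuous_measurable_fun; exact: continuous_cos.
by apply: measurable_funM => //; apply: measurable_funB.
Qed.

Let mK (e y : R) : 0 < e -> measurable_fun setT (fun w => cauchy_kernel e (Y w - y)).
Proof.
move=> e0; apply: measurableT_comp; first by apply: continuous_measurable_fun; exact: continuous_cauchy_kernel.
exact: measurable_funB.
Qed.

Definition fourier_integrand (e y : R) (p : U * R) : \bar R := (exponential_pdf e p.2 * cos ((Y p.1 - y) * p.2))%:E.

Let mfi e y : measurable_fun setT (fourier_integrand e y).
Proof.
apply/measurable_EFinP; apply: measurable_funM.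
  by apply: measurableT_comp => //; exact: measurable_exponential_pdf.
apply: measurableT_comp; first by apply: continuous_measurable_fun; exact: continuous_cos.
by apply: measurable_funM => //; apply: measurable_funB => //; apply: measurableT_comp.
Qed.

Let ifi e y : 0 < e -> (Q \x mu)%E.-integrable setT (fourier_integrand e y).
Proof.
move=> e0; apply/integrable12ltyP; first exact: mfi.
apply: (@le_lt_trans _ _ (\int[Q]_w 1)%E); last by rewrite integral_cst// mul1e (_ : _ setT = 1%E) ?ltry//; exact: probability_setT.
apply: ge0_le_integral => //.
- by move=> w _; apply: integral_ge0.
- apply: (@measurable_fun_fubini_tonelli_F _ _ _ _ _ mu (fun p => `|fourier_integrand e y p|%E)) => //.
  by apply: measurableT_comp => //; exact: mfi.
move=> w _; rewrite -(integral_exponential_pdf e0); apply: ge0_le_integral => //.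
- apply: measurableT_comp => //; apply/measurable_EFinP.
  by have /integrableP[/measurable_EFinP] := @integrable_pdf_cos e (Y w - y) e0.
- by apply/measurable_EFinP; exact: measurable_exponential_pdf.
move=> t _; rewrite /fourier_integrand /= lee_fin normrM ger0_norm ?exponential_pdf_ge0 ?(ltW e0)//.
by rewrite ler_piMr ?exponential_pdf_ge0 ?cos_max ?(ltW e0).
Qed.

Let inner e y t : (\int[Q]_w fourier_integrand e y (w, t) = (exponential_pdf e t * \int[Q]_w cos (t * (Y w - y)))%:E)%E.
Proof.
have ci := bounded_integrable Q (mcos t y) (fun w => cos_max _).
rewrite EFinM fineK; last exact: (integrable_fin_num _ ci).
rewrite -integralZl//; apply: eq_integral => w _.
by rewrite /fourier_integrand /= EFinM mulrC.
Qed.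

Lemma measurable_fourier e y : 0 < e ->
  measurable_fun setT (fun t => exponential_pdf e t * \int[Q]_w cos (t * (Y w - y))).
Proof.
move=> e0; apply/measurable_EFinP.
have := @measurable_fubini_G _ _ _ _ _ Q mu _ (ifi y e0).
by congr (measurable_fun _ _); apply/funext => t /=; rewrite /fubini_G inner.
Qed.

(** By Fubini, the smoothed law at [y] depends on [Y] only through its characteristic function. *)
Lemma expectation_cauchy_kernel e y : 0 < e ->
  \int[Q]_w cauchy_kernel e (Y w - y) =
  (pi * e)^-1 * \int[mu]_t (exponential_pdf e t * \int[Q]_w cos (t * (Y w - y))).
Proof.
move=> e0; have p0 : 0 < pi * e by rewrite mulr_gt0// pi_gt0.
have := Fubini (ifi y e0).
under eq_integral => w _.
  rewrite (_ : (\int[mu]_t _)%E = (pi * e * cauchy_kernel e (Y w - y))%:E); last first.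
    rewrite -integral_exponential_pdf_cos// /Rintegral fineK//.
    by apply: (integrable_fin_num _ (integrable_pdf_cos (Y w - y) e0)).
  over.
under [X in _ = X]eq_integral do rewrite inner.
move=> /(congr1 fine); rewrite -!/(Rintegral _ _ _) RintegralZl//.
  by move=> <-; rewrite mulKf// gt_eqF.
apply: (bounded_integrable Q (mK y e0) (M := (pi * e)^-1)) => w.
by rewrite ger0_norm ?cauchy_kernel_le// cauchy_kernel_ge0// ltW.
Qed.

Variables (e : R) (g : R -> R).
Hypotheses (e0 : 0 < e) (cg : continuous g) (g01 : forall y, 0 <= g y <= 1).

Definition cauchy_smooth (e : R) (g : R -> R) (x : R) : R := \int[mu]_y (g y * cauchy_kernel e (x - y)).

Let k_int x := integrable_cauchy_kernel x e0.

Lemma integrable_cauchy_smooth x : mu.-integrable setT (EFin \o (fun y => g y * cauchy_kernel e (x - y))).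
Proof.
apply: (@integrable_EFin_le _ _ _ mu setT _ _ _ _ _ (k_int x)) => //.
  apply: measurable_funM; first exact: continuous_measurable_fun.
  by have /integrableP[/measurable_EFinP] := k_int x.
move=> y _; have /andP[h0 h1] := g01 y.
have k0 := cauchy_kernel_ge0 (x - y) (ltW e0).
by rewrite normrM !ger0_norm// ler_piMl.
Qed.

Lemma cauchy_smooth01 x : 0 <= cauchy_smooth e g x <= 1.
Proof.
have k0 y := cauchy_kernel_ge0 (x - y) (ltW e0).
rewrite Rintegral_ge0/=; last by move=> y _; rewrite mulr_ge0//; case/andP: (g01 y).
have e1 : \int[mu]_y cauchy_kernel e (x - y) = 1 by rewrite /Rintegral integral_cauchy_kernel.
rewrite -e1; apply: le_Rintegral => //; first exact: integrable_cauchy_smooth.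
by move=> y _; rewrite ler_piMl//; case/andP: (g01 y).
Qed.

Definition smooth_integrand (p : U * R) : \bar R := (g p.2 * cauchy_kernel e (Y p.1 - p.2))%:E.

Let msi : measurable_fun setT smooth_integrand.
Proof.
apply/measurable_EFinP; apply: measurable_funM.
  by apply: measurableT_comp => //; exact: continuous_measurable_fun.
apply: measurableT_comp; first by apply: continuous_measurable_fun; exact: continuous_cauchy_kernel.
by apply: measurable_funB => //; apply: measurableT_comp.
Qed.

Let si0 p : (0 <= smooth_integrand p)%E.
Proof.
by rewrite lee_fin mulr_ge0 ?cauchy_kernel_ge0 ?(ltW e0)//; case/andP: (g01 p.2).
Qed.

Let si_in w : (\int[mu]_y smooth_integrand (w, y) = (cauchy_smooth e g (Y w))%:E)%E.
Proof.
rewrite /cauchy_smooth /Rintegral fineK//.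
by apply: (integrable_fin_num _ (integrable_cauchy_smooth (Y w))).
Qed.

Let K_bound y w : `|cauchy_kernel e (Y w - y)| <= (pi * e)^-1.
Proof. by rewrite ger0_norm ?cauchy_kernel_le// cauchy_kernel_ge0// ltW. Qed.

Let si_out y : (\int[Q]_w smooth_integrand (w, y) = (g y * \int[Q]_w cauchy_kernel e (Y w - y))%:E)%E.
Proof.
have ki := bounded_integrable Q (mK y e0) (K_bound y).
rewrite EFinM fineK; last exact: (integrable_fin_num _ ki).
by rewrite -integralZl.
Qed.

Lemma measurable_cauchy_smooth : measurable_fun setT (fun w => cauchy_smooth e g (Y w)).
Proof.
apply/measurable_EFinP.
have := measurable_fun_fubini_tonelli_F (m2 := mu) smooth_integrand msi si0.
by congr (measurable_fun _ _); apply/funext => w /=; rewrite /fubini_F si_in.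
Qed.

Lemma measurable_smooth_density :
  measurable_fun setT (fun y => g y * \int[Q]_w cauchy_kernel e (Y w - y)).
Proof.
apply/measurable_EFinP.
have := measurable_fun_fubini_tonelli_G (m1 := Q) smooth_integrand msi si0.
by congr (measurable_fun _ _); apply/funext => w /=; rewrite /fubini_G si_out.
Qed.

(** By Tonelli, smoothing the test function is smoothing the law, which then has a density; limits
    of the means reduce to pointwise limits of these densities. *)
Lemma expectation_cauchy_smooth : \int[Q]_w cauchy_smooth e g (Y w) =
  \int[mu]_y (g y * \int[Q]_w cauchy_kernel e (Y w - y)) /\
  mu.-integrable setT (EFin \o (fun y => g y * \int[Q]_w cauchy_kernel e (Y w - y))).
Proof.
have := fubini_tonelli (m1 := Q) (m2 := mu) smooth_integrand msi si0.
under eq_integral do rewrite si_in.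
under [X in _ = X]eq_integral do rewrite si_out.
move=> h; split; first by rewrite /Rintegral h.
apply/integrableP; split; first by apply/measurable_EFinP; exact: measurable_smooth_density.
rewrite (_ : (\int[mu]_y _)%E = (\int[Q]_w (cauchy_smooth e g (Y w))%:E)%E).
  have si : Q.-integrable setT (EFin \o (fun w => cauchy_smooth e g (Y w))).
    apply: (bounded_integrable Q measurable_cauchy_smooth (M := 1)) => w.
    by have /andP[h0 h1] := cauchy_smooth01 (Y w); rewrite ger0_norm.
  rewrite ltey_eq; by rewrite (integrable_fin_num _ si).
rewrite h; apply: eq_integral => y _ /=; rewrite ger0_norm// mulr_ge0//.
  by case/andP: (g01 y).
by apply: Rintegral_ge0 => w _; rewrite cauchy_kernel_ge0// ltW.
Qed.

(** Within distance eta / j the Lipschitz bound gives eta. Farther away the kernel of scale e is at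
    most 2 e j / eta times the kernel of scale eta / j, whose total mass is 1; this replaces a tail
    integral. *)
Lemma cauchy_smooth_near (j eta : R) x : 0 < j -> 0 < eta ->
  (forall x y, `|g x - g y| <= j * `|x - y|) ->
  `|cauchy_smooth e g x - g x| <= eta + 2 * e * j / eta.
Proof.
move=> j0 eta0 lg; pose de := eta / j; have de0 : 0 < de by rewrite divr_gt0.
have k0 y := cauchy_kernel_ge0 (x - y) (ltW e0).
have kd0 y := cauchy_kernel_ge0 (x - y) (ltW de0).
have e1 : \int[mu]_y cauchy_kernel e (x - y) = 1 by rewrite /Rintegral integral_cauchy_kernel.
have e2 : \int[mu]_y cauchy_kernel de (x - y) = 1 by rewrite /Rintegral integral_cauchy_kernel.
have kdi := integrable_cauchy_kernel x de0.
have gi := integrable_cauchy_smooth x.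
have gki : mu.-integrable setT (EFin \o (fun y => g x * cauchy_kernel e (x - y))) by apply: integrable_EFinZl.
have -> : cauchy_smooth e g x - g x = \int[mu]_y (g y * cauchy_kernel e (x - y) - g x * cauchy_kernel e (x - y)).
  by rewrite RintegralB// RintegralZl// e1 mulr1.
have di : mu.-integrable setT (EFin \o (fun y => g y * cauchy_kernel e (x - y) - g x * cauchy_kernel e (x - y))) by apply: integrable_EFinB.
apply: (le_trans (le_normr_Rintegral _ di)) => //.
have -> : eta + 2 * e * j / eta = \int[mu]_y (eta * cauchy_kernel e (x - y) + 2 * e / de * cauchy_kernel de (x - y)).
  rewrite RintegralD//; [|exact: integrable_EFinZl|exact: integrable_EFinZl].
  rewrite RintegralZl// [X in _ = _ + X]RintegralZl// e1 e2 !mulr1 /de; congr (_ + _); field.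
  by rewrite (gt_eqF eta0) (gt_eqF j0).
apply: le_Rintegral => //.
- exact: integrable_norm.
- by apply: integrable_EFinD => //; exact: integrable_EFinZl.
move=> y _; rewrite -mulrBl normrM (ger0_norm (k0 y)).
have /andP[y0 y1] := g01 y; have /andP[x0 x1] := g01 x.
have g1 : `|g y - g x| <= 1 by rewrite ler_norml; apply/andP; split; lra.
have [h|h] := leP (`|x - y|) de.
  apply: (@le_trans _ _ (eta * cauchy_kernel e (x - y))).
    rewrite ler_wpM2r// (le_trans (lg _ _))// distrC.
    have := ler_wpM2l (ltW j0) h; rewrite /de mulrCA mulfV ?mulr1// gt_eqF//.
  have c0 : 0 <= 2 * e / de by rewrite !mulr_ge0 ?invr_ge0 ?(ltW e0) ?(ltW de0).
  by rewrite lerDl mulr_ge0.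
apply: (@le_trans _ _ (2 * e / de * cauchy_kernel de (x - y))); last first.
  by rewrite lerDr mulr_ge0// ltW.
apply: (@le_trans _ _ (cauchy_kernel e (x - y))); first by rewrite ler_piMl.
rewrite /cauchy_kernel; set u := x - y in h *.
have u2 : de ^+ 2 <= u ^+ 2 by rewrite -(real_normK (num_real u)) lerXn2r ?nnegrE ?(ltW de0)// ltW.
have q0 : 0 < e ^+ 2 + u ^+ 2 by rewrite ltr_pwDl ?exprn_gt0 ?sqr_ge0.
have q1 : 0 < de ^+ 2 + u ^+ 2 by rewrite ltr_pwDl ?exprn_gt0 ?sqr_ge0.
have -> : 2 * e / de * (de / (pi * (de ^+ 2 + u ^+ 2))) = e * (2 / (pi * (de ^+ 2 + u ^+ 2))).
  have p0 := @pi_gt0 R; move: (pi) p0 => p p0; field.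
  by rewrite (gt_eqF q1) (gt_eqF de0) (gt_eqF p0).
rewrite ler_wpM2l ?(ltW e0)// -[leLHS]mul1r ler_pdivrMr ?mulr_gt0 ?pi_gt0// mulrAC ler_pdivlMr ?mulr_gt0 ?pi_gt0//.
by rewrite mul1r mulrCA ler_pM2l ?pi_gt0//; have := sqr_ge0 e; lra.
Qed.

End OneLaw.

Lemma dist_of_bounds (A B eps : R) : A - eps <= B -> 1 - A - eps <= 1 - B -> `|A - B| <= eps.
Proof. by move=> h1 h2; rewrite ler_norml; apply/andP; split; lra. Qed.

(** * Integrals against the Cauchy law *)

Section CauchyIntegral.

(* [cauchy_prob] lives on the canonical measurable structure of [R] but
   [lebesgue_measure] on [measurableTypeR R]: the same measure on the latter
   makes Radon-Nikodym applicable. *)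
Let nu : set (measurableTypeR R) -> \bar R := @cauchy_prob R.

Let nu0 : nu set0 = 0%E. Proof. exact: measure0. Qed.

Let nu_ge0 A : (0 <= nu A)%E. Proof. exact: measure_ge0. Qed.

Let nu_sigma_additive : semi_sigma_additive nu.
Proof. exact: (@measure_semi_sigma_additive _ _ _ (@cauchy_prob R)). Qed.

HB.instance Definition _ := isMeasure.Build _ _ _ nu nu0 nu_ge0 nu_sigma_additive.

Let nu_setT : nu setT = 1%E. Proof. exact: (@probability_setT _ _ R (@cauchy_prob R)). Qed.

HB.instance Definition _ := @Measure_isProbability.Build _ _ R nu nu_setT.

Let nu_dominates : nu `<< mu.
Proof.
apply/null_content_dominatesP => A mA A0.
by apply: null_set_integral => //; apply: measurable_funTS; apply/measurable_EFinP; exact: measurable_cauchy_pdf.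
Qed.

(** The Radon-Nikodym derivative and [cauchy_pdf] have the same integral over every measurable set,
    so they agree almost everywhere. *)
Lemma integral_cauchy_prob (f : R -> R) : measurable_fun setT f -> (exists M, forall x, `|f x| <= M) ->
  (\int[@cauchy_prob R]_x (f x)%:E = \int[mu]_x ((f x)%:E * (cauchy_pdf x)%:E))%E.
Proof.
move=> mf [M fM].
have mE : measurable_fun setT (EFin \o f) by exact/measurable_EFinP.
pose id' : measurableTypeR R -> R := idfun.
have mid : measurable_fun setT id' by exact: (@measurable_id _ (measurableTypeR R)).
have nf : nu.-integrable setT (EFin \o f).
  apply: (@integrable_EFin_le _ _ _ nu setT _ _ (fun=> M)) => //; exact: finite_measure_integrable_cst.
have := integral_pushforward mid mE nf measurableT.
rewrite (@eq_measure_integral _ _ R setT (@cauchy_prob R)) => [->|A mA _ //].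
rewrite /= -(Radon_Nikodym_change_of_variables nu_dominates _ nf)//.
apply: ae_eq_integral => //.
- apply: emeasurable_funM; first exact: mE.
  apply: (measurable_int mu).
  by apply: Radon_Nikodym_integrable; exact: nu_dominates.
- by apply: emeasurable_funM; [exact: mE|apply/measurable_EFinP; exact: measurable_cauchy_pdf].
- apply: ae_eqe_mul2l => /=.
  rewrite Radon_NikodymE//=.
  case: cid => /= h [h1 h2 h3].
  apply: integral_ae_eq => //=.
  + by apply/measurable_EFinP; exact: measurable_cauchy_pdf.
  + by move=> E _ mE'; rewrite -h3.
Qed.

End CauchyIntegral.

(** * From characteristic functions to convergence in law *)

Section Levy.
Context (d : nat -> measure_display) (T : forall n, measurableType (d n))
  (P : forall n, probability (T n) R) (X : forall n, T n -> R).
Arguments X : clear implicits.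
Hypothesis mX : forall n, measurable_fun setT (X n).
Hypothesis Xcos : forall t, 0 < t -> \int[P n]_w cos (t * X n w) @[n --> \oo] --> expR (- t).
Hypothesis Xsin : forall t, 0 < t -> \int[P n]_w sin (t * X n w) @[n --> \oo] --> (0 : R).

Let mcomp (h : R -> R) n : continuous h -> measurable_fun setT (fun w => h (X n w)).
Proof. by move=> ch; apply: measurableT_comp => //; exact: continuous_measurable_fun. Qed.

Let mcosX t n : measurable_fun setT (fun w => cos (t * X n w)).
Proof.
apply: (mcomp (h := fun x => cos (t * x))) => x.
by apply: continuous_comp; [apply: cvgM; [exact: cvg_cst|exact: cvg_id]|exact: continuous_cos].
Qed.

Let msinX t n : measurable_fun setT (fun w => sin (t * X n w)).
Proof.
apply: (mcomp (h := fun x => sin (t * x))) => x.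
by apply: continuous_comp; [apply: cvgM; [exact: cvg_cst|exact: cvg_id]|exact: continuous_sin].
Qed.

Let cvg_cos_shift t y : 0 < t ->
  \int[P n]_w cos (t * (X n w - y)) @[n --> \oo] --> expR (- t) * cos (y * t).
Proof.
move=> t0.
have h : cos (y * t) * \int[P n]_w cos (t * X n w) + sin (y * t) * \int[P n]_w sin (t * X n w) @[n --> \oo]
   --> cos (y * t) * expR (- t) + sin (y * t) * 0.
  by apply: cvgD; apply: cvgMr; [exact: Xcos|exact: Xsin].
rewrite mulr0 addr0 [cos _ * expR _]mulrC in h; apply: cvg_trans h; apply: near_eq_cvg; apply: nearW => n.
have ci := bounded_integrable (P n) (@mcosX t n) (fun w => cos_max _).
have si := bounded_integrable (P n) (@msinX t n) (fun w => sin_max _).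
rewrite -RintegralZl// -[X in _ + X]RintegralZl// -RintegralD//; [|exact: integrable_EFinZl|exact: integrable_EFinZl].
apply: eq_Rintegral => w _; rewrite mulrBr cosB [t * y]mulrC; ring.
Qed.

(** Dominated convergence in t. The exponentials of rates e and 1 multiply, which is the semigroup
    property of the Cauchy kernels: the smoothed laws tend to the Cauchy law of scale 1 + e. *)
Lemma cvg_cauchy_kernel e y : 0 < e ->
  \int[P n]_w cauchy_kernel e (X n w - y) @[n --> \oo] --> cauchy_kernel (1 + e) y.
Proof.
move=> e0; have e1 : 0 < 1 + e by lra.
have p0 := @pi_gt0 R.
under eq_fun do rewrite expectation_cauchy_kernel//.
have -> : cauchy_kernel (1 + e) y = (pi * e)^-1 * \int[mu]_t (exponential_pdf e t * (expR (- t) * cos (y * t))).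
  have -> : \int[mu]_t (exponential_pdf e t * (expR (- t) * cos (y * t))) =
      \int[mu]_t (e / (1 + e) * (exponential_pdf (1 + e) t * cos (y * t))).
    apply: eq_Rintegral => t _; have [t0|t0] := leP 0 t; last by rewrite !lt0_exponential_pdf// !mul0r mulr0.
    rewrite !exponential_pdfE//.
    have -> : expR (- (1 + e) * t) = expR (- e * t) * expR (- t) by rewrite -expRD; congr expR; ring.
    by field; rewrite gt_eqF.
  rewrite RintegralZl//; last exact: integrable_pdf_cos.
  rewrite integral_exponential_pdf_cos//.
  move: (pi) p0 (cauchy_kernel _ _) => p p0 K; field.
  by rewrite (gt_eqF e0) (gt_eqF p0) gt_eqF.
apply: cvgMr.
pose F (n : nat) (t : R) := exponential_pdf e t * \int[P n]_w cos (t * (X n w - y)).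
pose G (t : R) := exponential_pdf e t * (expR (- t) * cos (y * t)).
have FG (t : R) : F n t @[n --> \oo] --> G t.
  have [t0|t0|t0] := ltgtP t 0.
  - by rewrite /F /G; under eq_fun do rewrite lt0_exponential_pdf// mul0r; rewrite lt0_exponential_pdf// mul0r; exact: cvg_cst.
  - by apply: cvgMr; exact: cvg_cos_shift.
  - apply: cvgMr; rewrite t0 mulr0 oppr0 expR0 cos0 mulr1.
    apply: cvg_near_cst; apply: nearW => n; under eq_Rintegral do rewrite mul0r cos0.
    exact: Rintegral_cst_probability.
have Fb n t : `|F n t| <= exponential_pdf e t.
  rewrite normrM ger0_norm ?exponential_pdf_ge0 ?(ltW e0)// ler_piMr ?exponential_pdf_ge0 ?(ltW e0)//.
  apply: Rintegral_bounded => [|w]; last exact: cos_max.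
  apply: (mcomp (h := fun x => cos (t * (x - y)))) => x.
  apply: (@continuous_comp _ _ _ (fun x => t * (x - y))); last exact: continuous_cos.
  by apply: cvgM; [exact: cvg_cst|apply: cvgB; [exact: cvg_id|exact: cvg_cst]].
have mF n : measurable_fun setT (F n) by exact: measurable_fourier.
have [|||||_ _] := @dominated_convergence _ _ R mu setT measurableT
   (fun n => EFin \o F n) (EFin \o G) (EFin \o exponential_pdf e).
- by move=> n; apply/measurable_EFinP; exact: mF.
- apply/measurable_EFinP; apply: (measurable_fun_cvg (h := F)) => // x _; exact: FG.
- by apply: aeW => t _; apply: cvg_EFin; [exact: nearW|exact: FG].
- exact: integrable_exponential_pdf.
- by apply: aeW => t n _; rewrite lee_fin.
move=> h; apply: fine_cvg; rewrite fineK//.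
have iG : mu.-integrable setT (EFin \o G).
  apply: (@integrable_EFin_le _ _ _ mu setT _ G _ _ _ (integrable_exponential_pdf e0)) => //.
    by apply: (measurable_fun_cvg (h := F)) => // x _; exact: FG.
  move=> x _; have [x0|x0] := leP 0 x; last by rewrite /G lt0_exponential_pdf// mul0r normr0.
  rewrite normrM ger0_norm ?exponential_pdf_ge0 ?(ltW e0)// ler_piMr ?exponential_pdf_ge0 ?(ltW e0)//.
  rewrite normrM (ger0_norm (expR_ge0 _)) -[leRHS]mulr1; apply: ler_pM => //; last exact: cos_max.
  by rewrite expR_le1 oppr_le0.
exact: (integrable_fin_num _ iG).
Qed.

Let lim_mean (e : R) (g : R -> R) := \int[mu]_y (g y * cauchy_kernel (1 + e) y).

Let kernel_integrable e : 0 < e -> mu.-integrable setT (EFin \o cauchy_kernel e).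
Proof.
move=> e0; have := integrable_cauchy_kernel 0 e0.
by congr integrable; apply/funext => y /=; rewrite /cauchy_kernel sub0r sqrrN.
Qed.

Let kernel_one e : 0 < e -> \int[mu]_y cauchy_kernel e y = 1.
Proof.
move=> e0; rewrite -[RHS](_ : fine (\int[mu]_y (cauchy_kernel e (0 - y))%:E)%E = _).
  by congr fine; apply: eq_integral => y _; rewrite /cauchy_kernel sub0r sqrrN.
by rewrite integral_cauchy_kernel.
Qed.

Let gk_integrable e (g : R -> R) : 0 < e -> continuous g -> (forall y, 0 <= g y <= 1) ->
  mu.-integrable setT (EFin \o (fun y => g y * cauchy_kernel e y)).
Proof.
move=> e0 cg g01; apply: (@integrable_EFin_le _ _ _ mu setT _ _ _ _ _ (kernel_integrable e0)) => //.
  by apply: measurable_funM; apply: continuous_measurable_fun => //; exact: continuous_cauchy_kernel.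
move=> y _; have /andP[h0 h1] := g01 y; have k0 := cauchy_kernel_ge0 y (ltW e0).
by rewrite normrM !ger0_norm// ler_piMl.
Qed.

(* As in Scheffe's lemma, the minimum of the densities converges in mean. *)
Let smooth_lower e (g : R -> R) (eps : R) : 0 < e -> continuous g -> (forall y, 0 <= g y <= 1) -> 0 < eps ->
  \forall n \near \oo, lim_mean e g - eps <= \int[P n]_w cauchy_smooth e g (X n w).
Proof.
move=> e0 cg g01 eps0; have e1 : 0 < 1 + e by lra.
pose h n y := \int[P n]_w cauchy_kernel e (X n w - y).
pose G y := g y * cauchy_kernel (1 + e) y.
pose F n y := Num.min (g y * h n y) (G y).
have G0 y : 0 <= G y by rewrite mulr_ge0 ?cauchy_kernel_ge0 ?(ltW e1)//; case/andP: (g01 y).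
have h0 n y : 0 <= h n y by apply: Rintegral_ge0 => w _; rewrite cauchy_kernel_ge0// ltW.
have iG : mu.-integrable setT (EFin \o G) by exact: gk_integrable.
have mG : measurable_fun setT G by case/integrableP: iG => /measurable_EFinP.
have mh n : measurable_fun setT (fun y => g y * h n y) by exact: measurable_smooth_density.
have mF n : measurable_fun setT (F n) by exact: measurable_minr.
have F0 n y : 0 <= F n y by rewrite le_min G0 mulr_ge0//; case/andP: (g01 y).
have FG n y : F n y <= G y by rewrite ge_min lexx orbT.
have iF n : mu.-integrable setT (EFin \o F n).
  by apply: (@integrable_EFin_le _ _ _ mu setT _ (F n) _ _ _ iG) => //; [exact: mF|move=> y _; rewrite ger0_norm].
have c : \int[mu]_y F n y @[n --> \oo] --> \int[mu]_y G y.
  have [|||||_ _] := @dominated_convergence _ _ R mu setT measurableT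
     (fun n => EFin \o F n) (EFin \o G) (EFin \o G).
  - by move=> n; apply/measurable_EFinP; exact: mF.
  - exact/measurable_EFinP.
  - apply: aeW => y _; apply: cvg_EFin; first exact: nearW.
    have ck : g y * h n y @[n --> \oo] --> G y by apply: cvgMr; exact: cvg_cauchy_kernel.
    apply/cvgrPdist_le => r r0; move/cvgrPdist_le : ck => /(_ _ r0).
    apply: filterS => n; apply: le_trans; rewrite /= /F.
    have [h1|h1] := leP (g y * h n y) (G y); first by [].
    by rewrite subrr normr0.
  - exact: iG.
  - by apply: aeW => y n _; rewrite /= lee_fin ger0_norm.
  move=> hh; apply: fine_cvg; rewrite fineK//.
  exact: (integrable_fin_num _ iG).
have lt : lim_mean e g - eps < \int[mu]_y G y by rewrite /lim_mean; lra.
have q := cvgr_gt _ c _ lt; near=> n.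
have [-> ih] := expectation_cauchy_smooth (P n) (@mX n) e0 cg g01.
apply: (@le_trans _ _ (\int[mu]_y F n y)); first by apply/ltW; near: n; exact: q.
by apply: le_Rintegral => // y _; rewrite ge_min lexx.
Unshelve. all: by end_near. Qed.

Let lim_mean_compl e (g : R -> R) : 0 < e -> continuous g -> (forall y, 0 <= g y <= 1) ->
  lim_mean e (fun y => 1 - g y) = 1 - lim_mean e g.
Proof.
move=> e0 cg g01; have e1 : 0 < 1 + e by lra.
have gi := gk_integrable e1 cg g01; have ki := kernel_integrable e1.
rewrite -[in RHS](kernel_one e1) /lim_mean -RintegralB//.
by apply: eq_Rintegral => y _; rewrite mulrBl mul1r.
Qed.

Let smooth_compl e (g : R -> R) x : 0 < e -> continuous g -> (forall y, 0 <= g y <= 1) ->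
  cauchy_smooth e (fun y => 1 - g y) x = 1 - cauchy_smooth e g x.
Proof.
move=> e0 cg g01; have gi := integrable_cauchy_smooth e0 cg g01 x.
have ki := integrable_cauchy_kernel x e0.
have k1 : \int[mu]_y cauchy_kernel e (x - y) = 1 by rewrite /Rintegral integral_cauchy_kernel.
rewrite -[in RHS]k1 /cauchy_smooth -RintegralB//.
by apply: eq_Rintegral => y _; rewrite mulrBl mul1r.
Qed.

Let smooth_int e (g : R -> R) n : 0 < e -> continuous g -> (forall y, 0 <= g y <= 1) ->
  (P n).-integrable setT (EFin \o (fun w => cauchy_smooth e g (X n w))).
Proof.
move=> e0 cg g01; apply: (bounded_integrable (P n) (M := 1)).
  exact: measurable_cauchy_smooth.
by move=> w; have /andP[h0 h1] := cauchy_smooth01 e0 cg g01 (X n w); rewrite ger0_norm.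
Qed.

(** The lower bound [smooth_lower] for 1 - [g] is the upper bound for [g]. *)
Lemma cvg_cauchy_smooth e (g : R -> R) : 0 < e -> continuous g -> (forall y, 0 <= g y <= 1) ->
  \int[P n]_w cauchy_smooth e g (X n w) @[n --> \oo] --> \int[mu]_y (g y * cauchy_kernel (1 + e) y).
Proof.
move=> e0 cg g01; apply/cvgrPdist_le => eps eps0; rewrite -/(lim_mean e g).
pose g' y := 1 - g y.
have cg' : continuous g' by move=> y; apply: cvgB; [exact: cvg_cst|exact: cg].
have g01' y : 0 <= g' y <= 1 by have /andP[h0 h1] := g01 y; apply/andP; rewrite /g'; split; lra.
have l1 := smooth_lower e0 cg g01 eps0; have l2 := smooth_lower e0 cg' g01' eps0.
have e2 n : \int[P n]_w cauchy_smooth e g' (X n w) = 1 - \int[P n]_w cauchy_smooth e g (X n w).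
  rewrite -[in RHS](Rintegral_cst_probability (P n) 1) -RintegralB//; last 2 first.
  - exact: finite_measure_integrable_cst.
  - exact: smooth_int.
  by apply: eq_Rintegral => w _; exact: smooth_compl.
have e3 : lim_mean e g' = 1 - lim_mean e g by exact: lim_mean_compl.
apply: filterS2 l1 l2 => n h1; rewrite e2 e3; exact: dist_of_bounds.
Qed.

Lemma cauchy_kernel1 y : cauchy_kernel 1 y = cauchy_pdf y.
Proof. by rewrite /cauchy_kernel /cauchy_pdf expr1n mul1r invfM. Qed.

Let mean (g : R -> R) := \int[mu]_y (g y * cauchy_kernel 1 y).

(** Pointwise, the kernels of scales 1 + e and 1 differ by at most e times the latter. *)
Let lim_mean_near e (g : R -> R) : 0 < e -> continuous g -> (forall y, 0 <= g y <= 1) ->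
  `|lim_mean e g - mean g| <= e.
Proof.
move=> e0 cg g01; have e1 : 0 < 1 + e by lra.
have gi := gk_integrable e1 cg g01; have g1 := gk_integrable ltr01 cg g01.
have k1 := kernel_integrable ltr01.
rewrite /lim_mean /mean -RintegralB//.
have di : mu.-integrable setT (EFin \o (fun y => g y * cauchy_kernel (1 + e) y - g y * cauchy_kernel 1 y)) by exact: integrable_EFinB.
apply: (le_trans (le_normr_Rintegral _ di)) => //.
apply: (@le_trans _ _ (\int[mu]_y (e * cauchy_kernel 1 y))); last by rewrite RintegralZl// kernel_one// mulr1.
apply: le_Rintegral => //; try exact: integrable_norm; try exact: integrable_EFinZl.
move=> y _; rewrite -mulrBr normrM; have /andP[y0 y1] := g01 y; rewrite (ger0_norm y0).
apply: (@le_trans _ _ `|cauchy_kernel (1 + e) y - cauchy_kernel 1 y|); first by rewrite ler_piMl.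
have p0 := @pi_gt0 R.
rewrite /cauchy_kernel.
have Y0 : 0 <= y ^+ 2 := sqr_ge0 y.
set Y := y ^+ 2 in Y0 *.
have q0 : 0 < (1 + e) ^+ 2 + Y by rewrite ltr_pwDl ?exprn_gt0.
have q1 : 0 < 1 ^+ 2 + Y by rewrite expr1n ltr_pwDl.
have -> : (1 + e) / (pi * ((1 + e) ^+ 2 + Y)) - 1 / (pi * (1 ^+ 2 + Y)) = (e * (Y - (1 + e))) / (pi * ((1 + e) ^+ 2 + Y) * (1 ^+ 2 + Y)).
  move: (pi) p0 q0 q1 => p p0 q0 q1; field.
  by rewrite (gt_eqF p0) (gt_eqF q0) /= gt_eqF// -[X in X + _](expr1n _ 2).
rewrite normrM (ger0_norm (x := (_ * _ * _)^-1)); last by rewrite invr_ge0 !mulr_ge0// ltW.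
rewrite ler_pdivrMr ?mulr_gt0//.
have -> : e * (1 / (pi * (1 ^+ 2 + Y))) * (pi * ((1 + e) ^+ 2 + Y) * (1 ^+ 2 + Y)) = e * ((1 + e) ^+ 2 + Y).
  move: (pi) p0 q0 q1 => p p0 q0 q1; field.
  by rewrite (gt_eqF p0) /= gt_eqF// -[X in X + _](expr1n _ 2).
rewrite normrM (ger0_norm (ltW e0)) ler_pM2l//.
by rewrite ler_norml; apply/andP; split; nra.
Qed.

Let g_int (g : R -> R) n : continuous g -> (forall y, 0 <= g y <= 1) ->
  (P n).-integrable setT (EFin \o (fun w => g (X n w))).
Proof.
move=> cg g01; apply: (bounded_integrable (P n) (M := 1)); first exact: mcomp.
by move=> w; have /andP[h0 h1] := g01 (X n w); rewrite ger0_norm.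
Qed.

Lemma cvg_lipschitz (g : R -> R) (j : R) : 0 < j -> (forall y, 0 <= g y <= 1) ->
  (forall x y, `|g x - g y| <= j * `|x - y|) ->
  \int[P n]_w g (X n w) @[n --> \oo] --> \int[mu]_y (g y * cauchy_kernel 1 y).
Proof.
move=> j0 g01 lg.
have cg : continuous g.
  move=> x; apply/cvgrPdist_lt => eps eps0; near=> y.
  apply: (le_lt_trans (lg _ _)); rewrite -ltr_pdivlMl//; near: y.
  by apply: cvgr_dist_lt; [exact: cvg_id|rewrite mulr_gt0// invr_gt0].
apply/cvgrPdist_le => eps eps0; rewrite -/(mean g).
pose eta := eps / 4; have eta0 : 0 < eta by rewrite divr_gt0.
(* The first bound controls the change of scale in the limit; the second makes 2 e j / eta at most
   eps / 4, so the smoothing costs at most eps / 2. The last quarter is left for the convergence at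
   fixed e. *)
pose e := Num.min (eps / 4) (eta * eps / (8 * j)).
have e0 : 0 < e by rewrite lt_min !divr_gt0// ?mulr_gt0.
have e4 : e <= eps / 4 by rewrite ge_min lexx.
have e8 : 2 * e * j / eta <= eps / 4.
  have : e <= eta * eps / (8 * j) by rewrite ge_min lexx orbT.
  rewrite ler_pdivlMr ?mulr_gt0// ler_pdivrMr// => h; lra.
have c := cvg_cauchy_smooth e0 cg g01.
have eps4 : 0 < eps / 4 by rewrite divr_gt0.
have q : \forall n \near \oo, `|lim_mean e g - \int[P n]_w cauchy_smooth e g (X n w)| <= eps / 4.
  by move/cvgrPdist_le : c; apply.
near=> n.
have h1 : `|lim_mean e g - \int[P n]_w cauchy_smooth e g (X n w)| <= eps / 4 by near: n; exact: q.
have h2 := lim_mean_near e0 cg g01.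
have h3 : `|\int[P n]_w cauchy_smooth e g (X n w) - \int[P n]_w g (X n w)| <= eta + 2 * e * j / eta.
  have gi := g_int n cg g01; have si := smooth_int n e0 cg g01.
  rewrite -RintegralB//; apply: Rintegral_bounded.
    by apply: measurable_funB; [exact: measurable_cauchy_smooth|exact: mcomp].
  by move=> w; exact: cauchy_smooth_near.
move: h1 h2 h3; set A := lim_mean e g; set B := mean g; set C := \int[P n]_w _; set D := \int[P n]_w _ => h1 h2 h3.
have : `|B - D| <= `|A - B| + `|A - C| + `|C - D|.
  rewrite (_ : B - D = (B - A) + (A - C) + (C - D)); last by ring.
  by rewrite (le_trans (ler_normD _ _))// lerD// (le_trans (ler_normD _ _))// lerD// distrC.
by have etaE : eta = eps / 4 by []; lra.
Unshelve. all: by end_near. Qed.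

(* Lipschitz minorants, increasing to [h] with the slope [j]. *)
Let minorant (h : R -> R) (j : nat) (x : R) : R := inf [set h y + j.+1%:R * `|x - y| | y in setT].

Section Minorant.
Variable h : R -> R.
Hypotheses (ch : continuous h) (h01 : forall y, 0 <= h y <= 1).

Let lb j x : has_lbound [set h y + j.+1%:R * `|x - y| | y in setT].
Proof. by exists 0 => _ [y _ <-]; rewrite addr_ge0 ?mulr_ge0//; case/andP: (h01 y). Qed.

Let minorant_le j x y : minorant h j x <= h y + j.+1%:R * `|x - y|.
Proof. by apply: ge_inf; [exact: lb|exists y]. Qed.

Let minorant_ge j x c : (forall y, c <= h y + j.+1%:R * `|x - y|) -> c <= minorant h j x.
Proof. by move=> hc; apply: lb_le_inf; [exists (h 0 + j.+1%:R * `|x - 0|), 0|move=> _ [y _ <-]]. Qed.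

Let minorant_leh j x : minorant h j x <= h x.
Proof. by have := minorant_le j x x; rewrite subrr normr0 mulr0 addr0. Qed.

Let minorant01 j x : 0 <= minorant h j x <= 1.
Proof.
apply/andP; split; last by apply: (le_trans (minorant_leh _ _)); case/andP: (h01 x).
by apply: minorant_ge => y; rewrite addr_ge0 ?mulr_ge0//; case/andP: (h01 y).
Qed.

Let minorant_lip j x y : `|minorant h j x - minorant h j y| <= j.+1%:R * `|x - y|.
Proof.
have hh u v : minorant h j u - j.+1%:R * `|u - v| <= minorant h j v.
  apply: minorant_ge => z; rewrite lerBlDr (le_trans (minorant_le j u z))// -addrA lerD2l -mulrDr ler_wpM2l//.
  by rewrite [leRHS]addrC (ler_distD v).
have := hh x y; have := hh y x; rewrite (distrC y x) => h1 h2.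
by rewrite ler_norml; apply/andP; split; lra.
Qed.

Let cvg_minorant x : minorant h j x @[j --> \oo] --> h x.
Proof.
apply/cvgrPdist_le => eps eps0.
have cx : h y @[y --> x] --> h x by exact: ch.
have [de /= de0 hde] : \forall y \near x, `|h x - h y| <= eps by move/cvgrPdist_le : cx; apply.
near=> j; rewrite ger0_norm ?subr_ge0// lerBlDr -lerBlDl; apply: minorant_ge => y.
have [xy|xy] := ltP `|x - y| de.
  have := hde y xy; rewrite ler_norml => /andP[_ hxy].
  have : 0 <= j.+1%:R * `|x - y| by rewrite mulr_ge0.
  lra.
have j1 : 1 <= j.+1%:R * `|x - y|.
  apply: (@le_trans _ _ (j.+1%:R * de)); last by rewrite ler_wpM2l.
  rewrite -ler_pdivrMr// div1r; apply: (@le_trans _ _ j%:R); last by rewrite ler_nat.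
  near: j; exact: nbhs_infty_ger.
have /andP[x0 x1] := h01 x; have /andP[y0 y1] := h01 y; lra.
Unshelve. all: by end_near. Qed.

(** One Lipschitz minorant whose Cauchy mean is within eps / 2 is fixed before n grows. Only a lower
    bound comes out; the upper one is obtained by applying it to 1 - [h]. *)
Lemma liminf_continuous eps : 0 < eps ->
  \forall n \near \oo, \int[mu]_y (h y * cauchy_kernel 1 y) - eps <= \int[P n]_w h (X n w).
Proof.
move=> eps0; rewrite -/(mean h).
have cm j : continuous (minorant h j).
  move=> x; apply/cvgrPdist_lt => e e0; near=> y.
  apply: (le_lt_trans (minorant_lip _ _ _)); rewrite -ltr_pdivlMl//; near: y.
  by apply: cvgr_dist_lt; [exact: cvg_id|rewrite mulr_gt0// invr_gt0].
have c : mean (minorant h j) @[j --> \oo] --> mean h.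
  have ih := gk_integrable ltr01 ch h01.
  have [|||||_ _] := @dominated_convergence _ _ R mu setT measurableT
     (fun j => EFin \o (fun y => minorant h j y * cauchy_kernel 1 y)) (EFin \o (fun y => h y * cauchy_kernel 1 y)) (EFin \o cauchy_kernel 1).
  - by move=> j; have /integrableP[] := gk_integrable ltr01 (cm j) (minorant01 j).
  - by case/integrableP: ih.
  - apply: aeW => y _; apply: cvg_EFin; first exact: nearW.
    by apply: cvgMl; exact: cvg_minorant.
  - exact: kernel_integrable.
  - apply: aeW => y j _; rewrite /= lee_fin; have /andP[m0 m1] := minorant01 j y.
    have k0 := cauchy_kernel_ge0 y (@ler01 R).
    by rewrite normrM !ger0_norm// ler_piMl.
  move=> hh; apply: fine_cvg; rewrite fineK//.
  exact: (integrable_fin_num _ ih).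
have eps2 : mean h - eps / 2 < mean h by lra.
have q := cvgr_gt _ c _ eps2.
have [j hj] : exists j, mean h - eps / 2 < mean (minorant h j) by near \oo => j; exists j; near: j; exact: q.
have c2 := @cvg_lipschitz (minorant h j) j.+1%:R (ltr0Sn _ _) (minorant01 j) (minorant_lip j).
have eps3 : mean h - eps < mean (minorant h j) by lra.
have q2 := cvgr_gt _ c2 _ eps3.
near=> n; apply: (@le_trans _ _ (\int[P n]_w minorant h j (X n w))).
  by apply/ltW; near: n; exact: q2.
apply: (le_Rintegral _ (@g_int (minorant h j) n (cm j) (minorant01 j)) (@g_int h n ch h01)) => // w _.
Unshelve. all: by end_near. Qed.

End Minorant.

Lemma cvg_in_distribution_cauchy : cvg_in_distribution P X (@cauchy_prob R).
Proof.
move=> f cf [M fM].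
pose B := `|M| + 1; have B0 : 0 < B by rewrite ltr_wpDl.
have fB x : `|f x| <= B by rewrite (le_trans (fM x))// (le_trans (ler_norm M))// lerDl.
(* An affine change to values in [0, 1], a class stable under [h] -> 1 - [h]. *)
pose h y := (f y + B) / (2 * B).
have ch : continuous h.
  by move=> y; apply: cvgM; [apply: cvgD; [exact: cf|exact: cvg_cst]|exact: cvg_cst].
have h01 y : 0 <= h y <= 1.
  have := fB y; rewrite ler_norml => /andP[f1 f2].
  rewrite divr_ge0 ?mulr_ge0 ?(ltW B0)//=; last by lra.
  by rewrite ler_pdivrMr ?mulr_gt0//; lra.
pose h' y := 1 - h y.
have ch' : continuous h' by move=> y; apply: cvgB; [exact: cvg_cst|exact: ch].
have h01' y : 0 <= h' y <= 1 by have /andP[h0 h1] := h01 y; apply/andP; rewrite /h'; split; lra.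
have fh y : f y = 2 * B * h y - B by rewrite /h; field; rewrite gt_eqF.
have ih := gk_integrable ltr01 ch h01; have ik := kernel_integrable ltr01.
have c : \int[P n]_w h (X n w) @[n --> \oo] --> mean h.
  apply/cvgrPdist_le => eps eps0.
  have l1 := liminf_continuous ch h01 eps0; have l2 := liminf_continuous ch' h01' eps0.
  apply: filterS2 l1 l2 => n h1.
  have -> : \int[P n]_w h' (X n w) = 1 - \int[P n]_w h (X n w).
    rewrite -[in RHS](Rintegral_cst_probability (P n) 1) -RintegralB//.
      exact: finite_measure_integrable_cst.
    exact: g_int.
  have -> : \int[mu]_y (h' y * cauchy_kernel 1 y) = 1 - mean h.
    rewrite -[in RHS](kernel_one ltr01) /mean -RintegralB//.
    by apply: eq_Rintegral => y _; rewrite /h' mulrBl !mul1r.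
  exact: dist_of_bounds.
have Ef n : ('E_(P n)[f \o X n])%E = (2 * B * \int[P n]_w h (X n w) - B)%:E.
  have hi := @g_int h n ch h01.
  have fi : (P n).-integrable setT (EFin \o (fun w => f (X n w))).
    by apply: (bounded_integrable (P n) (M := B)) => [|w]; [exact: mcomp|exact: fB].
  rewrite unlock -[LHS]fineK; last exact: (integrable_fin_num _ fi).
  congr EFin; rewrite -[X in _ - X](Rintegral_cst_probability (P n) B) -RintegralZl// -RintegralB//.
  - by apply: eq_Rintegral => w _; exact: fh.
  - exact: integrable_EFinZl.
  - exact: finite_measure_integrable_cst.
have Ec : (\int[@cauchy_prob R]_x (f x)%:E = (2 * B * mean h - B)%:E)%E.
  have hi : (@cauchy_prob R).-integrable setT (EFin \o h).
    apply: (bounded_integrable (@cauchy_prob R) (M := 1)); first exact: continuous_measurable_fun.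
    by move=> w; have /andP[h0 h1] := h01 w; rewrite ger0_norm.
  rewrite integral_cauchy_prob; [|exact: continuous_measurable_fun|by exists B].
  rewrite -[LHS]fineK.
    have kB : B = \int[mu]_y (B * cauchy_kernel 1 y) by rewrite RintegralZl// kernel_one// mulr1.
    congr EFin; rewrite [X in _ - X]kB /mean -RintegralZl// -RintegralB//.
    - by congr fine; apply: eq_integral => y _ /=; rewrite -EFinM -cauchy_kernel1 fh; congr EFin; ring.
    - exact: integrable_EFinZl.
    - exact: integrable_EFinZl.
  have iz : mu.-integrable setT (EFin \o (fun y => 2 * B * (h y * cauchy_kernel 1 y) - B * cauchy_kernel 1 y)).
    by apply: integrable_EFinB => //; exact: integrable_EFinZl.
  rewrite (_ : (\int[mu]_x _)%E = (\int[mu]_x (2 * B * (h x * cauchy_kernel 1 x) - B * cauchy_kernel 1 x)%:E)%E).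
    exact: (integrable_fin_num _ iz).
  by apply: eq_integral => y _ /=; rewrite -EFinM -cauchy_kernel1 fh; congr EFin; ring.
rewrite Ec.
have c2 : 2 * B * \int[P n]_w h (X n w) - B @[n --> \oo] --> 2 * B * mean h - B.
  by apply: cvgB; [exact: cvgMr|exact: cvg_cst].
under eq_fun do rewrite Ef.
by apply: cvg_EFin; first exact: nearW.
Qed.

End Levy.
End Continuity.

(** * A bounded harmonic function of the winding walk *)

Section HalfPlane.
Context {R : realType}.
Let D : set R := `]0, pi[%classic.

(* On [0, pi] this is tan (pi / 4 - t / 2); it satisfies (1 + T ^ 2) cos = 2 T. *)
Definition tan_ratio (t : R) : R := cos t / (1 + `|sin t|).

Let den_gt0 (t : R) : 0 < 1 + `|sin t|.
Proof. by rewrite ltr_wpDr. Qed.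

Lemma tan_ratio_le1 t : `|tan_ratio t| <= 1.
Proof.
rewrite /tan_ratio normrM normfV (ger0_norm (ltW (den_gt0 t))) ler_pdivrMr// mul1r.
by rewrite (le_trans (cos_max t))// lerDl.
Qed.

Lemma tan_ratio_lt1 t : D t -> `|tan_ratio t| < 1.
Proof.
move=> Dt; rewrite /tan_ratio normrM normfV (ger0_norm (ltW (den_gt0 t))) ltr_pdivrMr// mul1r.
by rewrite (le_lt_trans (cos_max t))// ltrDl normr_gt0 gt_eqF// sin_itv_gt0.
Qed.

Lemma tan_ratio_eq t : D t -> (1 + tan_ratio t ^+ 2) * cos t = 2 * tan_ratio t.
Proof.
move=> Dt; have s0 := sin_itv_gt0 Dt; have h := cos2Dsin2 t.
rewrite /tan_ratio (gtr0_norm s0); move: s0 h; set s := sin t; set c := cos t => s0 h.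
have s1 : 1 + s != 0 by rewrite gt_eqF// addr_gt0.
have e : c ^+ 2 = (1 - s) * (1 + s) by rewrite -[LHS](addrK (s ^+ 2)) h; ring.
by rewrite expr_div_n e; field.
Qed.

Lemma tan_ratio_cos t : D t -> tan_ratio t * cos t = 1 - sin t.
Proof.
move=> Dt; have s0 := sin_itv_gt0 Dt; have h := cos2Dsin2 t.
rewrite /tan_ratio (gtr0_norm s0) mulrAC; apply: (canLR (mulfK _)); first by rewrite gt_eqF// addr_gt0.
by rewrite -expr2 -[LHS](addrK (sin t ^+ 2)) h; ring.
Qed.

(** The absolute value in [tan_ratio] keeps the denominator at least 1 on the whole line, as
    [test_fun] requires. *)
Lemma test_fun_tan_ratio : test_fun tan_ratio.
Proof.
split; last by exists 1; exact: tan_ratio_le1.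
move=> t; apply: cvgM; first exact: continuous_cos.
apply: cvgV; first by rewrite gt_eqF.
by apply: cvgD; [exact: cvg_cst|apply: cvg_norm; exact: continuous_sin].
Qed.

Section Potential.
Variable beta : R.
Hypothesis b01 : 0 < beta <= 1.

Let a := 1 - beta.
Let a01 : 0 <= a < 1.
Proof. by move: b01 => /andP[b0 b1]; rewrite /a; apply/andP; split; lra. Qed.

(* For [th = pi * beta * (m + 1 / 2)], [potential th] and [potential (th - pi / 2)]
   are the real and imaginary parts of the expectation of [cis (beta * angle)],
   [angle] the final rounded angle, given the position (u, v) after [m] half turns. *)
Definition potential (th : R) (u : int) (v : nat) : R :=
  sin (pi * beta / 2) / pi * cot_int a (fun t => tan_ratio t ^+ v * cos (th - u%:~R * t)).

Lemma test_fun_cosB th (u : R) : test_fun (fun t => cos (th - u * t)).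
Proof.
by have := @test_fun_cos R (- u) th; under eq_fun do rewrite mulNr addrC.
Qed.

Lemma test_fun_potential th (u : R) v : test_fun (fun t => tan_ratio t ^+ v * cos (th - u * t)).
Proof. by apply: test_funM; [apply: test_funX; exact: test_fun_tan_ratio|exact: test_fun_cosB]. Qed.

Let sin_gt0 : 0 < sin (pi * beta / 2).
Proof.
have p0 := @pi_gt0 R; move: b01 => /andP[b0 b1]; apply: sin_gt0_pi.
by rewrite divr_gt0 ?mulr_gt0//= ltr_pdivrMr// ltr_pM2l//; lra.
Qed.

Let cot_int1 : sin (pi * beta / 2) / pi * cot_int a (fun=> 1) = 1.
Proof.
have -> : sin (pi * beta / 2) = cos (pi * a / 2).
  by rewrite -cosBpihalf -cosN; congr cos; rewrite /a; field.
by rewrite mulrAC (mulrC (cos _)) cot_int_one// divff// gt_eqF// pi_gt0.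
Qed.

Let coef_ge0 : 0 <= sin (pi * beta / 2) / pi.
Proof. by apply: divr_ge0; [exact: ltW|exact: pi_ge0]. Qed.

Lemma potential_origin th : potential th 0 0 = cos th.
Proof.
rewrite /potential (@eq_cot_int _ _ _ (fun t => cos th * 1)); last first.
  by move=> t _; rewrite expr0 mul1r mul0r subr0 mulr1.
by rewrite (cot_intZ a01); [rewrite mulrCA cot_int1 mulr1|exact: test_fun_cst].
Qed.

(** The bound is uniform in [th] and [u] and tends to 0 as [v] grows, so height alone makes the
    potential small. *)
Lemma potential_le th u v :
  `|potential th u v| <= sin (pi * beta / 2) / pi * cot_int a (fun t => `|tan_ratio t| ^+ v).
Proof.
rewrite /potential normrM (ger0_norm coef_ge0); apply: ler_wpM2l => //.
apply: cot_int_norm => //; first exact: test_fun_potential.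
  by apply/test_funX/test_fun_norm; exact: test_fun_tan_ratio.
by move=> t _; rewrite normrM normrX ler_piMr ?exprn_ge0// cos_max.
Qed.

Lemma potential_le1 th u v : `|potential th u v| <= 1.
Proof.
apply: le_trans (potential_le _ _ _) _; rewrite -[leRHS]cot_int1; apply: ler_wpM2l => //.
apply: cot_int_le => //; first by apply/test_funX/test_fun_norm; exact: test_fun_tan_ratio.
  exact: test_fun_cst.
by move=> t _; rewrite exprn_ile1 ?tan_ratio_le1.
Qed.

Let potentialD th u v th' u' v' : potential th u v + potential th' u' v' =
  sin (pi * beta / 2) / pi * cot_int a (fun t => tan_ratio t ^+ v * cos (th - u%:~R * t)
    + tan_ratio t ^+ v' * cos (th' - u'%:~R * t)).
Proof. by rewrite /potential -mulrDr -cot_intD//; exact: test_fun_potential. Qed.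

Let cosD_cosB (x y : R) : cos (x + y) + cos (x - y) = 2 * (cos x * cos y).
Proof. by rewrite cosD cosB; ring. Qed.

Lemma potential_horizontal th u v : potential th (u + 1) v + potential th (u - 1) v =
  sin (pi * beta / 2) / pi * cot_int a (fun t => 2 * (tan_ratio t ^+ v * cos t * cos (th - u%:~R * t))).
Proof.
rewrite potentialD; congr (_ * _); apply: eq_cot_int => t _.
rewrite -mulrDr intrD intrB.
have -> : th - (u%:~R + 1) * t = th - u%:~R * t - t by ring.
have -> : th - (u%:~R - 1) * t = th - u%:~R * t + t by ring.
by rewrite addrC cosD_cosB; ring.
Qed.

Let test_fun_horizontal th (u : R) v : test_fun (fun t => 2 * (tan_ratio t ^+ v * cos t * cos (th - u * t))).
Proof.
apply: test_funZ; apply: test_funM; last exact: test_fun_cosB.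
apply: test_funM; last exact: test_fun_cos1.
by apply: test_funX; exact: test_fun_tan_ratio.
Qed.

Lemma potential_interior th u v :
  (potential th (u + 1) v.+2 + potential th (u - 1) v.+2)
  + (potential th (u + 1) v + potential th (u - 1) v) = 4 * potential th u v.+1.
Proof.
rewrite !potential_horizontal -mulrDr /potential [RHS]mulrCA -(cot_intD a01 (test_fun_horizontal _ _ _) (test_fun_horizontal _ _ _)).
rewrite -[4 * _](cot_intZ a01); last exact: test_fun_potential.
congr (_ * _); apply: eq_cot_int => t /tan_ratio_eq h.
transitivity (2 * tan_ratio t ^+ v * cos (th - u%:~R * t) * ((1 + tan_ratio t ^+ 2) * cos t)).
  by rewrite !exprS; ring.
by rewrite h exprS; ring.
Qed.

Let phase (w : int) : 0 < w -> cot_int a (fun t => cos (w%:~R * t + pi * a / 2)) = 0.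
Proof. by case: w => [[|n]|n]// _; exact: cot_int_phase. Qed.

(* Continuity of the potential across the negative half of the axis [v = 0]. *)
Lemma potential_reflect th w : 0 < w -> potential (th + pi * beta) w 0 = potential th (- w) 0.
Proof.
move=> w0; apply/eqP; rewrite -subr_eq0 /potential -mulrBr -cot_intB//; [|exact: test_fun_potential..].
rewrite (@eq_cot_int _ _ _ (fun t => - (2 * sin (th + pi * beta / 2)) * cos (w%:~R * t + pi * a / 2))).
  by rewrite (cot_intZ a01); [rewrite phase ?mulr0|exact: test_fun_cos].
move=> t _; rewrite expr0 !mul1r.
have -> : cos (w%:~R * t + pi * a / 2) = sin (pi * beta / 2 - w%:~R * t).
  by rewrite -cosBpihalf -cosN; congr cos; rewrite /a; field.
have -> : th + pi * beta - w%:~R * t = th + pi * beta / 2 + (pi * beta / 2 - w%:~R * t) by field.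
have -> : th - (- w)%:~R * t = th + pi * beta / 2 - (pi * beta / 2 - w%:~R * t) by rewrite mulrNz; field.
by rewrite (cosD (_ + _) (_ - _)) (cosB (_ + _) (_ - _)); ring.
Qed.

(** Product-to-sum gives the vanishing phase integrals of indices w - 1 and w + 1, both positive
    since 1 < w. *)
Let sin_sin_phase (w : int) : 1 < w -> cot_int a (fun t => sin t * sin (w%:~R * t + pi * a / 2)) = 0.
Proof.
move=> w1; rewrite (@eq_cot_int _ _ _ (fun t => 2^-1 *
  (cos ((w - 1)%:~R * t + pi * a / 2) - cos ((w + 1)%:~R * t + pi * a / 2)))); last first.
  move=> t _; rewrite intrB intrD.
  have -> : (w%:~R - 1) * t + pi * a / 2 = w%:~R * t + pi * a / 2 - t by ring.
  have -> : (w%:~R + 1) * t + pi * a / 2 = w%:~R * t + pi * a / 2 + t by ring.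
  by rewrite (cosD _ t) (cosB _ t); field.
rewrite (cot_intZ a01); last by apply: test_funB; exact: test_fun_cos.
rewrite (cot_intB a01); [|exact: test_fun_cos..].
by rewrite !phase ?subr0 ?mulr0//; lia.
Qed.

(** The neighbours below the axis appear after a negative half turn, with the phase lowered by pi
    beta. As T cos t = 1 - sin t, the four terms add up to 4 c f (1 - sin t) with f = cos (u t - pi
    beta / 2). The part with sin t integrates to 0 by [sin_sin_phase], and c f differs from cos (th
    - u t) by a multiple of [g], which integrates to 0 too. *)
Lemma potential_boundary th u : 1 < u ->
  (potential th (u + 1) 1 + potential th (u - 1) 1)
  + (potential (th - pi * beta) (- (u + 1)) 1 + potential (th - pi * beta) (- (u - 1)) 1)
  = 4 * potential th u 0.
Proof.
move=> u1; set c := cos (th - pi * beta / 2); set s := sin (th - pi * beta / 2).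
pose f t := sin (u%:~R * t + pi * a / 2).
pose g t := cos (u%:~R * t + pi * a / 2).
have tf : test_fun f by exact: test_fun_sin.
have tg : test_fun g by exact: test_fun_cos.
have fE t : cos (u%:~R * t - pi * beta / 2) = f t.
  by rewrite /f -cosBpihalf; congr cos; rewrite /a; field.
have gE t : sin (u%:~R * t - pi * beta / 2) = - g t.
  rewrite /g -[LHS]opprK -sinN -cosBpihalf -cosN; congr (- cos _); rewrite /a; by field.
have e1 : - (u + 1) = - u - 1 by ring.
have e2 : - (u - 1) = - u + 1 by ring.
rewrite e1 e2 [X in _ + X]addrC !potential_horizontal -mulrDr /potential [RHS]mulrCA.
rewrite -(cot_intD a01 (test_fun_horizontal _ _ _) (test_fun_horizontal _ _ _)).
congr (_ * _).
rewrite (@eq_cot_int _ _ _ (fun t => 4 * c * (f t - sin t * f t))).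
  rewrite cot_intZ//; last by apply: test_funB => //; apply: test_funM => //; exact: test_fun_sin1.
  rewrite cot_intB//; last by apply: test_funM => //; exact: test_fun_sin1.
  rewrite sin_sin_phase// subr0.
  rewrite (@eq_cot_int _ _ (fun t => _ ^+ 0 * _) (fun t => c * f t - s * g t)).
    rewrite cot_intB//; try exact: test_funZ.
    by rewrite !cot_intZ// /g phase ?(lt_trans _ u1)// mulr0 subr0 mulrA.
  move=> t _; rewrite expr0 mul1r -[in RHS]fE -[s * _]opprK -[- (s * _)]mulrN -gE opprK.
  have -> : th - u%:~R * t = (th - pi * beta / 2) - (u%:~R * t - pi * beta / 2) by ring.
  by rewrite cosB.
move=> t /tan_ratio_cos h; rewrite expr1 h -mulrDr -mulrDr.
have -> : th - u%:~R * t = (th - pi * beta / 2) - (u%:~R * t - pi * beta / 2) by ring.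
have -> : th - pi * beta - (- u)%:~R * t = (th - pi * beta / 2) + (u%:~R * t - pi * beta / 2).
  by rewrite mulrNz; field.
by rewrite (addrC (cos _)) cosD_cosB fE -/c; ring.
Qed.

(** cos (pi beta / 2 - 2k t) is sin (2k t + pi a / 2), the integrand of [cot_int_sin_coef]. For beta
    < 1 the factor sin (pi a) = 2 sin (pi beta / 2) cos (pi beta / 2) is nonzero and absorbs the
    normalization. *)
Lemma potential_start_re k : (0 < k)%N -> beta < 1 ->
  potential (pi * beta / 2) k.*2%:Z 0 * (2 * cos (pi * beta / 2)) = half_moebius_coef a k.*2.
Proof.
case: k => // k _ b1; have p0 := @pi_gt0 R.
have s0 : sin (pi * a) != 0.
  move: b01 => /andP[b0 _]; rewrite gt_eqF// sin_gt0_pi//.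
  by rewrite mulr_gt0//= ?subr_gt0// -[ltRHS]mulr1 ltr_pM2l// /a; lra.
apply: (mulIf s0); rewrite /potential.
rewrite (@eq_cot_int _ _ _ (fun t => sin (k.*2.+2%:R * t + pi * a / 2))); last first.
  by move=> t _; rewrite expr0 mul1r -cosBpihalf -cosN doubleS pmulrn; congr cos; rewrite /a; field.
have h := cot_int_sin_coef k.*2.+1 a01.
have e : sin (pi * a) = 2 * (sin (pi * beta / 2) * cos (pi * beta / 2)).
  have -> : pi * a = pi - (pi * beta / 2 + pi * beta / 2) by rewrite /a; field.
  by rewrite sinB sinpi cospi sinD; ring.
rewrite e in h *; rewrite doubleS.
transitivity (2 * cos (pi * beta / 2) * sin (pi * beta / 2) / pi *
   (cot_int a (fun t => sin (k.*2.+2%:R * t + pi * a / 2)) * (2 * (sin (pi * beta / 2) * cos (pi * beta / 2))))).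
  by ring.
rewrite h; move: (half_moebius_coef _ _) (sin _) (cos _) => x y z.
by rewrite -!mulrA (mulrA pi^-1) mulVf ?gt_eqF// mul1r; ring.
Qed.

Lemma potential_start_re1 k : (0 < k)%N -> beta = 1 -> potential (pi * beta / 2) k.*2%:Z 0 = 0.
Proof.
case: k => // k _ b1; rewrite /potential /a b1 subrr.
rewrite (@eq_cot_int _ _ _ (fun t => sin (k.+1.*2%:R * t))) ?cot_int_sin_even0 ?mulr0// => t _.
by rewrite expr0 mul1r -cosBpihalf -cosN pmulrn; congr cos; field.
Qed.

(** The shift by pi / 2 produces exactly the vanishing phase of [cot_int_phase]; hence the
    characteristic function of the rounded angle is real. *)
Lemma potential_start_im k : (0 < k)%N -> potential (pi * beta / 2 - pi / 2) k.*2%:Z 0 = 0.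
Proof.
case: k => // k _; rewrite /potential.
rewrite (@eq_cot_int _ _ _ (fun t => cos (k.*2.+2%:R * t + pi * a / 2))) ?cot_int_phase ?mulr0// => t _.
by rewrite expr0 mul1r -cosN doubleS pmulrn; congr cos; rewrite /a; field.
Qed.

End Potential.
End HalfPlane.

(** * The walk on the half-plane sheets *)

Section Sheets.
Context {R : realType}.

(* The multiplication by 1 - i turns the steps into (+-1, +-1). *)
Definition rot45 (p : Z2) : Z2 := (p.1 + p.2, p.2 - p.1).

(* [(m, b, z)] stands for the point [(-1) ^+ b * z] in rotated coordinates,
   reached with a winding angle [pi * m + Arg z] where [0 <= Arg z < pi]. *)
Notation sheet := (int * bool * Z2)%type.

(** The points of argument in [0, pi), and the origin, so that a step onto the origin leaves the
    number of half turns unchanged. *)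
Definition upper (z : Z2) := (0 < z.2) || ((z.2 == 0) && (0 <= z.1)).

(** A diagonal step leaves [upper] in two ways only: by landing on the negative half-axis, which
    completes a half turn, or by going down from the positive half-axis, which undoes one. *)
Definition fold_half (m : int) (b : bool) (z : Z2) : sheet :=
  if upper z then (m, b, z)
  else if z.2 == 0 then (m + 1, ~~ b, - z) else (m - 1, ~~ b, - z).

Definition sheet_step (s : sheet) (e : Z2) : sheet :=
  let: (m, b, z) := s in
  if z == 0 then s else fold_half m b (z + (if b then - rot45 e else rot45 e)).

(** Rotated lattice points have an even sum of coordinates. A nonzero point of [upper] on the axis
    thus has abscissa at least 2, as [potential_boundary] demands. *)
Definition sheet_inv (s : sheet) :=
  upper s.2 /\ exists q : int, s.2.1 + s.2.2 = q * 2.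

Definition step_mean (X : Type) (step : X -> Z2 -> X) (g : X -> R) (x : X) : R :=
  4^-1 * \sum_(e <- unit_steps) g (step x e).

Lemma sheet_step_inv s e : e \in unit_steps -> sheet_inv s -> sheet_inv (sheet_step s e).
Proof.
case: s => [[m b] [u v]]; rewrite /sheet_inv /upper /= => eu [h [q hq]].
case: eqP => _; first by split=> //; exists q.
have [q' hq'] : exists q' : int, u + (if b then - rot45 e else rot45 e).1 + (v + (if b then - rot45 e else rot45 e).2) = q' * 2.
  exists (q + if b then - e.2 else e.2); case: b => /=; rewrite /rot45; lia.
rewrite /fold_half /upper /=; set u' := _ + _ in hq' *; set v' := _ + _ in hq' *.
case: ifPn => h1 /=; first by split=> //; exists q'.
move: hq' h1; rewrite /u' /v'; case: (if b then _ else _) => x y /= hq' h1.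
have -> : - ((u, v) + (x, y)) = (- (u + x), - (v + y)) :> Z2 by [].
by case: (eqVneq (v + y) 0) h1 => h2 h1 /=; (split; first by lia); exists (- q'); rewrite ?h2; lia.
Qed.

Lemma iter_step_mean (X : Type) (step : X -> Z2 -> X) (g : X -> R) (inv : X -> Prop) n x :
  (forall x e, e \in unit_steps -> inv x -> inv (step x e)) ->
  (forall x, inv x -> step_mean step g x = g x) -> inv x ->
  iter n (step_mean step) g x = g x.
Proof.
move=> hs hg; elim: n x => // n IH x ix; rewrite iterS -[RHS]hg// /step_mean.
by congr (_ * _); apply: eq_big_seq => e eu; rewrite IH//; exact: hs.
Qed.

Section Harmonic.
Variables (beta phi : R).
Hypothesis b01 : 0 < beta <= 1.

Definition sheet_potential (s : sheet) : R :=
  potential beta (pi * beta * (s.1.1%:~R + 1 / 2) + phi) s.2.1 `|s.2.2|%N.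

Let G := sheet_potential.
Let th (m : int) : R := pi * beta * (m%:~R + 1 / 2) + phi.

Let thS m : th (m + 1) = th m + pi * beta. Proof. by rewrite /th intrD; ring. Qed.
Let thP m : th (m - 1) = th m - pi * beta. Proof. by rewrite /th intrB; ring. Qed.

(** Here the fold acts only on the negative half-axis, and [potential_reflect] says that the
    potential does not see it. *)
Let fold_nonneg m b u v : 0 <= v -> G (fold_half m b (u, v)) = potential beta (th m) u `|v|%N.
Proof.
move=> v0; rewrite /fold_half /upper /G /sheet_potential /=; case: ifPn => // h.
have v00 : v = 0 by lia.
have u0 : 0 < - u by lia.
by rewrite v00 eqxx /= -/(th _) thS (potential_reflect b01 _ u0) opprK.
Qed.

Let fold_neg m b u v : v < 0 -> G (fold_half m b (u, v)) = potential beta (th m - pi * beta) (- u) `|v|%N.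
Proof.
move=> v0; rewrite /fold_half /upper /G /sheet_potential /= ifF; last by lia.
by rewrite ifF /= -/(th _) ?thP ?absz_oppz ?abszN//; lia.
Qed.

Lemma sum_unit_steps (b : bool) (f : Z2 -> R) (u v : int) :
  \sum_(e <- unit_steps) f ((u, v) + (if b then - rot45 e else rot45 e)) =
  (f (u + 1, v + 1) + f (u - 1, v + 1)) + (f (u + 1, v - 1) + f (u - 1, v - 1)).
Proof.
have h (x y : int) : (u, v) + (x, y) = (u + x, v + y) :> Z2 by [].
have h' (x y : int) : - (x, y) = (- x, - y) :> Z2 by [].
rewrite /unit_steps !big_cons big_nil /rot45 /= addr0.
case: b; rewrite ?h' !h !(addr0, add0r, subr0, sub0r, opprK); ring.
Qed.

Lemma sheet_potential_mean s : sheet_inv s -> step_mean sheet_step G s = G s.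
Proof.
case: s => [[m b] [u v]] [/= h [q hq]]; rewrite /step_mean /sheet_step.
case: eqP => [_|/eqP z0]; first by rewrite !big_cons big_nil; field.
rewrite (@sum_unit_steps b (fun z => G (fold_half m b z))).
have -> : G (m, b, (u, v)) = potential beta (th m) u `|v|%N by [].
have [v0|v0] := eqVneq v 0.
  have u1 : 1 < u by move: h z0; rewrite /upper v0 xpair_eqE andbT /= => h' /eqP; lia.
  have p1 : 0 <= v + 1 by lia.
  have n1 : v - 1 < 0 by lia.
  rewrite !(fold_nonneg _ _ _ p1) !(fold_neg _ _ _ n1) v0.
  have -> : `|(0 + 1 : int)|%N = 1 by [].
  have -> : `|(0 - 1 : int)|%N = 1 by [].
  by rewrite (potential_boundary b01 _ u1) mulKf.
case: v h z0 v0 hq => [[|n]|n]// _ _ _ _.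
have p1 : 0 <= n.+1%:Z + 1 by lia.
have p2 : 0 <= n.+1%:Z - 1 by lia.
rewrite !(fold_nonneg _ _ _ p1) !(fold_nonneg _ _ _ p2).
have -> : `|(n.+1%:Z + 1)%R|%N = n.+2 by lia.
have -> : `|(n.+1%:Z - 1)%R|%N = n by lia.
by rewrite (potential_interior b01) mulKf.
Qed.

End Harmonic.

(** The probability that a simple walk on Z started at 0 is at [x] after [n] steps; with a = 0,
    [cot_int] is the plain integral over (0, pi). *)
Definition fourier_kernel (n : nat) (x : int) : R :=
  pi^-1 * cot_int 0 (fun t => cos t ^+ n * cos (x%:~R * t + 0)).

Let a0 : 0 <= (0 : R) < 1. Proof. by rewrite lexx ltr01. Qed.

Let tf n (x : R) : test_fun (fun t => cos t ^+ n * cos (x * t + 0)).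
Proof. by apply: test_funM; [apply: test_funX; exact: test_fun_cos1|exact: test_fun_cos]. Qed.

Lemma fourier_kernel0 x : fourier_kernel 0 x = (x == 0)%:R.
Proof.
have p0 := @pi_gt0 R.
have one : cot_int 0 (fun=> 1) = pi :> R.
  by have := cot_int_one a0; rewrite mulr0 mul0r cos0 mulr1.
rewrite /fourier_kernel; have [->|x0] := eqVneq x 0.
  rewrite (@eq_cot_int _ _ _ (fun=> 1)) ?one ?mulVf ?gt_eqF//.
  by move=> t _; rewrite expr0 mul1r mul0r addr0 cos0.
suff -> : cot_int 0 (fun t : R => cos t ^+ 0 * cos (x%:~R * t + 0)) = 0 by rewrite mulr0.
case: x x0 => [[|n]|n]// _.
  rewrite -[RHS](@cot_int_phase R 0 n a0); apply: eq_cot_int => t _.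
  by rewrite expr0 mul1r mulr0 mul0r.
rewrite -[RHS](@cot_int_phase R 0 n a0); apply: eq_cot_int => t _.
by rewrite expr0 mul1r mulr0 mul0r !addr0 NegzE mulrNz mulNr cosN.
Qed.

Lemma fourier_kernelS n x : fourier_kernel n (x + 1) + fourier_kernel n (x - 1) = 2 * fourier_kernel n.+1 x.
Proof.
rewrite /fourier_kernel -mulrDr -(cot_intD a0); [|exact: tf..].
rewrite [RHS]mulrCA -[2 * cot_int _ _](cot_intZ a0); last exact: tf.
congr (_ * _); apply: eq_cot_int => t _; rewrite intrD intrB !addr0 mulrDl mulrBl !mul1r.
by rewrite (cosD _ t) (cosB _ t) exprS; ring.
Qed.

Lemma cvg_fourier_kernel x : fourier_kernel n x @[n --> \oo] --> (0 : R).
Proof.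
apply/norm_cvg0P.
have h : pi^-1 * cot_int 0 (fun t : R => `|cos t| ^+ n) @[n --> \oo] --> (0 : R).
  rewrite -[X in _ --> X](mulr0 (pi^-1 : R)); apply: cvgMr; apply: (cvg_cot_int_expn a0).
    exact: test_fun_cos1.
  move=> t Dt; have s0 := sin_itv_gt0 Dt; have := cos2Dsin2 t.
  have : `|cos t| <= 1 by rewrite cos_max.
  rewrite le_eqVlt => /orP[/eqP h|//]; rewrite -[cos t ^+ 2](@real_normK R) ?num_real// h expr1n => /eqP.
  by rewrite -subr_eq0 addrAC subrr add0r expf_eq0 /= gt_eqF.
apply: (squeeze_cvgr _ (cvg_cst 0) h); near=> n; rewrite normr_ge0 /=.
rewrite /fourier_kernel normrM ger0_norm ?invr_ge0 ?pi_ge0//.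
apply: ler_wpM2l; first by rewrite invr_ge0 pi_ge0.
apply: (cot_int_norm a0); [exact: tf| |].
  by apply/test_funX/test_fun_norm; exact: test_fun_cos1.
by move=> t _; rewrite normrM normrX ler_piMr ?exprn_ge0// cos_max.
Unshelve. all: by end_near. Qed.

(** The second rotated coordinate, not stopped at the origin. Two of the four steps raise it by 1
    and two lower it by 1, so it is a simple walk on Z. *)
Definition height_step (v : int) (e : Z2) : int := v + (rot45 e).2.

Lemma iter_height_mean n j v :
  iter n (step_mean height_step) (fun v => (v == j)%:R) v = fourier_kernel n (v - j).
Proof.
elim: n v => [|n IH] v; first by rewrite /= fourier_kernel0 subr_eq0.
rewrite iterS /step_mean /unit_steps !big_cons big_nil /height_step !IH /rot45 /=.
have := fourier_kernelS n (v - j).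
have -> : v - j + 1 = v + 1 - j by ring.
have -> : v - j - 1 = v - 1 - j by ring.
have -> : v + (0 - 1) = v - 1 by ring.
have -> : v + (0 - -1) = v + 1 by ring.
rewrite addr0; move: (fourier_kernel n (v + 1 - j)) (fourier_kernel n (v - 1 - j)) (fourier_kernel n.+1 _).
by move=> x y z h; rewrite (_ : y + _ = 2 * (2 * z)); [field|rewrite -h; ring].
Qed.

End Sheets.

(** * Law of the walk *)

Section Discrete.
Context d (U : measurableType d).

Definition discrete_rv (C : Type) (X : U -> C) := forall c, measurable (X @^-1` [set c]).

Lemma discrete_rv_preimage (C : countType) (X : U -> C) (A : set C) : discrete_rv X ->
  measurable (X @^-1` A).
Proof.
move=> mX; rewrite (_ : X @^-1` A = \bigcup_(c in A) X @^-1` [set c]).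
  by rewrite bigcup_mkcond; apply: countable_bigcupT_measurable => // c; case: ifP.
by apply/seteqP; split => w /=; [move=> Aw; exists (X w)|move=> [c Ac /= ->]].
Qed.

Lemma discrete_rv_measurable d' (V : measurableType d') (C : countType) (X : U -> C) (g : C -> V) :
  discrete_rv X -> measurable_fun setT (fun w => g (X w)).
Proof. by move=> mX _ B mB; rewrite setTI; exact: (discrete_rv_preimage (g @^-1` B) mX). Qed.

Lemma discrete_rv_map2 (C D : countType) (E : Type) (X : U -> C) (Y : U -> D) (g : C -> D -> E) :
  discrete_rv X -> discrete_rv Y -> discrete_rv (fun w => g (X w) (Y w)).
Proof.
move=> mX mY e.
have mXY : discrete_rv (fun w => (X w, Y w)).
  move=> [x y]; rewrite (_ : _ @^-1` _ = X @^-1` [set x] `&` Y @^-1` [set y]).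
    exact: measurableI.
  by apply/seteqP; split => w /=; [move=> [-> ->]|move=> [-> ->]].
exact: (discrete_rv_preimage [set p | g p.1 p.2 = e] mXY).
Qed.

Lemma discrete_rv_cst (C : Type) (c : C) : discrete_rv (fun=> c).
Proof. by move=> c'; rewrite preimage_cst; case: ifP => _. Qed.

Lemma discrete_rv_mkseq (C : countType) (X : nat -> U -> C) n : (forall j, discrete_rv (X j)) ->
  discrete_rv (fun w => mkseq (X^~ w) n).
Proof.
move=> mX; elim: n => [|n IH]; first exact: discrete_rv_cst.
rewrite (_ : (fun w => _) = (fun w => rcons (mkseq (X^~ w) n) (X n w))).
  exact: discrete_rv_map2.
by apply: funext => w; rewrite mkseqS.
Qed.

Lemma Rintegral_discrete_partition (R : realType) (Q : probability U R) (C : countType)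
    (X : U -> C) (B : set U) (f : U -> R) (s : seq C) :
  discrete_rv X -> measurable B -> Q.-integrable setT (EFin \o f) -> uniq s ->
  \int[Q]_(w in B `&` X @^-1` [set` s]) f w = \sum_(c <- s) \int[Q]_(w in B `&` X @^-1` [set c]) f w.
Proof.
move=> mX mB fi; elim: s => [|c s IH] /=.
  by move=> _; rewrite set_nil preimage_set0 setI0 Rintegral_set0 big_nil.
move=> /andP[cs us]; rewrite big_cons -IH//.
rewrite (_ : [set` c :: s] = [set c] `|` [set` s]); last first.
  by apply/seteqP; split => x /=; [rewrite inE => /predU1P|move=> h; rewrite inE; exact/predU1P].
rewrite preimage_setU setIUr.
have m1 : measurable (B `&` X @^-1` [set c]) by exact: measurableI.
have m2 : measurable (B `&` X @^-1` [set` s]) by apply: measurableI => //; exact: discrete_rv_preimage.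
rewrite Rintegral_setU//; first by apply: integrableS fi => //; exact: measurableU.
apply/disj_setPS => w /= [[_ wc] [_ ws]]; by rewrite wc in ws; rewrite ws in cs.
Qed.

End Discrete.

Section Law.
Context {R : realType} d (U : measurableType d) (P : probability U R) (z0 : Z2) (S : nat -> U -> Z2).
Hypothesis hS : simple_random_walk P z0 S.

Definition increments n w : seq Z2 := mkseq (fun j => increment S j w) n.

Lemma discrete_rv_walk n : discrete_rv (S n). Proof. by move=> z; exact: (srw_measurable hS). Qed.

Lemma discrete_rv_increment n : discrete_rv (increment S n).
Proof.
by apply: (@discrete_rv_map2 _ _ Z2 Z2 _ (S n.+1) (S n) (fun x y => x - y)); exact: discrete_rv_walk.
Qed.

Lemma discrete_rv_increments n : discrete_rv (increments n).
Proof. by apply: discrete_rv_mkseq => j; exact: discrete_rv_increment. Qed.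

Lemma probability_increment n (e : Z2) : e \in unit_steps ->
  fine (P (increment S n @^-1` [set e])) = 4^-1.
Proof. by move=> eu; rewrite (srw_uniform hS n eu) /= mul1r. Qed.

Lemma probability_cylinder (l : seq Z2) : {subset l <= unit_steps} ->
  fine (P (increments (size l) @^-1` [set l])) = 4^-1 ^+ size l.
Proof.
move=> lu; have := @srw_independent _ _ _ _ _ _ hS (iota 0 (size l)) (fun j => [set nth 0 l j]) (iota_uniq _ _).
rewrite (_ : \bigcap_(j in _) _ = increments (size l) @^-1` [set l]).
  move=> ->; rewrite (_ : (\prod_(j <- _) _)%E = (\prod_(j <- iota 0 (size l)) (4^-1 : R))%:E).
    by rewrite big_const_seq count_predT size_iota iter_mulr_1.
  rewrite -prodEFin; apply: eq_big_seq => j; rewrite mem_iota add0n => /andP[_ jl].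
  by rewrite (srw_uniform hS) ?lu ?mem_nth// mul1r.
apply/seteqP; split => w /=.
  move=> h; apply: (@eq_from_nth _ 0); first by rewrite size_mkseq.
  by move=> j; rewrite size_mkseq => jl; rewrite nth_mkseq//; apply: h; rewrite /= mem_iota.
by move=> h j /=; rewrite mem_iota add0n => /andP[_ jl]; rewrite -[in nth _ _]h nth_mkseq.
Qed.

(** The four prescribed probabilities already add up to 1. *)
Lemma increment_ae n : P (increment S n @^-1` [set` unit_steps]) = 1%E.
Proof.
have fi : P.-integrable setT (EFin \o (fun=> 1 : R)) by exact: finite_measure_integrable_cst.
have m : measurable (increment S n @^-1` [set` unit_steps]).
  exact: discrete_rv_preimage (discrete_rv_increment n).
have := Rintegral_discrete_partition (s := unit_steps) (@discrete_rv_increment n) measurableT fi isT.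
rewrite setTI Rintegral_cst// mul1r => h; rewrite -[LHS]fineK ?fin_num_measure//; congr EFin.
rewrite h (eq_big_seq (fun=> 4^-1)); first by rewrite !big_cons big_nil; field.
by move=> e eu; rewrite setTI Rintegral_cst ?mul1r ?probability_increment//; exact: discrete_rv_increment.
Qed.

Lemma Rintegral_increment n (B : set U) (f : U -> R) : measurable B -> P.-integrable setT (EFin \o f) ->
  \int[P]_(w in B) f w = \sum_(e <- unit_steps) \int[P]_(w in B `&` increment S n @^-1` [set e]) f w.
Proof.
move=> mB fi; rewrite -(Rintegral_discrete_partition (discrete_rv_increment n))//.
have m : measurable (increment S n @^-1` [set` unit_steps]).
  exact: discrete_rv_preimage (discrete_rv_increment n).
rewrite /Rintegral (@negligible_integral _ _ _ P B (~` (increment S n @^-1` [set` unit_steps])))//.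
- by rewrite setDE setCK.
- exact: measurableC.
- by apply: integrableS fi.
- by apply: etrans (probability_setC P m) _; rewrite increment_ae subee.
Qed.

Section Chain.
Variables (X : Type) (step : X -> Z2 -> X) (x0 : X) (g : X -> R) (M : R).
Hypothesis gM : forall x, `|g x| <= M.

Lemma measurable_chain n : measurable_fun setT (fun w => g (foldl step x0 (increments n w))).
Proof. by apply: (discrete_rv_measurable (fun l => g (foldl step x0 l))); exact: discrete_rv_increments. Qed.

Lemma integrable_chain n : P.-integrable setT (EFin \o (fun w => g (foldl step x0 (increments n w)))).
Proof. by apply: (bounded_integrable P (M := M)); [exact: measurable_chain|move=> w; exact: gM]. Qed.

(** The Markov property: splitting the cylinder by the next increment trades one step of remaining
    time for one [step_mean]. *)
Lemma Rintegral_cylinder n (l : seq Z2) : {subset l <= unit_steps} ->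
  \int[P]_(w in increments (size l) @^-1` [set l]) g (foldl step x0 (increments (size l + n) w)) =
  4^-1 ^+ size l * iter n (step_mean step) g (foldl step x0 l).
Proof.
elim: n l => [|n IH] l lu.
  rewrite addn0 (@eq_Rintegral _ _ _ _ _ (fun=> g (foldl step x0 l))); last first.
    by move=> w /set_mem /= ->.
  by rewrite Rintegral_cst ?probability_cylinder// 1?mulrC//; exact: discrete_rv_increments.
rewrite (Rintegral_increment (size l)); [|exact: discrete_rv_increments|exact: integrable_chain].
rewrite iterS /step_mean mulrA -exprSr mulr_sumr; apply: eq_big_seq => e eu.
have := IH (rcons l e); rewrite size_rcons foldl_rcons => <-; last first.
  by move=> x; rewrite mem_rcons inE => /predU1P[->//|/lu].
rewrite addSnnS; congr (fine (integral _ _ _)); apply/seteqP; split => w /=.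
  by move=> [hl he]; rewrite /increments mkseqS -/(increments _ w) hl he.
by rewrite /increments mkseqS => /rcons_inj [-> ->].
Qed.

Lemma expectation_chain n :
  \int[P]_w g (foldl step x0 (increments n w)) = iter n (step_mean step) g x0.
Proof.
have := @Rintegral_cylinder n [::]; rewrite /= expr0 mul1r => <-//.
by congr (fine (integral _ _ _)); apply/seteqP; split.
Qed.

End Chain.

Lemma discrete_rv_hitting_time : discrete_rv (hitting_time S).
Proof.
move=> n; have m0 j : measurable (S j @^-1` [set 0]) by exact: discrete_rv_walk.
(* The default value 0 of [hitting_time] adds the paths that never reach the origin to the event n =
   0. *)
rewrite (_ : _ @^-1` _ = (S n @^-1` [set 0] `&` \bigcap_(j in `I_n) ~` (S j @^-1` [set 0]))
   `|` (if n == 0%N then \bigcap_j ~` (S j @^-1` [set 0]) else set0)).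
  apply: measurableU; first apply: measurableI => //.
    by apply: bigcap_measurableType => j _; exact: measurableC.
  by case: eqP => // _; apply: bigcap_measurableType => j _; exact: measurableC.
apply/seteqP; split => w /=.
  rewrite /hitting_time; case: pselect => [h|h] /=.
    case: ex_minnP => m /eqP m0' mm <-; left; split=> // j /= jm sj.
    by have := mm j; rewrite sj eqxx leqNgt jm => /(_ isT).
  by move=> <-; right => j _ /= sj; apply: h; exists j; rewrite sj.
rewrite /hitting_time; case: pselect => [h|h] /=.
  case: ex_minnP => m /eqP m0' mm [[sn hn]|].
    apply/eqP; rewrite eqn_leq mm ?sn ?eqxx//= leqNgt; apply/negP => nm.
    by apply: (hn m).
  by case: eqP => // _ /(_ m I).
move=> [[sn _]|]; first by case: h; exists n; rewrite sn.
by case: eqP.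
Qed.

(** The path up to the hitting time takes values in a countable type, so every function of it, the
    winding angle included, is measurable. *)
Lemma discrete_rv_excursion : discrete_rv (fun w => mkseq (S^~ w) (hitting_time S w)).
Proof.
move=> l; rewrite (_ : _ @^-1` _ = hitting_time S @^-1` [set size l] `&`
   (fun w => mkseq (S^~ w) (size l)) @^-1` [set l]).
  apply: measurableI; first exact: discrete_rv_hitting_time.
  by apply: discrete_rv_mkseq => j; exact: discrete_rv_walk.
apply/seteqP; split => w /=; last by move=> [-> ->].
move=> h; have e : hitting_time S w = size l by rewrite -h size_mkseq.
by rewrite -e.
Qed.

Lemma measurable_winding_angle (h : R -> R) :
  measurable_fun setT (fun w => h (winding_angle S w)).
Proof.
pose f (l : seq Z2) : R := \sum_(0 <= n < (size l).-1) signed_angle (nth 0 l n) (nth 0 l n.+1).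
rewrite (_ : (fun w => _) = (fun w => (h \o f) (mkseq (S^~ w) (hitting_time S w)))).
  exact: (discrete_rv_measurable (h \o f) discrete_rv_excursion).
apply: funext => w /=; congr h; rewrite /f size_mkseq /winding_angle.
apply: eq_big_nat => n /andP[_ hn]; have hn' : (n.+1 < hitting_time S w)%N by lia.
by rewrite !nth_mkseq//; lia.
Qed.

End Law.

(** * Winding angles *)

Section Geometry.
Context {R : realType}.

(** [rot45] is a rotation times sqrt 2, so it preserves signed angles and divides out of the cosine.
    The bound on y - x lets [acos] recover its absolute value, and the sign of sin (y - x) its
    sign. *)
Lemma signed_angle_polar (p q : Z2) (r s x y : R) : 0 < r -> 0 < s ->
  (rot45 p).1%:~R = r * cos x -> (rot45 p).2%:~R = r * sin x ->
  (rot45 q).1%:~R = s * cos y -> (rot45 q).2%:~R = s * sin y ->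
  - pi < y - x < pi -> signed_angle p q = y - x.
Proof.
case: p q => [a b] [c e] r0 s0; rewrite /rot45 /= => p1 p2 q1 q2 /andP[d1 d2].
have nr : znorm (a, b) = r / Num.sqrt 2 :> R.
  rewrite /znorm /=; apply: (canRL (mulfK _)); first by rewrite gt_eqF ?sqrtr_gt0.
  rewrite -sqrtrM; last by rewrite ler0z; nia.
  rewrite -[RHS](ger0_norm (ltW r0)) -sqrtr_sqr; congr Num.sqrt.
  transitivity ((r * cos x) ^+ 2 + (r * sin x) ^+ 2); last first.
    by rewrite !exprMn -mulrDr cos2Dsin2 mulr1.
  by rewrite -p1 -p2 !(intrD, intrB, rmorphXn)/=; ring.
have ns : znorm (c, e) = s / Num.sqrt 2 :> R.
  rewrite /znorm /=; apply: (canRL (mulfK _)); first by rewrite gt_eqF ?sqrtr_gt0.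
  rewrite -sqrtrM; last by rewrite ler0z; nia.
  rewrite -[RHS](ger0_norm (ltW s0)) -sqrtr_sqr; congr Num.sqrt.
  transitivity ((s * cos y) ^+ 2 + (s * sin y) ^+ 2); last first.
    by rewrite !exprMn -mulrDr cos2Dsin2 mulr1.
  by rewrite -q1 -q2 !(intrD, intrB, rmorphXn)/=; ring.
have crossE : (a * e - b * c)%:~R = r * s / 2 * sin (y - x) :> R.
  have -> : r * s / 2 * sin (y - x) = ((r * cos x) * (s * sin y) - (r * sin x) * (s * cos y)) / 2.
    by rewrite sinB; field.
  by rewrite -p1 -p2 -q1 -q2 !(intrD, intrB, intrM); field.
have dotE : (a * c + b * e)%:~R = r * s / 2 * cos (y - x) :> R.
  have -> : r * s / 2 * cos (y - x) = ((r * cos x) * (s * cos y) + (r * sin x) * (s * sin y)) / 2.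
    by rewrite cosB; field.
  by rewrite -p1 -p2 -q1 -q2 !(intrD, intrB, intrM); field.
have rs : 0 < r * s / 2 by rewrite divr_gt0 ?mulr_gt0.
rewrite /signed_angle nr ns /= dotE.
have -> : r / Num.sqrt 2 * (s / Num.sqrt 2) = r * s / 2.
  rewrite mulrACA -invfM -expr2 sqr_sqrtr//.
rewrite mulrAC divff ?gt_eqF// mul1r.
have -> : (Num.sg (a * e - b * c))%:~R = Num.sg (sin (y - x)) :> R.
  by rewrite intr_sg crossE sgrM gtr0_sg// mul1r.
move: (y - x) d1 d2 => t t1 t2; have [t0|t0|->] := ltgtP t 0; last by rewrite sin0 sgr0 mul0r.
  rewrite ltr0_sg; last by rewrite -oppr_gt0 -sinN sin_gt0_pi// oppr_gt0 t0 ltrNl.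
  by rewrite -cosN cosK ?in_itv/= ?oppr_ge0 ?(ltW t0)//= ?mulrN1 ?mulN1r ?opprK// lerNl ltW.
rewrite gtr0_sg; last by rewrite sin_gt0_pi// t0 t2.
by rewrite mul1r cosK// in_itv/= !ltW.
Qed.

(** The argument of a nonzero point with nonnegative ordinate; below the axis, the argument of the
    mirror image. *)
Definition arg (z : Z2) : R := acos (z.1%:~R / znorm z).

Lemma upperN (z : Z2) : ~~ upper z -> upper (- z).
Proof.
by case: z => [u v]; rewrite /upper (_ : - (u, v) = (- u, - v))//=; lia.
Qed.

Lemma znorm_gt0 (z : Z2) : z != 0 -> 0 < znorm z :> R.
Proof.
case: z => [u v] z0; rewrite /znorm sqrtr_gt0 ltr0z /=.
by move: z0; rewrite xpair_eqE => h; nia.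
Qed.

Let intr_sqr (u : int) : (u%:~R : R) ^+ 2 = (u ^+ 2)%:~R.
Proof. by rewrite rmorphXn. Qed.

Let ratio_le1 (z : Z2) : z != 0 -> -1 <= z.1%:~R / (znorm z : R) <= 1.
Proof.
move=> z0; have n0 := znorm_gt0 z0.
rewrite -ler_norml normrM normfV (gtr0_norm n0) ler_pdivrMr// mul1r.
rewrite -sqrtr_sqr /znorm intr_sqr ler_sqrt ?ler_int; first by rewrite lerDl sqr_ge0.
by rewrite ler0z addr_ge0 ?sqr_ge0.
Qed.

Lemma arg_polar (z : Z2) : z != 0 -> upper z ->
  z.1%:~R = znorm z * cos (arg z) /\ z.2%:~R = znorm z * sin (arg z).
Proof.
move=> z0 up; have n0 := znorm_gt0 z0; have r1 := ratio_le1 z0; split.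
  by rewrite /arg acosK// mulrCA divff ?mulr1// gt_eqF.
rewrite /arg sin_acos// -{1}[znorm z](ger0_norm (ltW n0)) -sqrtr_sqr -sqrtrM ?sqr_ge0//.
rewrite mulrBr mulr1 expr_div_n mulrCA divff ?mulr1 ?sqrf_eq0 ?gt_eqF//.
rewrite [znorm z ^+ 2]sqr_sqrtr; last by rewrite ler0z; nia.
rewrite intrD !rmorphXn/= addrAC subrr add0r sqrtr_sqr ger0_norm// ler0z.
by move: up; rewrite /upper; case/orP => [/ltW//|/andP[/eqP->]].
Qed.

Lemma arg_ge0 z : z != 0 -> 0 <= arg z.
Proof. by move=> z0; rewrite acos_ge0// ratio_le1. Qed.

Lemma arg_ltpi z : z != 0 -> upper z -> arg z < pi.
Proof.
move=> z0 up; rewrite acos_ltpi//; have /andP[h1 ->] := ratio_le1 z0; rewrite andbT.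
have n0 := znorm_gt0 z0; rewrite lt_neqAle h1 andbT; apply/eqP => h.
have u0 : z.1%:~R = - znorm z :> R by rewrite -[LHS](divfK (lt0r_neq0 n0)) -h mulN1r.
have : znorm z ^+ 2 = (z.1%:~R) ^+ 2 :> R by rewrite u0 sqrrN.
rewrite sqr_sqrtr ?ler0z; last by nia.
rewrite intr_sqr => /eqP; rewrite eqr_int => /eqP e.
have : z.1%:~R < 0 :> R by rewrite u0 oppr_lt0.
have v0 : z.2 = 0.
  by apply/eqP; rewrite -sqrf_eq0 -(inj_eq (addrI (z.1 ^+ 2))) addr0; apply/eqP.
by rewrite ltrz0; move: up; rewrite /upper v0 ltxx eqxx leNgt /= => /negbTE ->.
Qed.

Lemma arg_gt0 (z : Z2) : 0 < z.2 -> 0 < arg z.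
Proof.
move=> v0; have z0 : z != 0 by apply: contraTneq v0 => ->.
rewrite acos_gt0//; have /andP[-> h1] := ratio_le1 z0; rewrite /=.
have n0 := znorm_gt0 z0; rewrite lt_neqAle h1 andbT; apply/eqP => h.
have u0 : z.1%:~R = znorm z :> R by rewrite -[LHS](divfK (lt0r_neq0 n0)) h mul1r.
have : znorm z ^+ 2 = (z.1%:~R) ^+ 2 :> R by rewrite u0.
rewrite sqr_sqrtr ?ler0z; last by nia.
by rewrite intr_sqr => /eqP; rewrite eqr_int => /eqP e; nia.
Qed.

Lemma arg_axis (z : Z2) : z.2 = 0 -> 0 < z.1 -> arg z = 0.
Proof.
case: z => [u v] /= -> u0; rewrite /arg /znorm /= expr0n addr0 rmorphXn/= sqrtr_sqr.
by rewrite ger0_norm ?ler0z ?(ltW u0)// divff ?acos1// intr_eq0 gt_eqF.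
Qed.

Lemma rot45D (q e : Z2) : rot45 (q + e) = rot45 q + rot45 e.
Proof. by case: q e => [a b] [c d]; congr pair => /=; ring. Qed.

Lemma rot45_eq0 (q : Z2) : rot45 q = 0 -> q = 0.
Proof.
case: q => [a b] h; have h1 := congr1 fst h; have h2 := congr1 snd h.
by rewrite /= in h1 h2; congr pair; lia.
Qed.

(** * Lifting a lattice path to the sheets *)

Section Path.
Variables (p : nat -> Z2) (k : nat).
Hypotheses (k0 : (0 < k)%N) (p0 : p 0%N = (k%:Z, k%:Z)).
Hypothesis p_step : forall n, p n.+1 - p n \in unit_steps.

Definition sheet_path n := foldl sheet_step (0, false, (k.*2%:Z, 0)) (mkseq (fun j => p j.+1 - p j) n).

Let sheet_pathS n : sheet_path n.+1 = sheet_step (sheet_path n) (p n.+1 - p n).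
Proof. by rewrite /sheet_path mkseqS foldl_rcons. Qed.

Definition sheet_angle (s : int * bool * Z2) : R := pi * s.1.1%:~R + arg s.2.

(** The state [s] represents the lattice point [q]. That [b] is the parity of [m] is recorded
    through cos (pi m), the form used in polar coordinates. *)
Definition above (s : int * bool * Z2) (q : Z2) :=
  [/\ rot45 q = (if s.1.2 then - s.2 else s.2), cos (pi * s.1.1%:~R) = (-1) ^+ s.1.2 :> R & upper s.2].

Let sin_above s q : above s q -> sin (pi * s.1.1%:~R) = 0 :> R.
Proof.
move=> [_ c _]; have := cos2Dsin2 (pi * s.1.1%:~R : R); rewrite c sqrr_sign => /eqP.
by rewrite -subr_eq0 addrAC subrr add0r sqrf_eq0 => /eqP.
Qed.

Lemma above_polar s q : above s q -> s.2 != 0 ->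
  (rot45 q).1%:~R = znorm s.2 * cos (sheet_angle s) /\
  (rot45 q).2%:~R = znorm s.2 * sin (sheet_angle s).
Proof.
move=> ab z0; have sn := sin_above ab; case: ab => [-> c up].
have [e1 e2] := arg_polar z0 up.
rewrite /sheet_angle cosD sinD sn c !mul0r subr0 add0r 2!(mulrCA (znorm _)) -e1 -e2.
by case: (s.1.2); rewrite ?expr1 ?expr0 ?mulN1r ?mul1r /= ?mulrNz.
Qed.

(** The sheet angle always moves by less than pi: without a fold both arguments lie in [0, pi);
    landing on the negative half-axis goes from a positive argument to 0; going down from the
    positive half-axis goes from 0 to a positive one. [signed_angle_polar] then identifies the
    move. *)
Lemma above_step s q e : e \in unit_steps -> above s q -> s.2 != 0 ->
  above (sheet_step s e) (q + e) /\
  ((sheet_step s e).2 != 0 -> signed_angle q (q + e) = sheet_angle (sheet_step s e) - sheet_angle s).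
Proof.
move=> eu ab z0; have sn := sin_above ab.
have [rq c up] := ab.
case: s => [[m b] z] in ab sn rq c up z0 *; rewrite /= in ab sn rq c up z0 *.
set z' := z + (if b then - rot45 e else rot45 e).
have rz' : rot45 (q + e) = if b then - z' else z'.
  by rewrite rot45D rq /z'; case: (b); rewrite ?opprD ?opprK.
have e2 : (rot45 e).2 = 1 \/ (rot45 e).2 = -1.
  by move: eu; rewrite !inE => /or4P[] /eqP ->; [right|left|left|right].
have z'2 : z'.2 = z.2 + 1 \/ z'.2 = z.2 - 1.
  have -> : z'.2 = z.2 + (if b then - (rot45 e).2 else (rot45 e).2) by rewrite /z'; case: (b).
  by case: (b); lia.
have h : above (fold_half m b z') (q + e) /\
  ((fold_half m b z').2 != 0 -> - pi < sheet_angle (fold_half m b z') - sheet_angle (m, b, z) < pi).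
  have a0 := arg_ge0 z0; have api := arg_ltpi z0 up.
  rewrite /fold_half; case: ifPn => h1.
    split; first by split.
    move=> /= z'0; rewrite /sheet_angle /=.
    by have := arg_ge0 z'0; have := arg_ltpi z'0 h1; lra.
  have cS : cos (pi * (m + 1)%:~R) = (-1) ^+ (~~ b) :> R.
    by rewrite intrD mulrDr mulr1 cosDpi c; case: (b); rewrite ?expr1 ?expr0 ?opprK.
  have cP : cos (pi * (m - 1)%:~R) = (-1) ^+ (~~ b) :> R.
    rewrite intrB mulrBr mulr1 -[LHS]opprK -cosDpi subrK c.
    by case: (b); rewrite ?expr1 ?expr0 ?opprK.
  have rz'' : rot45 (q + e) = if ~~ b then - - z' else - z' by rewrite rz'; case: (b); rewrite ?opprK.
  have N2 : (- z').2 = - z'.2 by [].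
  have N1 : (- z').1 = - z'.1 by [].
  case: ifPn => h2.
    have up' : upper (- z') by exact: upperN.
    split; first by split.
    move=> /= z'0; rewrite /sheet_angle /= intrD mulrDr mulr1.
    have -> : arg (- z') = 0 :> R.
      rewrite arg_axis ?N1 ?N2 ?(eqP h2)//; move: h1; rewrite /upper (eqP h2) ltxx eqxx /=.
      by rewrite -ltNge oppr_gt0.
    have : 0 < arg z :> R by apply: arg_gt0; move: up z'2; rewrite /upper (eqP h2); move: z.1 z.2; lia.
    by lra.
  have up' : upper (- z') by exact: upperN.
  split; first by split.
  move=> /= z'0; rewrite /sheet_angle /= intrB mulrBr mulr1.
  have -> : arg z = 0 :> R.
    have v0 : z.2 = 0 by move: up h1 h2 z'2; rewrite /upper; move: z'.1 z'.2 z.1 z.2; lia.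
    rewrite arg_axis//; move: up; rewrite /upper v0 ltxx eqxx /= le_eqVlt => /predU1P[u0|//].
    by case/eqP: z0; rewrite (surjective_pairing z) -u0 v0.
  have : 0 < arg (- z') :> R by apply: arg_gt0; rewrite N2; move: h1 h2; rewrite /upper; move: z'.1 z'.2; lia.
  by have := arg_ltpi z'0 up'; lra.
rewrite /sheet_step (negbTE z0); split; first by have [] := h.
move=> z'0; have [ab' /(_ z'0) d] := h.
have [q1 q2] := above_polar ab z0; have [q1' q2'] := above_polar ab' z'0.
by apply: (signed_angle_polar (znorm_gt0 z0) (znorm_gt0 z'0) q1 q2 q1' q2' d).
Qed.

Lemma above_path n : (forall j, (j < n)%N -> p j != 0) ->
  above (sheet_path n) (p n) /\
  (p n != 0 -> sheet_angle (sheet_path n) = \sum_(0 <= j < n) signed_angle (p j) (p j.+1)).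
Proof.
elim: n => [|n IH] pn.
  split.
    rewrite p0 /sheet_path /=; split; last by rewrite /upper.
      by rewrite /rot45; congr pair => /=; lia.
    by rewrite /= mulr0 cos0 expr0.
  by rewrite big_geq// /sheet_angle /= mulr0 add0r arg_axis//=; lia.
have [ab /(_ (pn _ (ltnSn n))) sa] := IH (fun j jn => pn j (ltnW jn)).
have z0 : (sheet_path n).2 != 0.
  apply: contraNneq (pn _ (ltnSn n)) => z0; apply/eqP/rot45_eq0; have [-> _ _] := ab.
  by rewrite z0; case: ifP; rewrite ?oppr0.
have [ab' sg] := above_step (p_step n) ab z0; rewrite -sheet_pathS addrC subrK in ab' sg *.
split=> // q0; rewrite (big_nat_recr n 0)//= -sa sg; first by rewrite [RHS]addrC subrK.
apply: contraNneq q0 => z0'; apply/eqP/rot45_eq0; have [-> _ _] := ab'.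
by rewrite z0'; case: ifP; rewrite ?oppr0.
Qed.

(** The angle is pi m plus an argument in [0, pi), so the floor taken in the rounding is m: the
    rounded angle only depends on the half turns. *)
Lemma round_half_pi_sheet (s : int * bool * Z2) : s.2 != 0 -> upper s.2 ->
  round_half_pi (sheet_angle s) = pi * (s.1.1%:~R + 1 / 2).
Proof.
move=> z0 up; rewrite /round_half_pi; congr (pi * (_%:~R + _)).
have pi0 := @pi_gt0 R.
apply: Num.Theory.floor_def; rewrite /sheet_angle mulrDl mulrAC divff ?gt_eqF// mul1r.
rewrite lerDl divr_ge0 ?arg_ge0 ?(ltW pi0)//= intrD ltrD2l ltr_pdivrMr// mul1r.
exact: arg_ltpi.
Qed.

Lemma sheet_path_height n : (forall j, (j < n)%N -> p j != 0) ->
  `|(rot45 (p n)).2|%N = `|(sheet_path n).2.2|%N.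
Proof.
by move=> /above_path [[-> _ _] _]; case: ifP => // _; rewrite abszN.
Qed.

Let absorbed t n : (t <= n)%N -> (sheet_path t).2 = 0 -> sheet_path n = sheet_path t.
Proof.
move=> tn z0; elim: n tn => [|n IH]; first by rewrite leqn0 => /eqP->.
rewrite leq_eqVlt => /predU1P[->//|]; rewrite ltnS => /IH e.
by rewrite sheet_pathS e; move: z0; case: (sheet_path t) => [[m b] z] /= ->; rewrite eqxx.
Qed.

Let above_zero s : above s 0 -> s.2 = 0.
Proof.
by case: s => [[m b] [u v]] [/= h _ _]; move: h; case: b => /= -[h1 h2]; congr pair; lia.
Qed.

Lemma sheet_path_neq0 n : (forall j, (j <= n)%N -> p j != 0) -> (sheet_path n).2 != 0.
Proof.
move=> pn; have [[r _ _] _] := above_path (fun j jn => pn j (ltnW jn)).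
apply: contraNneq (pn _ (leqnn n)) => z0; apply/eqP/rot45_eq0.
by rewrite r z0; case: ifP; rewrite ?oppr0.
Qed.

(* [t.+1] is the hitting time of the origin. *)
Lemma sheet_path_hitting t n : p t.+1 = 0 -> (forall j, (j <= t)%N -> p j != 0) ->
  (t < n)%N -> (sheet_path n).2 = 0 /\
    round_half_pi (\sum_(0 <= j < t) signed_angle (p j) (p j.+1)) = pi * ((sheet_path n).1.1%:~R + 1 / 2) :> R.
Proof.
move=> pt pj tn.
have z0 : (sheet_path t.+1).2 = 0 by have [] := above_path (n := t.+1) pj; rewrite pt => /above_zero.
rewrite (absorbed tn z0); split=> //.
have [[_ _ up] /(_ (pj _ (leqnn t))) <-] := above_path (fun j jt => pj j (ltnW jt)).
have z1 := sheet_path_neq0 pj; rewrite round_half_pi_sheet//; congr (pi * (_%:~R + _)).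
(* The step onto the origin does not change [m], since the origin is [upper]; in the other cases of
   [fold_half] the new point is nonzero. *)
move: z0; rewrite sheet_pathS /sheet_step; case: (sheet_path t) z1 up => [[m b] z] /= z1 up.
rewrite (negbTE z1) /fold_half; move: (z + _) => z'.
by case: ifPn => //= h; case: ifP => h' /= /eqP; rewrite oppr_eq0 => /eqP z'0; rewrite z'0 in h.
Qed.

End Path.
End Geometry.

(** * Characteristic function of the rounded angle *)

Section OneWalk.
Context {R : realType} d (U : measurableType d) (P : probability U R) (k : nat) (S : nat -> U -> Z2).
Hypothesis k0 : (0 < k)%N.
Hypothesis hS : simple_random_walk P (k%:Z, k%:Z) S.

Let good : set U := \bigcap_n (increment S n @^-1` [set` unit_steps]).

Let m_inc n : measurable (increment S n @^-1` [set` unit_steps]).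
Proof. exact: (discrete_rv_preimage _ (discrete_rv_increment hS n)). Qed.

Let mgood : measurable good.
Proof. by apply: bigcap_measurableType => n _; exact: m_inc. Qed.

Let bad0 : P (~` good) = 0%E.
Proof.
apply: measure_negligible; first exact: measurableC.
rewrite /good setC_bigcap; apply: negligible_bigcup => n.
apply/negligibleP; first exact: measurableC.
by apply: etrans (probability_setC P (m_inc n)) _; rewrite (increment_ae hS) subee.
Qed.

Let Rintegral_good (f : U -> R) : P.-integrable setT (EFin \o f) -> \int[P]_w f w = \int[P]_(w in good) f w.
Proof.
move=> fi; rewrite /Rintegral (@negligible_integral _ _ _ P setT (~` good))//.
- by rewrite setDE setCK setTI.
- exact: measurableC.
Qed.

Let le_good (f g : U -> R) : P.-integrable setT (EFin \o f) -> P.-integrable setT (EFin \o g) ->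
  (forall w, good w -> f w <= g w) -> \int[P]_w f w <= \int[P]_w g w.
Proof.
move=> fi gi fg; rewrite Rintegral_good// [leRHS]Rintegral_good//.
by apply: le_Rintegral => //; [exact: integrableS fi|exact: integrableS gi].
Qed.

Let start : Z2 := (k%:Z, k%:Z).
Let s0 : int * bool * Z2 := (0, false, (k.*2%:Z, 0)).
Let st n w := foldl sheet_step s0 (increments S n w).

Let stE n w : st n w = sheet_path (S^~ w) k n. Proof. by []. Qed.

Let p0 w : S 0%N w = start. Proof. exact: (srw_start hS). Qed.

Let good_step w : good w -> forall n, S n.+1 w - S n w \in unit_steps.
Proof. by move=> gw n; exact: (gw n I). Qed.

Let first_hit w n : S n w = 0 -> exists t, [/\ (t < n)%N, S t.+1 w = 0 & forall j, (j <= t)%N -> S j w != 0].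
Proof.
move=> sn; have h : exists n, S n w == 0 by exists n; rewrite sn.
case: (ex_minnP h) => -[|t] /eqP st0 tm.
  by move: st0; rewrite p0 => /eqP; rewrite xpair_eqE; lia.
exists t; split=> //; first by apply: tm; rewrite sn.
by move=> j jt; apply/negP => /tm; rewrite ltnNge jt.
Qed.

Let winding_hit w t : S t.+1 w = 0 -> (forall j, (j <= t)%N -> S j w != 0) ->
  winding_angle S w = \sum_(0 <= j < t) signed_angle (S j w) (S j.+1 w) :> R.
Proof.
move=> st0 nz; rewrite /winding_angle; suff -> : hitting_time S w = t.+1 by [].
rewrite /hitting_time; case: pselect => [h|]; last by case; exists t.+1; rewrite st0.
case: ex_minnP => m m0 mm; apply/eqP; rewrite eqn_leq mm ?st0//= ltnNge.
by apply/negP => /nz; rewrite m0.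
Qed.

Let round_st w n : good w -> (st n w).2 = 0 ->
  round_half_pi (winding_angle S w) = pi * ((st n w).1.1%:~R + 1 / 2) :> R.
Proof.
move=> gw z0; have [/asboolP[j]|/asboolP h] := boolP `[< exists j, (j <= n)%N /\ S j w = 0 >].
  move=> [jn /first_hit[t [tj st0 nz]]]; rewrite (winding_hit st0 nz).
  by have [] := sheet_path_hitting (R := R) k0 (p0 w) (good_step gw) st0 nz (leq_trans tj jn).
have : (st n w).2 != 0.
  rewrite stE; apply: (sheet_path_neq0 (R := R) k0 (p0 w) (good_step gw)) => j jn; apply/eqP => sj.
  by apply: h; exists j.
by rewrite z0 eqxx.
Qed.

Let height w n : good w -> (st n w).2 != 0 -> `|(rot45 (S n w)).2|%N = `|(st n w).2.2|%N.
Proof.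
move=> gw z0; apply: (sheet_path_height (R := R) k0 (p0 w) (good_step gw)) => j jn; apply/eqP => sj.
have [t [tj st0 nz]] := first_hit sj.
have [z0' _] := sheet_path_hitting (R := R) k0 (p0 w) (good_step gw) st0 nz (leq_trans tj (ltnW jn)).
by rewrite stE z0' eqxx in z0.
Qed.

(** The height is followed on the unstopped walk, where it is a chain by itself; as long as the
    sheet walk is alive, [height] identifies the two in absolute value. *)
Let heightE n w : (rot45 (S n w)).2 = foldl height_step 0 (increments S n w).
Proof.
elim: n => [|n IH]; first by rewrite p0 /rot45 /= subrr.
by rewrite /increments mkseqS foldl_rcons -/(increments S n w) -IH /height_step -{1}(subrK (S n w) (S n.+1 w)) addrC rot45D.
Qed.

Let alive (s : int * bool * Z2) : R := (s.2 != 0)%:R.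
Let alive_le1 s : `|alive s| <= 1. Proof. by rewrite /alive; case: eqP; rewrite ?normr0 ?normr1. Qed.

(** Up to a null event, the probability that the origin has not been hit by time [n]. *)
Let q n : R := \int[P]_w alive (st n w).

(** The indicator of -V <= v < V, split into points so that [iter_height_mean] applies to each
    term. *)
Let small (V : nat) (v : int) : R := \sum_(i < V.*2) (v == i%:Z - V%:Z)%:R.

Let small_ge0 V v : 0 <= small V v. Proof. exact: sumr_ge0. Qed.

Let small_ge1 V v : (`|v|%N < V)%N -> 1 <= small V v.
Proof.
move=> vV; have h : (`|(v + V%:Z)%R|%N < V.*2)%N by lia.
rewrite /small (bigD1 (Ordinal h))//= (_ : v == _); last by apply/eqP; lia.
by rewrite lerDl; apply: sumr_ge0.
Qed.

Let small_le V v : `|small V v| <= V.*2%:R.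
Proof.
rewrite ger0_norm//; apply: (@le_trans _ _ (\sum_(i < V.*2) 1)).
  by apply: ler_sum => i _; case: (_ == _).
by rewrite sumr_const card_ord.
Qed.

Lemma iter_step_mean_sum (X : Type) (step : X -> Z2 -> X) n m (g : 'I_m -> X -> R) x :
  iter n (step_mean step) (fun x => \sum_(i < m) g i x) x = \sum_(i < m) iter n (step_mean step) (g i) x.
Proof.
elim: n x => [//|n IH] x; rewrite iterS /step_mean.
under eq_bigr do rewrite IH.
by rewrite exchange_big /= mulr_sumr; apply: eq_bigr => i _.
Qed.

Let cvg_sum0 m (F : nat -> nat -> R) : (forall i, F i n @[n --> \oo] --> (0 : R)) ->
  \sum_(i < m) F i n @[n --> \oo] --> (0 : R).
Proof.
move=> cF; elim: m => [|m IH]; first by under eq_fun do rewrite big_ord0; exact: cvg_cst.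
have h := cvgD IH (cF m); rewrite addr0 in h.
by under eq_fun do rewrite big_ord_recr; exact: h.
Qed.

Let cvg_small V : \int[P]_w small V (foldl height_step 0 (increments S n w)) @[n --> \oo] --> (0 : R).
Proof.
under eq_fun do rewrite (expectation_chain hS height_step 0 (small_le V)) iter_step_mean_sum.
apply: (@cvg_sum0 _ (fun i n => iter n (step_mean height_step) (fun v => (v == i%:Z - V%:Z)%:R) 0)) => i.
under eq_fun do rewrite iter_height_mean; exact: cvg_fourier_kernel.
Qed.

(** * Stopping the harmonic function at a finite time *)

Section OneBeta.
Variables (beta phi : R).
Hypothesis b01 : 0 < beta <= 1.

Let G := sheet_potential beta phi.
Let G_le1 s : `|G s| <= 1. Proof. exact: potential_le1. Qed.

Let inv0 : sheet_inv s0.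
Proof. by split; [|exists k%:Z; rewrite /= addr0; lia]. Qed.

Let potential_st n : \int[P]_w G (st n w) = potential beta (pi * beta / 2 + phi) k.*2%:Z 0.
Proof.
rewrite (expectation_chain hS sheet_step s0 G_le1).
rewrite (iter_step_mean (inv := sheet_inv)); [|exact: sheet_step_inv|exact: sheet_potential_mean|exact: inv0].
by rewrite /G /sheet_potential /= add0r mul1r.
Qed.

Let integrable_st n : P.-integrable setT (EFin \o (fun w => G (st n w))).
Proof. exact: (integrable_chain hS sheet_step s0 G_le1). Qed.

Let integrable_alive n : P.-integrable setT (EFin \o (fun w => alive (st n w))).
Proof. exact: (integrable_chain hS sheet_step s0 alive_le1). Qed.

(** The mean of the potential at time n is its initial value. It is at most 1 on absorbed paths; a
    surviving path is either at height at least V, where [potential_le] gives the second term, or in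
    the band counted by [small]. *)
Lemma potential_escape n V :
  potential beta (pi * beta / 2 + phi) k.*2%:Z 0 <= 1 - q n
   + sin (pi * beta / 2) / pi * cot_int (1 - beta) (fun t => `|tan_ratio t| ^+ V)
   + \int[P]_w small V (foldl height_step 0 (increments S n w)).
Proof.
set K := sin _ / _ * _.
have sin0 : 0 <= sin (pi * beta / 2) / pi.
  apply: divr_ge0; last exact: pi_ge0.
  move: b01 => /andP[h1 h2]; have pi0 := @pi_gt0 R.
  by apply: sin_ge0_pi; apply/andP; split; nra.
have b01' : 0 <= 1 - beta < 1 by move: b01 => /andP[? ?]; apply/andP; split; lra.
have ci (c : R) : P.-integrable setT (EFin \o (fun=> c)) by exact: finite_measure_integrable_cst.
have smi := integrable_chain hS height_step 0 (small_le V) n.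
have K0 : 0 <= K.
  by apply: mulr_ge0 => //; apply: cot_int_ge0 => t _; exact: exprn_ge0.
rewrite -(potential_st n) -[X in X - q n](Rintegral_cst_probability P) /q -RintegralB//.
rewrite -[K](Rintegral_cst_probability P) -RintegralD//; last exact: integrable_EFinB.
rewrite -RintegralD//; last by apply: integrable_EFinD => //; exact: integrable_EFinB.
apply: le_good => //.
  by do 2 (apply: integrable_EFinD => //); exact: integrable_EFinB.
move=> w gw; rewrite /alive; have [z0|z0] := eqVneq (st n w).2 0.
  rewrite subr0 -addrA; apply: (le_trans (ler_norm _)); apply: (le_trans (G_le1 _)).
  by rewrite lerDl addr_ge0.
rewrite subrr add0r; have := height gw z0; rewrite heightE => hE.
have [hV|hV] := ltnP `|(st n w).2.2| V.
  apply: (le_trans (ler_norm _)); apply: (le_trans (G_le1 _)).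
  by rewrite ler_wpDl// small_ge1// hE.
apply: (@le_trans _ _ K); last by rewrite lerDl.
apply: (le_trans (ler_norm _)); apply: (le_trans (potential_le b01 _ _ _)).
apply: ler_wpM2l => //.
apply: (cot_int_le b01'); try by apply/test_funX/test_fun_norm; exact: test_fun_tan_ratio.
by move=> t _; apply: ler_wiXn2l => //; exact: tan_ratio_le1.
Qed.

(** On absorbed paths the two integrands coincide by [potential_origin]; on the others each is at
    most 1 in absolute value. *)
Lemma expectation_near n :
  `|\int[P]_w cos (beta * round_half_pi (winding_angle S w) + phi)
    - potential beta (pi * beta / 2 + phi) k.*2%:Z 0| <= 2 * q n.
Proof.
pose f w := cos (beta * round_half_pi (winding_angle S w) + phi).
have fi : P.-integrable setT (EFin \o f).
  apply: (bounded_integrable P (M := 1)); last by move=> w; exact: cos_max.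
  exact: (measurable_winding_angle hS (fun x => cos (beta * round_half_pi x + phi))).
rewrite -(potential_st n) -RintegralB// /q -RintegralZl//.
have fgi : P.-integrable setT (EFin \o (fun w => f w - G (st n w))) by exact: integrable_EFinB.
apply: (le_trans (le_normr_Rintegral _ fgi)) => //.
apply: le_good; [exact: integrable_norm|exact: integrable_EFinZl|].
move=> w gw; rewrite /alive; have [z0|z0] := eqVneq (st n w).2 0.
  rewrite mulr0 /f (round_st gw z0) /G /sheet_potential z0 /= potential_origin//.
  by rewrite mulrA (mulrC beta) subrr normr0.
rewrite mulr1 (le_trans (ler_normB _ _))// -[2]/(1 + 1) lerD//; exact: cos_max.
Qed.

End OneBeta.

Let q_ge0 n : 0 <= q n.
Proof. by apply: Rintegral_ge0 => w _; rewrite /alive. Qed.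

Let q_bound beta n V : 0 < beta <= 1 ->
  q n <= (1 - potential beta (pi * beta / 2) k.*2%:Z 0)
    + sin (pi * beta / 2) / pi * cot_int (1 - beta) (fun t => `|tan_ratio t| ^+ V)
    + \int[P]_w small V (foldl height_step 0 (increments S n w)).
Proof. by move=> b01; have := @potential_escape beta 0 b01 n V; rewrite addr0; lra. Qed.

(** As beta tends to 0, the initial value tends to half the coefficient of index 2k of (1 + x) / (1
    - x), which is 1. *)
Let cvg_start (e : R) : 0 < e ->
  exists beta, 0 < beta <= 1 /\ 1 - potential beta (pi * beta / 2) k.*2%:Z 0 < e.
Proof.
move=> e0.
pose f (b : R) := half_moebius_coef (1 - b) k.*2 / (2 * cos (pi * b / 2)).
have f0 : f 0 = 1.
  rewrite /f; case: k k0 => // j _; rewrite subr0 doubleS half_moebius_coef1.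
  by rewrite mulr0 mul0r cos0 mulr1 divff.
have c : f b @[b --> (0 : R)] --> (1 : R).
  have c1 : continuous (fun b : R => half_moebius_coef (1 - b) k.*2).
    move=> x; apply: (@continuous_comp R R R (fun b => 1 - b) (fun a => half_moebius_coef a k.*2)).
      by apply: cvgB; [exact: cvg_cst|exact: cvg_id].
    exact: continuous_half_moebius_coef.
  have c2 : continuous (fun b : R => 2 * cos (pi * b / 2)).
    move=> x; apply: cvgMr; apply: (@continuous_comp _ _ _ (fun b => pi * b / 2)); last exact: continuous_cos.
    by apply: cvgMl; apply: cvgMr; exact: cvg_id.
  rewrite -f0; apply: cvgM; first exact: c1.
  by apply: cvgV; [rewrite mulr0 mul0r cos0 mulr1|exact: c2].
have /cvgrPdist_lt /(_ e e0) := c.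
move=> /nbhs_ballP[r /= r0 hr].
pose b := Num.min (1 / 2) (r / 2).
have b0 : 0 < b by rewrite lt_min !divr_gt0.
have b1 : b <= 1 / 2 by rewrite ge_min lexx.
have br : b < r by rewrite gt_min; apply/orP; right; lra.
have b1' : b < 1 by lra.
have b01 : 0 < b <= 1 by rewrite b0 ltW.
exists b; split=> //; have := hr b; rewrite /ball /= sub0r normrN gtr0_norm// => /(_ br).
rewrite /f -(potential_start_re b01 k0 b1') mulfK; first by apply: le_lt_trans; exact: ler_norm.
have pi0 := @pi_gt0 R.
by rewrite mulf_neq0// gt_eqF// cos_gt0_pihalf//; apply/andP; split; nra.
Qed.

(** The three error terms are made small in turn: by the choice of beta, then of V for this beta,
    then of n for this V. *)
Let cvg_q : q n @[n --> \oo] --> (0 : R).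
Proof.
apply/cvgr0Pnorm_lt => e e0.
have e3 : 0 < e / 3 by rewrite divr_gt0.
have [b [b01 hb]] := cvg_start e3.
have b01' : 0 <= 1 - b < 1 by move: b01 => /andP[? ?]; apply/andP; split; lra.
have c : sin (pi * b / 2) / pi * cot_int (1 - b) (fun t => `|tan_ratio t| ^+ V) @[V --> \oo] --> (0 : R).
  rewrite -[X in _ --> X](mulr0 (sin (pi * b / 2) / pi)); apply: cvgMr.
  by apply: (cvg_cot_int_expn b01'); [exact: test_fun_tan_ratio|exact: tan_ratio_lt1].
have [V hV] : exists V, sin (pi * b / 2) / pi * cot_int (1 - b) (fun t => `|tan_ratio t| ^+ V) < e / 3.
  have h := cvgr_lt _ c _ e3.
  by near \oo => V; exists V; near: V; exact: h.
have h := cvgr_lt _ (cvg_small V) _ e3.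
near=> n; rewrite ger0_norm//; apply: (le_lt_trans (q_bound n V b01)).
have : \int[P]_w small V (foldl height_step 0 (increments S n w)) < e / 3 by near: n; exact: h.
by lra.
Unshelve. all: by end_near. Qed.

Lemma expectation_cos (beta phi : R) : 0 < beta <= 1 ->
  \int[P]_w cos (beta * round_half_pi (winding_angle S w) + phi) = potential beta (pi * beta / 2 + phi) k.*2%:Z 0.
Proof.
move=> b01; apply/eqP; rewrite -subr_eq0 -normr_le0.
have c : 2 * q n @[n --> \oo] --> (0 : R).
  by rewrite -[X in _ --> X](mulr0 (2 : R)); apply: cvgMr; exact: cvg_q.
apply: (cvgr_to_ge c); apply: nearW => n; exact: expectation_near.
Qed.

Let E_cos beta : R := \int[P]_w cos (beta * round_half_pi (winding_angle S w)).
Let E_sin beta : R := \int[P]_w sin (beta * round_half_pi (winding_angle S w)).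

Let E_cos_lt1 beta : 0 < beta < 1 ->
  E_cos beta = half_moebius_coef (1 - beta) k.*2 / (2 * cos (pi * beta / 2)).
Proof.
move=> /andP[b0 b1]; have b01 : 0 < beta <= 1 by rewrite b0 ltW.
rewrite -(potential_start_re b01 k0 b1) mulfK.
  have := expectation_cos 0 b01; rewrite addr0 => <-.
  by apply: eq_Rintegral => w _; rewrite addr0.
have pi0 := @pi_gt0 R.
by rewrite mulf_neq0// gt_eqF// cos_gt0_pihalf//; apply/andP; split; nra.
Qed.

Let E_sin_le1 beta : 0 < beta <= 1 -> E_sin beta = 0.
Proof.
move=> b01; rewrite -(potential_start_im b01 k0) -(expectation_cos (- (pi / 2)) b01).
by apply: eq_Rintegral => w _; rewrite cosBpihalf.
Qed.

Let charfun_formula beta := E_cos beta = cos (pi * beta / 2) * h_down (cos (pi * beta)) k /\ E_sin beta = 0.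

Let charfun_formula_le1 beta : 0 <= beta <= 1 -> charfun_formula beta.
Proof.
move=> /andP[]; rewrite le_eqVlt => /predU1P[<-|b0].
  move=> _; split.
    rewrite mulr0 mul0r cos0 /h_down gtn_eqF// eqxx mulr1 -[RHS](Rintegral_cst_probability P).
    by apply: eq_Rintegral => w _; rewrite mul0r cos0.
  rewrite -[RHS](Rintegral_cst_probability P).
  by apply: eq_Rintegral => w _; rewrite mul0r sin0.
rewrite le_eqVlt => /predU1P[->|b1].
  (* At beta = 1 both sides are 0: the cosine factor on the right, the potential at a = 0 on the
     left. *)
  have b01 : 0 < (1 : R) <= 1 by rewrite ltr01 lexx.
  split; last exact: E_sin_le1.
  rewrite mulr1 cos_pihalf mul0r -(potential_start_re1 k0 (erefl (1 : R))).
  rewrite -[pi * 1 / 2]addr0 -(expectation_cos _ b01).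
  by apply: eq_Rintegral => w _; rewrite addr0.
have b01 : 0 < beta < 1 by rewrite b0 b1.
split; last by apply: E_sin_le1; rewrite b0 ltW.
rewrite (E_cos_lt1 b01) (h_down_coef b01 k0).
have pi0 := @pi_gt0 R.
have c0 : cos (pi * beta / 2) != 0 by rewrite gt_eqF// cos_gt0_pihalf//; apply/andP; split; nra.
have -> : 1 + cos (pi * beta) = 2 * cos (pi * beta / 2) ^+ 2.
  have {1}-> : pi * beta = pi * beta / 2 + pi * beta / 2 by field.
  by rewrite cosD -!expr2 -[sin _ ^+ 2](addKr (cos (pi * beta / 2) ^+ 2)) cos2Dsin2; ring.
by move: (half_moebius_coef _ _) c0 => x c0; field.
Qed.

Let charfun_formulaN beta : charfun_formula beta -> charfun_formula (- beta).
Proof.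
move=> [h1 h2]; split.
  rewrite !mulrN mulNr !cosN -h1.
  by apply: eq_Rintegral => w _; rewrite mulNr cosN.
transitivity (\int[P]_w (-1 * sin (beta * round_half_pi (winding_angle S w)))).
  by apply: eq_Rintegral => w _; rewrite mulN1r mulNr sinN.
rewrite RintegralZl//; first by rewrite -/(E_sin beta) h2 mulr0.
apply: (bounded_integrable P (M := 1)); last by move=> w; exact: sin_max.
exact: (measurable_winding_angle hS (fun x => sin (beta * round_half_pi x))).
Qed.

Let cosDpi_odd (x : R) (m : int) : cos (x + pi * (2 * m%:~R + 1)) = - cos x /\ sin (x + pi * (2 * m%:~R + 1)) = - sin x.
Proof.
suff h (n : nat) (y : R) : cos (y + pi * (2 * n%:R)) = cos y /\ sin (y + pi * (2 * n%:R)) = sin y.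
  have [hc hs] : cos (x + pi * (2 * m%:~R)) = cos x /\ sin (x + pi * (2 * m%:~R)) = sin x.
    case: m => n; first exact: h.
    have := h n.+1 (x + pi * (2 * (Negz n)%:~R)); rewrite NegzE mulrNz -pmulrn.
    by rewrite -addrA -mulrDr -mulrDr addNr !mulr0 addr0 => -[<- <-].
  by rewrite mulrDr mulr1 addrA cosDpi sinDpi hc hs.
elim: n => [|n [IH1 IH2]]; first by rewrite !mulr0 addr0.
have -> : y + pi * (2 * n.+1%:R) = y + pi * (2 * n%:R) + pi + pi by rewrite -natr1; ring.
by rewrite !(cosDpi, sinDpi) !opprK.
Qed.

(** The rounded angle is an odd multiple of pi / 2, so the phase gains an odd multiple of pi and the
    expectation changes sign, as does cos (pi beta / 2). *)
Let charfun_formulaD2 beta : charfun_formula beta -> charfun_formula (beta + 2).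
Proof.
move=> [h1 h2].
have rE w : exists m : int, (beta + 2) * round_half_pi (winding_angle S w) =
    beta * round_half_pi (winding_angle S w) + pi * (2 * m%:~R + 1).
  exists (Num.floor (winding_angle S w / pi : R)).
  by rewrite mulrDl; congr (_ + _); rewrite /round_half_pi; field.
have mc : P.-integrable setT (EFin \o (fun w => cos (beta * round_half_pi (winding_angle S w)))).
  apply: (bounded_integrable P (M := 1)); last by move=> w; exact: cos_max.
  exact: (measurable_winding_angle hS (fun x => cos (beta * round_half_pi x))).
have ms : P.-integrable setT (EFin \o (fun w => sin (beta * round_half_pi (winding_angle S w)))).
  apply: (bounded_integrable P (M := 1)); last by move=> w; exact: sin_max.
  exact: (measurable_winding_angle hS (fun x => sin (beta * round_half_pi x))).
split.
  have -> : pi * (beta + 2) / 2 = pi * beta / 2 + pi :> R by field.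
  have -> : pi * (beta + 2) = pi * beta + pi + pi :> R by ring.
  rewrite !cosDpi opprK mulNr -h1 -mulN1r -RintegralZl//.
  by apply: eq_Rintegral => w _; have [m ->] := rE w; rewrite mulN1r; case: (cosDpi_odd (beta * round_half_pi (winding_angle S w)) m).
transitivity (-1 * E_sin beta); last by rewrite h2 mulr0.
rewrite -RintegralZl//.
by apply: eq_Rintegral => w _; have [m ->] := rE w; rewrite mulN1r; case: (cosDpi_odd (beta * round_half_pi (winding_angle S w)) m).
Qed.

Lemma charfun_round beta :
  \int[P]_w cos (beta * round_half_pi (winding_angle S w)) = cos (pi * beta / 2) * h_down (cos (pi * beta)) k /\
  \int[P]_w sin (beta * round_half_pi (winding_angle S w)) = 0.
Proof.
suff h (b : R) : 0 <= b -> charfun_formula b.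
  have [b0|b0] := leP 0 beta; first exact: h.
  by rewrite -[beta]opprK; apply: charfun_formulaN; apply: h; rewrite oppr_ge0 ltW.
(* With n the integer part of (b + 1) / 2, the remainder b - 2n lies in [-1, 1]. *)
move=> b0; have : 0 <= (b + 1) / 2 by lra.
move=> /truncn_itv; move: (Num.truncn _) => n /andP[n1 n2].
have -> : b = (b - 2 * n%:R) + 2 * n%:R by ring.
rewrite -[n.+1%:R]natr1 in n2.
have : (-1 : R) <= b - 2 * n%:R <= 1.
  by apply/andP; split; lra.
move: (b - _) => c c1; elim: {n1 n2} n => [|n IH].
  rewrite mulr0 addr0; move: c1 => /andP[c1 c2].
  have [c0|c0] := leP 0 c; first by apply: charfun_formula_le1; rewrite c0.
  by rewrite -[c]opprK; apply/charfun_formulaN/charfun_formula_le1; apply/andP; split; lra.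
by rewrite -[n.+1%:R]natr1 mulrDr mulr1 addrA; exact: charfun_formulaD2.
Qed.

Lemma charfun_round_lt1 beta : 0 < beta < 1 ->
  \int[P]_w cos (beta * round_half_pi (winding_angle S w))
    = half_moebius_coef (1 - beta) k.*2 / (2 * cos (pi * beta / 2)).
Proof. exact: E_cos_lt1. Qed.

End OneWalk.

(** * Limit law *)

Section LimitLaw.
Context {R : realType}.

Lemma cos_dist_le (x y : R) : `|cos x - cos y| <= `|x - y|.
Proof.
wlog xy : x y / x <= y => [h|].
  by have [/h//|/ltW/h] := leP x y; rewrite distrC [leRHS]distrC.
have cc : {within `[x, y], continuous (@cos R)}.
  by apply: continuous_subspaceT; exact: continuous_cos.
have [c _ e] := MVT_segment xy (fun z _ => is_derive_cos z) cc.
rewrite distrC [leRHS]distrC e normrM normrN ler_piMl//; exact: sin_max.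
Qed.

Lemma round_half_pi_dist (x : R) : `|x - round_half_pi x| <= pi.
Proof.
have pi0 := @pi_gt0 R; have /andP[h1 h2] := floor_itv (x / pi).
rewrite intrD ler_pdivlMr// ltr_pdivrMr// in h1 h2; move: h1 h2; rewrite /round_half_pi.
move: (_%:~R) => m h1 h2; rewrite ler_norml; apply/andP; split; nra.
Qed.

(** Rounding moves the angle by a bounded amount, which disappears when beta = t / ln k tends to 0.
    The phase [phi] treats cosine and sine at once. *)
Lemma winding_round_dist d (U : measurableType d) (P : probability U R) (k : nat) (S : nat -> U -> Z2)
    (beta phi : R) : 0 <= beta -> simple_random_walk P (k%:Z, k%:Z) S ->
  `|\int[P]_w cos (beta * winding_angle S w + phi)
    - \int[P]_w cos (beta * round_half_pi (winding_angle S w) + phi)| <= pi * beta.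
Proof.
move=> b0 hS.
have i1 : P.-integrable setT (EFin \o (fun w => cos (beta * winding_angle S w + phi))).
  apply: (bounded_integrable P (M := 1)); last by move=> w; exact: cos_max.
  exact: (measurable_winding_angle hS (fun x => cos (beta * x + phi))).
have i2 : P.-integrable setT (EFin \o (fun w => cos (beta * round_half_pi (winding_angle S w) + phi))).
  apply: (bounded_integrable P (M := 1)); last by move=> w; exact: cos_max.
  exact: (measurable_winding_angle hS (fun x => cos (beta * round_half_pi x + phi))).
rewrite -RintegralB//; apply: Rintegral_bounded.
  apply: (measurable_winding_angle hS (fun x => cos (beta * x + phi) - cos (beta * round_half_pi x + phi))).
move=> w; apply: (le_trans (cos_dist_le _ _)).
rewrite opprD addrACA subrr addr0 -mulrBr normrM ger0_norm// mulrC ler_wpM2r//.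
exact: round_half_pi_dist.
Qed.

Section Limit.
Context (d : nat -> measure_display) (T : forall k, measurableType (d k))
  (P : forall k, probability (T k) R) (S : forall k, nat -> T k -> Z2).
Hypothesis S_walk : forall k, (1 <= k)%N -> simple_random_walk (P k) (k%:Z, k%:Z) (@S k).

Lemma cvg_charfun (t phi l : R) : 0 < t ->
  \int[P k]_w cos (t / ln k%:R * round_half_pi (winding_angle (@S k) w) + phi) @[k --> \oo] --> l ->
  \int[P k]_w cos (t * (winding_angle (@S k) w / ln k%:R) + phi) @[k --> \oo] --> l.
Proof.
move=> t0 c.
have cb : t / ln k%:R @[k --> \oo] --> (0 : R).
  by rewrite -[X in _ --> X](mulr0 t); apply: cvgMr; exact: cvg_lnV.
have cpb : pi * (t / ln k%:R) @[k --> \oo] --> (0 : R).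
  by rewrite -[X in _ --> X](mulr0 (pi : R)); apply: cvgMr.
apply: cvg_sub0 c; apply/norm_cvg0P; apply: (squeeze_cvgr _ (cvg_cst 0) cpb).
near=> k; rewrite normr_ge0 /=.
have k1 : (1 <= k)%N by near: k; exact: nbhs_infty_ge.
have b0 : 0 <= t / ln k%:R by rewrite divr_ge0 ?ln_ge0 ?ler1n// ltW.
apply: le_trans (winding_round_dist phi b0 (S_walk k1)).
apply/le_of_eq; rewrite !fctE; congr `|_ - _|.
by apply: eq_Rintegral => w _; rewrite mulrA mulrAC.
Unshelve. all: by end_near. Qed.

Let charfun_cos t : 0 < t ->
  \int[P k]_w cos (t * (winding_angle (@S k) w / ln k%:R) + 0) @[k --> \oo] --> expR (- t).
Proof.
move=> t0; apply: cvg_charfun => //.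
have cb : pi * (t / ln k%:R) / 2 @[k --> \oo] --> (0 : R).
  have h := cvgMl (b := 2^-1 : R) (cvgMr (a := pi : R) (cvgMr (a := t) (@cvg_lnV R))).
  by rewrite !mulr0 mul0r in h; exact: h.
have c : half_moebius_coef (1 - t / ln k%:R) k.*2 / (2 * cos (pi * (t / ln k%:R) / 2)) @[k --> \oo] --> expR (- t).
  have -> : expR (- t) = 2 * expR (- t) / (2 * cos 0) by rewrite cos0 mulr1 mulrAC divff// mul1r.
  apply: cvgM; first exact: cvg_half_moebius_coef.
  apply: cvgV; first by rewrite cos0 mulr1.
  apply: cvgMr; apply: (@cvg_comp _ _ _ (fun k : nat => pi * (t / ln k%:R) / 2) (@cos R)); first exact: cb.
  exact: continuous_cos.
apply: cvg_trans c; apply: near_eq_cvg; near=> k.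
have k1 : (1 < k)%N by near: k; exact: nbhs_infty_gt.
have l0 : 0 < ln k%:R :> R by rewrite ln_gt0// ltr1n.
have b01 : 0 < t / ln k%:R < 1.
  rewrite divr_gt0//= ltr_pdivrMr// mul1r.
  have : expR (t + 1) <= k%:R by near: k; exact: nbhs_infty_ger.
  by rewrite -ler_ln ?posrE ?expR_gt0 ?ltr0n ?(ltnW k1)// expRK; lra.
rewrite -(charfun_round_lt1 (ltnW k1) (S_walk (ltnW k1)) b01).
by apply: eq_Rintegral => w _; rewrite addr0.
Unshelve. all: by end_near. Qed.

Let charfun_sin t : 0 < t ->
  \int[P k]_w cos (t * (winding_angle (@S k) w / ln k%:R) + (- (pi / 2))) @[k --> \oo] --> (0 : R).
Proof.
move=> t0; apply: cvg_charfun => //.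
apply: cvg_near_cst; near=> k.
have k1 : (1 <= k)%N by near: k; exact: nbhs_infty_ge.
have [_ e] := charfun_round k1 (S_walk k1) (t / ln k%:R).
apply: etrans e.
by apply: eq_Rintegral => w _; rewrite cosBpihalf.
Unshelve. all: by end_near. Qed.

Lemma cvg_winding_cauchy :
  cvg_in_distribution P (fun k w => winding_angle (@S k) w / ln k%:R) (@cauchy_prob R).
Proof.
(* The index is shifted because the walks are given from k = 1 on. *)
pose X k w := winding_angle (@S k.+1) w / ln k.+1%:R : R.
have : cvg_in_distribution (fun k => P k.+1) X (@cauchy_prob R).
  apply: cvg_in_distribution_cauchy.
  - by move=> n; exact: (measurable_winding_angle (S_walk (ltn0Sn n)) (fun x => x / ln n.+1%:R)).
  - move=> t /charfun_cos; rewrite -cvg_shiftS /=; apply: cvg_trans; apply: near_eq_cvg; apply: nearW => n.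
    by apply: eq_Rintegral => w _; rewrite addr0.
  - move=> t /charfun_sin; rewrite -cvg_shiftS /=; apply: cvg_trans; apply: near_eq_cvg; apply: nearW => n.
    by apply: eq_Rintegral => w _; rewrite cosBpihalf.
move=> h f cf bf; rewrite -cvg_shiftS; exact: h.
Qed.

End Limit.
End LimitLaw.

Theorem theorem6 (R : realType) (d : nat -> measure_display)
    (T : forall k : nat, measurableType (d k))
    (P : forall k : nat, probability (T k) R)
    (S : forall k : nat, nat -> T k -> Z2)
    (S_walk : forall k : nat, (1 <= k)%N ->
      simple_random_walk (P k) (k%:Z, k%:Z) (S k)) :
  (forall (k : nat) (beta : R), (1 <= k)%N ->
    complex_expectation (P k)
      (fun w => cis (beta * round_half_pi (winding_angle (S k) w)))
    = Complex (cos (pi * beta / 2) * h_down (cos (pi * beta)) k) 0)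
  /\
  cvg_in_distribution P
    (fun k w => winding_angle (S k) w / ln k%:R) (@cauchy_prob R).
Proof.
split; last exact: cvg_winding_cauchy.
move=> k beta k1; have [hc hs] := charfun_round k1 (S_walk k k1) beta.
by rewrite /complex_expectation unlock /= -hc -[in RHS]hs.
Qed.
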